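(* $M(\mathrm{odd})$ is spanned over $\mathbb{Z}/2$ by the products $F^{i}G^{j}$ with $i,j\ge 0$ and $i+j$ odd.
   Context: For even $k\ge 0$, $M_{k}$ is the set of $f\in\mathbb{Z}/2[[x]]$ for which there is a modular form of weight $k$ for $\Gamma_{0}(5)$ whose expansion at infinity (in $x=e^{2\pi i z}$) lies in $\mathbb{Z}[[x]]$ and reduces mod $2$ to $f$; $M=\bigcup_{m}M_{4m}$ and $M(\mathrm{odd})=M\cap x\,\mathbb{Z}/2[[x^{2}]]$. In $\mathbb{Z}/2[[x]]$ let $F=\sum_{n\ \mathrm{odd},\,n>0}x^{n^{2}}$ and $G=F(x^{5})$. *)

(* Defs.v *)
From Stdlib Require Import Reals ZArith Arith List Bool.
From Coquelicot Require Import Coquelicot.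
Import ListNotations.

Open Scope C_scope.

Fixpoint cpow (z : C) (n : nat) : C :=
  match n with O => 1 | S m => z * cpow z m end.

Definition in_H (z : C) : Prop := (0 < Im z)%R.

(* x = e^{2 pi i z} *)
Definition qparam (z : C) : C :=
  (exp (- 2 * PI * Im z) * cos (2 * PI * Re z),
   exp (- 2 * PI * Im z) * sin (2 * PI * Re z))%R.

Definition moeb (a b c d : Z) (z : C) : C :=
  (RtoC (IZR a) * z + RtoC (IZR b)) / (RtoC (IZR c) * z + RtoC (IZR d)).

Definition automy (a b c d : Z) (z : C) : C := RtoC (IZR c) * z + RtoC (IZR d).

Definition is_modular_form_Gamma0_5 (k : nat) (f : C -> C) : Prop :=
  (forall z : C, in_H z -> ex_derive (f : C_AbsRing -> C_NormedModule) z) /\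
  (forall a b c d : Z, (a * d - b * c = 1)%Z -> (5 | c)%Z ->
     forall z : C, in_H z ->
       f (moeb a b c d z) = cpow (automy a b c d z) k * f z) /\
  (* holomorphic at all cusps: for every gamma in SL_2(Z), f|_k gamma is
     bounded as Im z -> +oo *)
  (forall a b c d : Z, (a * d - b * c = 1)%Z ->
     exists B Y : R, forall z : C, (Y < Im z)%R ->
       (Cmod (f (moeb a b c d z) / cpow (automy a b c d z) k) <= B)%R).

Definition has_expansion (f : C -> C) (a : nat -> Z) : Prop :=
  forall z : C, in_H z ->
    is_series (fun n : nat => RtoC (IZR (a n)) * cpow (qparam z) n) (f z).

Close Scope C_scope.

(** * Formal power series over Z/2, represented by coefficient functions *)

Definition ps := nat -> bool.

Definition M_k (k : nat) (h : ps) : Prop :=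
  exists (f : C -> C) (a : nat -> Z),
    is_modular_form_Gamma0_5 k f /\ has_expansion f a /\
    forall n, h n = Z.odd (a n).

Definition M (h : ps) : Prop := exists m : nat, M_k (4 * m)%nat h.

Definition M_odd (h : ps) : Prop := M h /\ forall n, Nat.even n = true -> h n = false.

Definition ps_zero : ps := fun _ => false.
Definition ps_one : ps := fun n => Nat.eqb n 0.
Definition ps_add (f g : ps) : ps := fun n => xorb (f n) (g n).

Definition ps_mul (f g : ps) : ps :=
  fun n => fold_right xorb false (map (fun k => andb (f k) (g (n - k)%nat)) (seq 0 (S n))).

Fixpoint ps_pow (f : ps) (i : nat) : ps :=
  match i with O => ps_one | S j => ps_mul f (ps_pow f j) end.

Definition F : ps :=
  fun N => existsb (fun m => andb (Nat.odd m) (Nat.eqb (m * m)%nat N)) (seq 0 (S N)).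

Definition G : ps := fun N => andb (Nat.eqb (N mod 5)%nat 0) (F (N / 5)%nat).

(* Z/2-linear combination (= finite sum, coefficients in {0,1}) of the
   monomials F^i G^j for (i,j) in the list *)
Definition sum_FG (l : list (nat * nat)) : ps :=
  fold_right (fun p acc => ps_add (ps_mul (ps_pow F (fst p)) (ps_pow G (snd p))) acc)
    ps_zero l.

(* Main.v *)
(* Writing E2 = 1 - 24 sum sigma(n) x^n, Lipschitz's partial fraction formula gives the
   quasi-modularity of E2 under z -> -1/z, hence the weight 2 form (5 E2(5z) - E2(z)) / 4 for
   Gamma_0(5), E4 = E2^2 - 12 theta E2, and 15 Delta as a Rankin-Cohen bracket of E4, all with
   integral coefficients.

   If f of weight 4m for Gamma_0(5) vanishes to order > 2m at infinity, then
   f^12 Delta(z)^(m+1) / Delta(5z)^(5m+1) has weight 0 and vanishes at both cusps, so the maximum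
   principle gives f = 0.  Weight 4 contains integral forms with leading terms 1, 15 x, -45 x^2,
   whose coefficients are odd; their reductions are 1, rho, rho^2 with rho = (E4(z) - E4(5z)) / 16.
   Eliminating the leading coefficients with their monomials shows that M_{4m} is spanned by the
   rho^i with i <= 2m.

   For odd n, sigma(n) is odd exactly when n is a square, and sigma(2n) = sigma(n) mod 2.  Hence
   rho + rho^2 = F + G =: R; comparing coefficients gives G = rho^5 + rho^6.  With s = rho^2 we get
   rho = R + s, R^2 = s + s^2 and G = R s^2, so every polynomial in rho is u(s) + R v(s).  As s is
   even and R is odd, the odd ones are the R v(s), and R s^i is an odd polynomial in F and G by
   induction on i: R s = G + R^3 and R s^(i+2) = R s^(i+1) + R^2 (R s^i). *)

Require Import Defs.
From Stdlib Require Import Reals ZArith Arith List Bool.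
From Stdlib Require Import Lra Lia Psatz Permutation.
From Stdlib Require Import FunctionalExtensionality Classical ClassicalEpsilon.
From Coquelicot Require Import Coquelicot.
Import ListNotations.
Local Open Scope R_scope.

(** Three obstacles shape the proof. The double series behind E2 converges only conditionally.
    Subtracting a telescoping term makes it absolutely convergent; the boundary terms of the
    telescope vanish along rows but not along columns, and their limit is the quasi-modular
    correction. The partial fractions themselves come from iterating duplication formulas and
    passing to a dominated limit.

    Vanishing is reached by self-improvement: each point is equivalent, through one of the two
    cusps, to a point of height at least 1/2, and the weight 0 function decays exponentially above
    height 1/4. Comparison on a strip then shrinks any global bound by exp(- PI / 4), and iterating
    forces 0. The exponents m + 1 and 5m + 1 are those for which the weight cancels and a positive
    order, bounded below independently of m, survives at both cusps.

    Holomorphy enters through second-order Taylor expansions, stable under sums, products and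
    composition; they give both the derivatives of transformation laws and a sub-mean-value
    inequality.

    Elimination stays integral: a form is multiplied by an odd leading coefficient instead of being
    divided by it, which is invisible mod 2. *)

(** * Finite sums and limits of complex sequences *)

Fixpoint rsum (a : nat -> R) (n : nat) : R :=
  match n with O => 0 | S m => rsum a m + a m end.
Fixpoint csum (a : nat -> C) (n : nat) : C :=
  match n with O => RtoC 0 | S m => (csum a m + a m)%C end.

Definition Clim (s : nat -> C) (l : C) : Prop :=
  forall eps, 0 < eps -> exists N, forall n, (N <= n)%nat -> Cmod (s n - l) < eps.

(** A total function: under [summ], and more generally whenever the partial sums converge
    ([Csum_unique]), it is their limit. *)
Definition Csum (a : nat -> C) : C :=
  (Series (fun n => Re (a n)), Series (fun n => Im (a n))).
Definition summ (a : nat -> C) : Prop := ex_series (fun n => Cmod (a n)).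

Lemma im_le_Cmod (c : C) : Rabs (Im c) <= Cmod c.
Proof.
  apply Rle_trans with (2 := Rmax_Cmod c). apply Rmax_r.
Qed.

Lemma Cmod_le_sum (c : C) : Cmod c <= Rabs (Re c) + Rabs (Im c).
Proof.
  replace c with (RtoC (Re c) + Ci * RtoC (Im c))%C at 1
    by (destruct c; unfold RtoC, Ci, Cplus, Cmult; simpl; f_equal; ring).
  eapply Rle_trans; [apply Cmod_triangle|].
  rewrite Cmod_mult, !Cmod_R, Cmod_Ci. lra.
Qed.

Lemma Re_plus (x y : C) : Re (x + y)%C = Re x + Re y. Proof. reflexivity. Qed.
Lemma Im_plus (x y : C) : Im (x + y)%C = Im x + Im y. Proof. reflexivity. Qed.
Lemma Re_minus (x y : C) : Re (x - y)%C = Re x - Re y. Proof. reflexivity. Qed.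
Lemma Im_minus (x y : C) : Im (x - y)%C = Im x - Im y. Proof. reflexivity. Qed.
Lemma Re_mult (x y : C) : Re (x * y)%C = Re x * Re y - Im x * Im y. Proof. reflexivity. Qed.
Lemma C_eq (x y : C) : Re x = Re y -> Im x = Im y -> x = y.
Proof. destruct x, y; simpl; intros; subst; reflexivity. Qed.

Lemma Cmod_minus_sym (x y : C) : Cmod (x - y) = Cmod (y - x).
Proof. rewrite <- Cmod_opp. f_equal. ring. Qed.

Lemma Cmod_triangle_inv (x y : C) : Cmod x - Cmod y <= Cmod (x - y).
Proof.
  assert (H := Cmod_triangle (x - y) y). replace (x - y + y)%C with x in H by ring. lra.
Qed.

Lemma Cmod_triangle_minus (x y : C) : Cmod (x - y) <= Cmod x + Cmod y.
Proof.
  unfold Cminus. eapply Rle_trans; [apply Cmod_triangle|]. rewrite Cmod_opp. lra.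
Qed.

Lemma Clim_const (c : C) : Clim (fun _ => c) c.
Proof.
  intros e He. exists O. intros n _. replace (c - c)%C with (RtoC 0) by ring. now rewrite Cmod_0.
Qed.

Lemma Clim_ext_ev (s t : nat -> C) l N0 :
  (forall n, (N0 <= n)%nat -> s n = t n) -> Clim s l -> Clim t l.
Proof.
  intros H Hs e He. destruct (Hs e He) as [N HN]. exists (max N N0). intros n Hn.
  rewrite <- H by lia. apply HN. lia.
Qed.

Lemma Clim_ext (s t : nat -> C) l : (forall n, s n = t n) -> Clim s l -> Clim t l.
Proof. intros H. apply Clim_ext_ev with O. auto. Qed.

Lemma Clim_plus s t l m : Clim s l -> Clim t m -> Clim (fun n => s n + t n)%C (l + m)%C.
Proof.
  intros Hs Ht e He. destruct (Hs (e/2)) as [N HN]; [lra|]. destruct (Ht (e/2)) as [N' HN']; [lra|].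
  exists (max N N'). intros n Hn.
  replace (s n + t n - (l + m))%C with ((s n - l) + (t n - m))%C by ring.
  eapply Rle_lt_trans; [apply Cmod_triangle|].
  specialize (HN n ltac:(lia)). specialize (HN' n ltac:(lia)). lra.
Qed.

Lemma Clim_mult s t l m : Clim s l -> Clim t m -> Clim (fun n => s n * t n)%C (l * m)%C.
Proof.
  intros Hs Ht e He.
  assert (Hl := Cmod_ge_0 l). assert (Hm := Cmod_ge_0 m).
  set (d := Rmin 1 (e / (2 + Cmod l + Cmod m))).
  assert (Hd : 0 < d). { apply Rmin_glb_lt; [lra|]. apply Rdiv_lt_0_compat; lra. }
  destruct (Hs d Hd) as [N HN]. destruct (Ht d Hd) as [N' HN'].
  exists (max N N'). intros n Hn.
  replace (s n * t n - l * m)%C with ((s n - l) * (t n - m) + (s n - l) * m + l * (t n - m))%C by ring.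
  specialize (HN n ltac:(lia)). specialize (HN' n ltac:(lia)).
  eapply Rle_lt_trans; [apply Cmod_triangle|].
  eapply Rle_lt_trans; [apply Rplus_le_compat_r, Cmod_triangle|].
  rewrite !Cmod_mult.
  assert (Hd1 : d <= 1) by apply Rmin_l.
  assert (Hd2 : d * (2 + Cmod l + Cmod m) <= e).
  { apply Rle_trans with (e / (2 + Cmod l + Cmod m) * (2 + Cmod l + Cmod m)).
    apply Rmult_le_compat_r; [lra|apply Rmin_r]. right; field; lra. }
  assert (H1 := Cmod_ge_0 (s n - l)). assert (H2 := Cmod_ge_0 (t n - m)).
  set (x := Cmod (s n - l)) in *. set (y := Cmod (t n - m)) in *.
  set (p := Cmod l) in *. set (q := Cmod m) in *.
  assert (x * y <= d * 1) by (apply Rmult_le_compat; lra).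
  assert (x * q <= d * q) by (apply Rmult_le_compat_r; lra).
  assert (p * y <= p * d) by (apply Rmult_le_compat_l; lra).
  lra.
Qed.

Lemma Clim_scal c s l : Clim s l -> Clim (fun n => c * s n)%C (c * l)%C.
Proof. intros. apply Clim_mult; auto. apply Clim_const. Qed.

Lemma Clim_opp s l : Clim s l -> Clim (fun n => - s n)%C (- l)%C.
Proof.
  intros H. apply Clim_ext with (fun n => (- (1)) * s n)%C. intros; ring.
  replace (- l)%C with (- (1) * l)%C by ring. now apply Clim_scal.
Qed.

Lemma Clim_minus s t l m : Clim s l -> Clim t m -> Clim (fun n => s n - t n)%C (l - m)%C.
Proof. intros. apply Clim_plus; auto. now apply Clim_opp. Qed.

Lemma Clim_inv s l : l <> RtoC 0 -> Clim s l -> Clim (fun n => / s n)%C (/ l)%C.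
Proof.
  intros Hl Hs e He.
  assert (Hm : 0 < Cmod l) by (now apply Cmod_gt_0).
  set (p := Cmod l) in *.
  destruct (Hs (Rmin (p / 2) (e * (p * p / 2)))) as [N HN].
  { apply Rmin_glb_lt; [lra|]. apply Rmult_lt_0_compat; [lra|]. nra. }
  exists N. intros n Hn. specialize (HN n Hn).
  assert (H1 : Cmod (s n - l) < p / 2) by (eapply Rlt_le_trans; [apply HN|apply Rmin_l]).
  assert (H2 : Cmod (s n - l) < e * (p * p / 2)) by (eapply Rlt_le_trans; [apply HN|apply Rmin_r]).
  assert (H3 := Cmod_triangle_inv l (s n)). rewrite (Cmod_minus_sym l) in H3. fold p in H3.
  assert (H4 : p / 2 < Cmod (s n)) by lra.
  assert (H5 : s n <> RtoC 0). { apply Cmod_gt_0. lra. }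
  replace (/ s n - / l)%C with ((l - s n) / (s n * l))%C by (field; auto).
  rewrite Cmod_div by (now apply Cmult_neq_0). rewrite Cmod_mult, (Cmod_minus_sym l). fold p.
  apply Rlt_div_l. nra. eapply Rlt_le_trans; [apply H2|]. apply Rmult_le_compat_l; nra.
Qed.

Lemma Clim_unique s l m : Clim s l -> Clim s m -> l = m.
Proof.
  intros H1 H2. destruct (Ceq_dec l m) as [|Hn]; auto. exfalso.
  assert (Hp : 0 < Cmod (l - m)). { apply Cmod_gt_0. now apply Cminus_eq_contra. }
  destruct (H1 (Cmod (l - m) / 2)) as [N HN]; [lra|]. destruct (H2 (Cmod (l - m) / 2)) as [N' HN']; [lra|].
  specialize (HN (max N N') ltac:(lia)). specialize (HN' (max N N') ltac:(lia)).
  assert (H := Cmod_triangle (l - s (max N N')) (s (max N N') - m)).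
  replace (l - s (max N N') + (s (max N N') - m))%C with (l - m)%C in H by ring.
  rewrite (Cmod_minus_sym l (s _)) in H. lra.
Qed.

Lemma Clim_shift s l : Clim s l -> Clim (fun n => s (S n)) l.
Proof. intros H e He. destruct (H e He) as [N HN]. exists N. intros n Hn. apply HN. lia. Qed.

Lemma Clim_shift_inv s l : Clim (fun n => s (S n)) l -> Clim s l.
Proof.
  intros H e He. destruct (H e He) as [N HN]. exists (S N). intros n Hn.
  destruct n; [lia|]. apply HN. lia.
Qed.

Lemma Clim_comp s l (phi : nat -> nat) :
  (forall n, (n <= phi n)%nat) -> Clim s l -> Clim (fun n => s (phi n)) l.
Proof.
  intros Hp H e He. destruct (H e He) as [N HN]. exists N. intros n Hn. apply HN.
  specialize (Hp n). lia.
Qed.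

Lemma Clim_0_le s (b : nat -> R) :
  (forall n, Cmod (s n) <= b n) -> is_lim_seq b 0 -> Clim s 0.
Proof.
  intros H Hb e He. apply is_lim_seq_spec in Hb. destruct (Hb (mkposreal e He)) as [N HN].
  exists N. intros n Hn. replace (s n - 0)%C with (s n) by ring.
  specialize (HN n Hn). simpl in HN. specialize (H n). apply Rle_lt_trans with (1 := H).
  rewrite Rminus_0_r in HN. apply Rle_lt_trans with (2 := HN). apply Rle_abs.
Qed.

Lemma Clim_of_components s l :
  is_lim_seq (fun n => Re (s n)) (Re l) -> is_lim_seq (fun n => Im (s n)) (Im l) -> Clim s l.
Proof.
  intros H1 H2 e He. apply is_lim_seq_spec in H1. apply is_lim_seq_spec in H2.
  assert (He2 : 0 < e / 2) by lra.
  destruct (H1 (mkposreal _ He2)) as [N HN]. destruct (H2 (mkposreal _ He2)) as [N' HN'].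
  exists (max N N'). intros n Hn. specialize (HN n ltac:(lia)). specialize (HN' n ltac:(lia)).
  simpl in *. eapply Rle_lt_trans; [apply Cmod_le_sum|]. rewrite Re_minus, Im_minus. lra.
Qed.

Lemma Clim_Re s l : Clim s l -> is_lim_seq (fun n => Re (s n)) (Re l).
Proof.
  intros H. apply is_lim_seq_spec. intros [e He]. destruct (H e He) as [N HN]. exists N. intros n Hn.
  simpl. rewrite <- Re_minus. eapply Rle_lt_trans; [apply re_le_Cmod|]. auto.
Qed.

Lemma Clim_Im s l : Clim s l -> is_lim_seq (fun n => Im (s n)) (Im l).
Proof.
  intros H. apply is_lim_seq_spec. intros [e He]. destruct (H e He) as [N HN]. exists N. intros n Hn.
  simpl. rewrite <- Im_minus. eapply Rle_lt_trans; [apply im_le_Cmod|]. auto.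
Qed.

(** * Absolutely convergent complex series *)

Lemma sum_n_rsum (a : nat -> R) n : sum_n a n = rsum a (S n).
Proof.
  induction n. rewrite sum_O. simpl. ring.
  rewrite sum_Sn, IHn. reflexivity.
Qed.

Lemma is_series_rsum (a : nat -> R) (l : R) : is_series a l <-> is_lim_seq (rsum a) l.
Proof.
  split; intros H.
  - apply is_lim_seq_incr_1. apply is_lim_seq_ext with (sum_n a). apply sum_n_rsum. exact H.
  - apply is_lim_seq_incr_1 in H. apply is_lim_seq_ext with (v := sum_n a) in H. exact H.
    intros; now rewrite sum_n_rsum.
Qed.

Lemma rsum_ext a b n : (forall k, (k < n)%nat -> a k = b k) -> rsum a n = rsum b n.
Proof. induction n; simpl; intros H; auto. rewrite IHn, H; auto. Qed.
Lemma csum_ext a b n : (forall k, (k < n)%nat -> a k = b k) -> csum a n = csum b n.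
Proof. induction n; simpl; intros H; auto. rewrite IHn, H; auto. Qed.

Lemma Re_csum a n : Re (csum a n) = rsum (fun k => Re (a k)) n.
Proof. induction n; simpl; auto. rewrite <- IHn. reflexivity. Qed.
Lemma Im_csum a n : Im (csum a n) = rsum (fun k => Im (a k)) n.
Proof. induction n; simpl; auto. rewrite <- IHn. reflexivity. Qed.

Lemma csum_plus a b n : csum (fun k => a k + b k)%C n = (csum a n + csum b n)%C.
Proof. induction n; simpl. ring. rewrite IHn. ring. Qed.
Lemma csum_scal c a n : csum (fun k => c * a k)%C n = (c * csum a n)%C.
Proof. induction n; simpl. ring. rewrite IHn. ring. Qed.
Lemma csum_S_l a n : csum a (S n) = (a O + csum (fun k => a (S k)) n)%C.
Proof.
  induction n. simpl. ring.
  change (csum a (S (S n))) with (csum a (S n) + a (S n))%C. rewrite IHn. simpl. ring.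
Qed.

Lemma ex_series_nn_bounded (a : nat -> R) (K : R) :
  (forall n, 0 <= a n) -> (forall n, rsum a n <= K) -> ex_series a.
Proof.
  intros Ha HK. destruct (ex_finite_lim_seq_incr (rsum a) K) as [l Hl].
  - intros n; simpl; specialize (Ha n); lra.
  - exact HK.
  - exists l. now apply is_series_rsum.
Qed.

Lemma rsum_le_Series (a : nat -> R) n : (forall n, 0 <= a n) -> ex_series a -> rsum a n <= Series a.
Proof.
  intros Ha He. apply Series_correct, is_series_rsum in He.
  apply is_lim_seq_incr_compare with (u := rsum a) (l := Series a); auto.
  intros k; simpl; specialize (Ha k); lra.
Qed.

Lemma Series_nonneg (a : nat -> R) : (forall n, 0 <= a n) -> ex_series a -> 0 <= Series a.
Proof. intros Ha He. apply (rsum_le_Series a 0 Ha He). Qed.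

Lemma Series_le_bound (a : nat -> R) K :
  ex_series a -> (forall n, rsum a n <= K) -> Series a <= K.
Proof.
  intros He HK. apply Series_correct, is_series_rsum in He.
  assert (H := is_lim_seq_le _ _ _ _ HK He (is_lim_seq_const K)). exact H.
Qed.

Lemma summ_Re a : summ a -> ex_series (fun n => Re (a n)).
Proof.
  intros H. apply (ex_series_le (fun n => Re (a n)) (fun n => Cmod (a n))); auto.
  intros n. apply re_le_Cmod.
Qed.
Lemma summ_Im a : summ a -> ex_series (fun n => Im (a n)).
Proof.
  intros H. apply (ex_series_le (fun n => Im (a n)) (fun n => Cmod (a n))); auto.
  intros n. apply im_le_Cmod.
Qed.

Lemma summ_le a (b : nat -> R) : (forall n, Cmod (a n) <= b n) -> ex_series b -> summ a.
Proof.
  intros H Hb. apply (ex_series_le (fun n => Cmod (a n)) b); auto.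
  intros n. change (Rabs (Cmod (a n)) <= b n). rewrite Rabs_pos_eq; auto using Cmod_ge_0.
Qed.

Lemma ex_series_le_nn (a b : nat -> R) : (forall n, 0 <= a n <= b n) -> ex_series b -> ex_series a.
Proof.
  intros H Hb. apply (ex_series_le a b); auto.
  intros n. change (Rabs (a n) <= b n). destruct (H n). rewrite Rabs_pos_eq; auto.
Qed.

Lemma Clim_Csum a : summ a -> Clim (csum a) (Csum a).
Proof.
  intros H. apply Clim_of_components.
  - apply is_lim_seq_ext with (rsum (fun k => Re (a k))). intros; now rewrite Re_csum.
    apply is_series_rsum. apply (Series_correct (fun k => Re (a k))). now apply summ_Re.
  - apply is_lim_seq_ext with (rsum (fun k => Im (a k))). intros; now rewrite Im_csum.
    apply is_series_rsum. apply (Series_correct (fun k => Im (a k))). now apply summ_Im.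
Qed.

Lemma Csum_unique a l : Clim (csum a) l -> Csum a = l.
Proof.
  intros H. apply C_eq.
  - apply is_series_unique, is_series_rsum. apply is_lim_seq_ext with (2 := Clim_Re _ _ H).
    intros; now rewrite Re_csum.
  - apply is_series_unique, is_series_rsum. apply is_lim_seq_ext with (2 := Clim_Im _ _ H).
    intros; now rewrite Im_csum.
Qed.

Lemma Csum_ext a b : (forall n, a n = b n) -> Csum a = Csum b.
Proof. intros H. unfold Csum. f_equal; apply Series_ext; intros; now rewrite H. Qed.
Lemma summ_ext a b : (forall n, a n = b n) -> summ a -> summ b.
Proof. intros H. apply ex_series_ext. intros; now rewrite H. Qed.

Lemma summ_plus a b : summ a -> summ b -> summ (fun n => a n + b n)%C.
Proof.
  intros Ha Hb. apply summ_le with (fun n => Cmod (a n) + Cmod (b n)).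
  intros; apply Cmod_triangle. now apply (ex_series_plus (V := R_NormedModule)).
Qed.
Lemma summ_scal c a : summ a -> summ (fun n => c * a n)%C.
Proof.
  intros Ha. apply summ_le with (fun n => Cmod c * Cmod (a n)).
  intros; rewrite Cmod_mult; lra. now apply (ex_series_scal (V := R_NormedModule)).
Qed.
Lemma summ_opp a : summ a -> summ (fun n => - a n)%C.
Proof. intros H. apply (ex_series_ext (fun n => Cmod (a n))); auto. intros. now rewrite Cmod_opp. Qed.
Lemma summ_minus a b : summ a -> summ b -> summ (fun n => a n - b n)%C.
Proof. intros. apply summ_plus; auto. now apply summ_opp. Qed.

Lemma Csum_plus a b : summ a -> summ b -> Csum (fun n => a n + b n)%C = (Csum a + Csum b)%C.
Proof.
  intros Ha Hb. apply Csum_unique. apply Clim_ext with (fun n => csum a n + csum b n)%C.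
  intros; now rewrite csum_plus. apply Clim_plus; now apply Clim_Csum.
Qed.
Lemma Csum_scal c a : summ a -> Csum (fun n => c * a n)%C = (c * Csum a)%C.
Proof.
  intros Ha. apply Csum_unique. apply Clim_ext with (fun n => c * csum a n)%C.
  intros; now rewrite csum_scal. apply Clim_scal; now apply Clim_Csum.
Qed.
Lemma Csum_opp a : summ a -> Csum (fun n => - a n)%C = (- Csum a)%C.
Proof.
  intros H. replace (- Csum a)%C with (- (1) * Csum a)%C by ring.
  rewrite <- Csum_scal by auto. apply Csum_ext; intros; ring.
Qed.
Lemma Csum_minus a b : summ a -> summ b -> Csum (fun n => a n - b n)%C = (Csum a - Csum b)%C.
Proof.
  intros Ha Hb. unfold Cminus. rewrite <- Csum_opp by auto. apply Csum_plus; auto. now apply summ_opp.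
Qed.

Lemma summ_shift a : summ a <-> summ (fun n => a (S n)).
Proof. apply (ex_series_incr_1 (fun n => Cmod (a n))). Qed.
Lemma summ_shift_n a n : summ a -> summ (fun k => a (n + k)%nat).
Proof. intros H. apply (ex_series_incr_n (fun n => Cmod (a n))). exact H. Qed.

Lemma Csum_shift a : summ a -> Csum a = (a O + Csum (fun n => a (S n)))%C.
Proof.
  intros H. apply Csum_unique. apply Clim_shift_inv.
  apply Clim_ext with (fun n => a O + csum (fun k => a (S k)) n)%C.
  intros; now rewrite csum_S_l.
  apply Clim_plus. apply Clim_const. apply Clim_Csum. now apply summ_shift in H.
Qed.

Lemma Csum_split a n : summ a -> Csum a = (csum a n + Csum (fun k => a (n + k)%nat))%C.
Proof.
  induction n; intros H; simpl. rewrite Cplus_0_l; reflexivity.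
  rewrite IHn by auto. rewrite (Csum_shift (fun k => a (n + k)%nat)).
  rewrite Nat.add_0_r.
  rewrite (Csum_ext (fun n0 => a (n + S n0)%nat) (fun k => a (S (n + k)))). ring.
  intros; f_equal; lia. now apply summ_shift_n.
Qed.

(* The modulus is attained by pairing the sum [S] with its own conjugate. *)
Lemma Cmod_Csum_le a : summ a -> Cmod (Csum a) <= Series (fun n => Cmod (a n)).
Proof.
  intros H. set (s := Csum a).
  destruct (Req_dec (Cmod s) 0) as [Hz|Hz].
  { rewrite Hz. apply Series_nonneg; auto. intros; apply Cmod_ge_0. }
  assert (Hp : 0 < Cmod s) by (assert (Hs := Cmod_ge_0 s); lra).
  apply Rmult_le_reg_l with (1 := Hp).
  replace (Cmod s * Cmod s) with (Re (Cconj s * s)).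
  2:{ replace (Cmod s * Cmod s) with (Cmod s ^ 2) by ring. rewrite Cmod2_alt, Re_mult.
      unfold Cconj; simpl. unfold Re, Im. ring. }
  unfold s at 2. rewrite <- Csum_scal by auto. rewrite <- Series_scal_l.
  unfold Csum at 1. simpl Re at 1.
  apply Rle_trans with (Series (fun n => Rabs (Re (Cconj s * a n)))).
  - eapply Rle_trans; [apply Rle_abs|]. apply Series_Rabs.
    apply ex_series_le_nn with (fun n => Cmod s * Cmod (a n)).
    intros n. split. apply Rabs_pos. eapply Rle_trans; [apply re_le_Cmod|]. rewrite Cmod_mult, Cmod_conj. lra.
    now apply (ex_series_scal (V := R_NormedModule)).
  - apply Series_le.
    intros n. split. apply Rabs_pos. eapply Rle_trans; [apply re_le_Cmod|]. rewrite Cmod_mult, Cmod_conj. lra.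
    now apply (ex_series_scal (V := R_NormedModule)).
Qed.

Lemma Cmod_Csum_le_bound a (b : nat -> R) :
  (forall n, Cmod (a n) <= b n) -> ex_series b -> Cmod (Csum a) <= Series b.
Proof.
  intros H Hb. eapply Rle_trans. apply Cmod_Csum_le. now apply summ_le with b.
  apply Series_le; auto. intros; split; auto. apply Cmod_ge_0.
Qed.

Lemma Series_tail_small (v : nat -> R) eps :
  (forall n, 0 <= v n) -> ex_series v -> 0 < eps -> exists J, Series (fun k => v (J + k)%nat) < eps.
Proof.
  intros Hv He Hp.
  assert (Hl := Series_correct _ He). apply is_series_rsum in Hl. apply is_lim_seq_spec in Hl.
  destruct (Hl (mkposreal _ Hp)) as [N HN].
  exists (S N). assert (HN' : Rabs (rsum v (S N) - Series v) < eps) by exact (HN (S N) ltac:(lia)).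
  assert (Hs := Series_incr_n v (S N) ltac:(lia) He).
  replace (sum_f_R0 v (Nat.pred (S N))) with (rsum v (S N)) in Hs.
  2:{ simpl Nat.pred. rewrite <- sum_n_rsum. rewrite sum_n_Reals. reflexivity. }
  apply Rabs_def2 in HN'.
  change (Series v = rsum v (S N) + Series (fun k => v (S N + k)%nat)) in Hs. lra.
Qed.

(** Dominated convergence for series. Beyond an index J where the tail of the majorant is below
    eps/4 both sums contribute at most eps/2 together, and the heads of length J converge
    termwise. *)
Lemma tannery (D : nat -> nat -> C) (u : nat -> C) (v : nat -> R) :
  (forall k j, Cmod (D k j) <= v j) -> ex_series v ->
  (forall j, Clim (fun k => D k j) (u j)) ->
  Clim (fun k => Csum (D k)) (Csum u).
Proof.
  intros HD Hv Hl.
  assert (Hv0 : forall j, 0 <= v j). { intros j. eapply Rle_trans; [apply Cmod_ge_0|apply (HD O)]. }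
  assert (Hu : forall j, Cmod (u j) <= v j).
  { intros j. apply Rnot_lt_le. intros Hc. destruct (Hl j (Cmod (u j) - v j)) as [N HN]; [lra|].
    specialize (HN N ltac:(lia)). rewrite Cmod_minus_sym in HN.
    assert (H := Cmod_triangle_inv (u j) (D N j)). specialize (HD N j). lra. }
  assert (HsD : forall k, summ (D k)) by (intros k; now apply summ_le with v).
  assert (Hsu : summ u) by now apply summ_le with v.
  intros e He. destruct (Series_tail_small v (e / 4)) as [J HJ]; auto; [lra|].
  assert (Hf : Clim (fun k => csum (D k) J) (csum u J)).
  { clear HJ. induction J; simpl. apply Clim_const. now apply Clim_plus. }
  destruct (Hf (e / 2)) as [N HN]; [lra|]. exists N. intros n Hn. specialize (HN n Hn).
  rewrite (Csum_split (D n) J), (Csum_split u J) by auto.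
  assert (Hvt : ex_series (fun k => v (J + k)%nat)) by now apply ex_series_incr_n.
  assert (H1 : Cmod (Csum (fun k => D n (J + k)%nat)) <= Series (fun k => v (J + k)%nat))
    by (apply Cmod_Csum_le_bound; auto).
  assert (H2 : Cmod (Csum (fun k => u (J + k)%nat)) <= Series (fun k => v (J + k)%nat))
    by (apply Cmod_Csum_le_bound; auto).
  set (x := Csum (fun k => D n (J + k)%nat)) in *. set (y := Csum (fun k => u (J + k)%nat)) in *.
  replace (csum (D n) J + x - (csum u J + y))%C with ((csum (D n) J - csum u J) + (x - y))%C by ring.
  eapply Rle_lt_trans; [apply Cmod_triangle|].
  assert (H3 := Cmod_triangle_minus x y). lra.
Qed.

(** * Interchange of double sums *)

Lemma rsum_plus a b n : rsum (fun k => a k + b k) n = rsum a n + rsum b n.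
Proof. induction n; simpl; [|rewrite IHn]; ring. Qed.
Lemma rsum_le a b n : (forall k, (k < n)%nat -> a k <= b k) -> rsum a n <= rsum b n.
Proof. induction n; simpl; intros H. lra. specialize (IHn ltac:(auto)). specialize (H n ltac:(lia)). lra. Qed.
Lemma rsum_exch (u : nat -> nat -> R) m n :
  rsum (fun i => rsum (fun j => u i j) n) m = rsum (fun j => rsum (fun i => u i j) m) n.
Proof.
  induction m; simpl. induction n; simpl; auto; rewrite <- IHn; ring.
  rewrite IHm, rsum_plus. reflexivity.
Qed.

(** Finitely many columns, cut off after finitely many rows, exchange trivially and stay below the
    total L; letting the number of rows grow bounds every partial sum of column sums by L. Applying
    this twice gives equality. *)
Lemma fubini_nn (u : nat -> nat -> R) :
  (forall m n, 0 <= u m n) -> (forall m, ex_series (u m)) -> ex_series (fun m => Series (u m)) ->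
  (forall n, ex_series (fun m => u m n)) /\
  ex_series (fun n => Series (fun m => u m n)) /\
  Series (fun n => Series (fun m => u m n)) <= Series (fun m => Series (u m)).
Proof.
  intros Hu Hr Hs. set (L := Series (fun m => Series (u m))).
  assert (HR0 : forall m, 0 <= Series (u m)) by (intros; now apply Series_nonneg).
  assert (Hc : forall n, ex_series (fun m => u m n)).
  { intros n. apply ex_series_le_nn with (fun m => Series (u m)); auto.
    intros m. split; auto. apply Rle_trans with (rsum (u m) (S n)).
    simpl. assert (H : 0 <= rsum (u m) n). { clear -Hu. induction n; simpl. lra. specialize (Hu m n). lra. }
    lra. now apply rsum_le_Series. }
  assert (HC0 : forall n, 0 <= Series (fun m => u m n)) by (intros; now apply Series_nonneg).
  assert (Hb : forall N, rsum (fun n => Series (fun m => u m n)) N <= L).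
  { intros N.
    assert (Hlim : is_lim_seq (fun M => rsum (fun n => rsum (fun m => u m n) M) N) (rsum (fun n => Series (fun m => u m n)) N)).
    { induction N; simpl. apply is_lim_seq_const.
      apply is_lim_seq_plus'; auto. apply is_series_rsum. now apply (Series_correct (fun m => u m N)). }
    apply (is_lim_seq_le (fun M => rsum (fun n => rsum (fun m => u m n) M) N) (fun _ => L)
      (Finite (rsum (fun n => Series (fun m => u m n)) N)) (Finite L)); auto using is_lim_seq_const.
    intros M. rewrite <- rsum_exch. apply Rle_trans with (rsum (fun m => Series (u m)) M).
    apply rsum_le; intros; now apply rsum_le_Series. now apply rsum_le_Series. }
  split; auto. assert (He : ex_series (fun n => Series (fun m => u m n))) by now apply ex_series_nn_bounded with L.
  split; auto. now apply Series_le_bound.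
Qed.

Lemma fubini_nn_eq (u : nat -> nat -> R) :
  (forall m n, 0 <= u m n) -> (forall m, ex_series (u m)) -> ex_series (fun m => Series (u m)) ->
  Series (fun n => Series (fun m => u m n)) = Series (fun m => Series (u m)).
Proof.
  intros Hu Hr Hs. destruct (fubini_nn u Hu Hr Hs) as [H1 [H2 H3]].
  apply Rle_antisym; auto.
  destruct (fubini_nn (fun n m => u m n)) as [_ [_ H]]; auto.
Qed.

(** The nonnegative case applies to [w + u], which lies between 0 and [2 * u]; the identity for [u]
    is then subtracted. *)
Lemma fubini_R (w u : nat -> nat -> R) :
  (forall m n, Rabs (w m n) <= u m n) -> (forall m, ex_series (u m)) -> ex_series (fun m => Series (u m)) ->
  Series (fun n => Series (fun m => w m n)) = Series (fun m => Series (w m)).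
Proof.
  intros Hw Hr Hs.
  assert (Hu : forall m n, 0 <= u m n) by (intros; eapply Rle_trans; [apply Rabs_pos|apply Hw]).
  destruct (fubini_nn u Hu Hr Hs) as [H1 [H2 _]].
  assert (Hw' : forall m n, 0 <= w m n + u m n <= 2 * u m n).
  { intros m n. specialize (Hw m n). apply Rabs_le_between in Hw. lra. }
  assert (E := fubini_nn_eq u Hu Hr Hs).
  assert (Hr2 : forall m, ex_series (fun n => 2 * u m n)) by (intros; now apply (ex_series_scal (V := R_NormedModule))).
  assert (Hr' : forall m, ex_series (fun n => w m n + u m n)).
  { intros m. apply ex_series_le_nn with (2 := Hr2 m). intros; auto. }
  assert (Hs' : ex_series (fun m => Series (fun n => w m n + u m n))).
  { apply ex_series_le_nn with (fun m => 2 * Series (u m)). intros m. split.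
    apply Series_nonneg; auto. intros; apply Hw'. rewrite <- Series_scal_l. apply Series_le; auto.
    now apply (ex_series_scal (V := R_NormedModule)). }
  assert (E' := fubini_nn_eq (fun m n => w m n + u m n) (fun m n => proj1 (Hw' m n)) Hr' Hs').
  destruct (fubini_nn (fun m n => w m n + u m n) (fun m n => proj1 (Hw' m n)) Hr' Hs') as [K1 [K2 _]].
  rewrite (Series_ext _ (fun n => Series (fun m => w m n + u m n) - Series (fun m => u m n))).
  2:{ intros n. rewrite <- Series_minus; auto. apply Series_ext; intros; ring. }
  rewrite Series_minus; auto. rewrite E', E. rewrite <- Series_minus; auto.
  apply Series_ext. intros m. rewrite <- Series_minus; auto. apply Series_ext; intros; ring.
Qed.

Lemma fubini (D : nat -> nat -> C) (u : nat -> nat -> R) :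
  (forall m n, Cmod (D m n) <= u m n) -> (forall m, ex_series (u m)) -> ex_series (fun m => Series (u m)) ->
  Csum (fun n => Csum (fun m => D m n)) = Csum (fun m => Csum (fun n => D m n)) /\
  summ (fun n => Csum (fun m => D m n)) /\ summ (fun m => Csum (fun n => D m n)).
Proof.
  intros HD Hr Hs.
  assert (Hu : forall m n, 0 <= u m n) by (intros; eapply Rle_trans; [apply Cmod_ge_0|apply HD]).
  destruct (fubini_nn u Hu Hr Hs) as [H1 [H2 _]].
  split; [|split].
  - apply C_eq; simpl.
    + apply (fubini_R (fun m n => Re (D m n)) u); auto. intros; eapply Rle_trans; [apply re_le_Cmod|auto].
    + apply (fubini_R (fun m n => Im (D m n)) u); auto. intros; eapply Rle_trans; [apply im_le_Cmod|auto].
  - apply summ_le with (2 := H2). intros. apply Cmod_Csum_le_bound; auto.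
  - apply summ_le with (2 := Hs). intros. apply Cmod_Csum_le_bound; auto.
Qed.

(** * The complex exponential and its normalisation of period 1 *)

Definition cexp (u : C) : C := (exp (Re u) * cos (Im u), exp (Re u) * sin (Im u)).
Definition cE (z : C) : C := cexp (RtoC (2 * PI) * Ci * z)%C.

Lemma cexp_plus u v : cexp (u + v)%C = (cexp u * cexp v)%C.
Proof.
  destruct u as [a b], v as [c d]. unfold cexp, Cplus, Cmult, Re, Im; simpl.
  rewrite exp_plus, cos_plus, sin_plus. f_equal; ring.
Qed.

Lemma cexp_0 : cexp 0 = 1.
Proof. unfold cexp; simpl. rewrite exp_0, cos_0, sin_0. apply C_eq; simpl; ring. Qed.

Lemma Cmod_cexp u : Cmod (cexp u) = exp (Re u).
Proof.
  unfold Cmod, cexp; simpl.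
  replace (_ + _) with (exp (Re u) ^ 2).
  - rewrite <- Rsqr_pow2. apply sqrt_Rsqr. left; apply exp_pos.
  - assert (H := sin2_cos2 (Im u)). unfold Rsqr in H.
    transitivity (exp (Re u) ^ 2 * (sin (Im u) * sin (Im u) + cos (Im u) * cos (Im u))); [rewrite H|]; ring.
Qed.

Lemma cexp_nz u : cexp u <> 0.
Proof. apply Cmod_gt_0. rewrite Cmod_cexp. apply exp_pos. Qed.

Lemma cE_plus u v : cE (u + v)%C = (cE u * cE v)%C.
Proof. unfold cE. rewrite <- cexp_plus. f_equal. ring. Qed.

Lemma cE_eq z : cE z = (exp (- (2 * PI) * Im z) * cos (2 * PI * Re z), exp (- (2 * PI) * Im z) * sin (2 * PI * Re z)).
Proof. unfold cE, cexp. simpl. unfold Re, Im. f_equal; f_equal; f_equal; ring. Qed.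

Lemma qparam_cE z : qparam z = cE z.
Proof. rewrite cE_eq. unfold qparam. replace (- 2 * PI * Im z) with (- (2 * PI) * Im z) by ring. reflexivity. Qed.

Lemma cE_1 : cE 1 = 1.
Proof.
  rewrite cE_eq. simpl. rewrite !Rmult_0_r, Rmult_1_r, exp_0, cos_2PI, sin_2PI. apply C_eq; simpl; ring.
Qed.
Lemma cE_half : cE (RtoC (1 / 2)) = RtoC (- 1).
Proof.
  rewrite cE_eq. simpl. replace (2 * PI * (1 / 2)) with PI by field.
  rewrite !Rmult_0_r, exp_0, cos_PI, sin_PI. apply C_eq; simpl; ring.
Qed.
Lemma cE_0 : cE 0 = 1.
Proof. unfold cE. rewrite Cmult_0_r. apply cexp_0. Qed.
Lemma cE_per u : cE (u + 1)%C = cE u.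
Proof. rewrite cE_plus, cE_1. ring. Qed.
Lemma cE_nz u : cE u <> 0.
Proof. apply cexp_nz. Qed.
Lemma Cmod_cE z : Cmod (cE z) = exp (- (2 * PI) * Im z).
Proof. unfold cE. rewrite Cmod_cexp. f_equal. simpl. unfold Im; ring. Qed.
Lemma Cmod_cE_lt1 z : 0 < Im z -> Cmod (cE z) < 1.
Proof.
  intros H. rewrite Cmod_cE, <- exp_0. apply exp_increasing. assert (Hp := PI_RGT_0). nra.
Qed.
Lemma cE_neq_1 z : 0 < Im z -> cE z <> 1.
Proof. intros H E. assert (H' := Cmod_cE_lt1 z H). rewrite E, Cmod_1 in H'. lra. Qed.
Lemma cE_pow z n : cE (RtoC (INR n) * z)%C = (cE z ^ n)%C.
Proof.
  induction n. simpl INR. rewrite Cmult_0_l, cE_0. reflexivity.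
  rewrite S_INR, RtoC_plus. replace ((INR n + 1) * z)%C with (z + INR n * z)%C by ring.
  rewrite cE_plus, IHn. reflexivity.
Qed.

(** * Taylor estimates for the exponential *)

(** The real mean value theorem is applied to the two components separately, which is the origin of
    the factor 2. *)
Lemma path_mvt (f f' : R -> C) (K : R) :
  (forall t, 0 <= t <= 1 ->
     is_derive (fun t => Re (f t)) t (Re (f' t)) /\ is_derive (fun t => Im (f t)) t (Im (f' t))) ->
  (forall t, 0 <= t <= 1 -> Cmod (f' t) <= K) -> Cmod (f 1 - f 0) <= 2 * K.
Proof.
  intros Hd HK. eapply Rle_trans; [apply Cmod_le_sum|]. rewrite Re_minus, Im_minus.
  assert (G : forall g g' : R -> R, (forall t, 0 <= t <= 1 -> is_derive g t (g' t)) ->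
    (forall t, 0 <= t <= 1 -> Rabs (g' t) <= K) -> Rabs (g 1 - g 0) <= K).
  { intros g g' Hg Hb. destruct (MVT_gen g 0 1 g') as [c [Hc E]].
    - intros x Hx. apply Hg. rewrite Rmin_left, Rmax_right in Hx; lra.
    - intros x Hx. rewrite Rmin_left, Rmax_right in Hx by lra.
      apply continuity_pt_filterlim. apply (ex_derive_continuous (K := R_AbsRing) (V := R_NormedModule)). exists (g' x). apply Hg; lra.
    - rewrite Rmin_left, Rmax_right in Hc by lra. rewrite E. replace (g' c * (1 - 0)) with (g' c) by ring. auto. }
  assert (H1 := G (fun t => Re (f t)) (fun t => Re (f' t)) (fun t Ht => proj1 (Hd t Ht))
     (fun t Ht => Rle_trans _ _ _ (re_le_Cmod _) (HK t Ht))).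
  assert (H2 := G (fun t => Im (f t)) (fun t => Im (f' t)) (fun t Ht => proj2 (Hd t Ht))
     (fun t Ht => Rle_trans _ _ _ (im_le_Cmod _) (HK t Ht))).
  simpl in H1, H2. lra.
Qed.

Lemma cexp_path (u : C) t :
  is_derive (fun t => Re (cexp (RtoC t * u))) t (Re (u * cexp (RtoC t * u))) /\
  is_derive (fun t => Im (cexp (RtoC t * u))) t (Im (u * cexp (RtoC t * u))).
Proof.
  destruct u as [a b]. unfold cexp; simpl. unfold Re, Im. simpl. split; auto_derive; auto. all: unfold Rminus; ring.
Qed.

Lemma Cmod_exp_scal u t : 0 <= t <= 1 -> exp (Re (RtoC t * u)%C) <= exp (Cmod u).
Proof.
  intros Ht. assert (H : Re (RtoC t * u)%C <= Cmod u).
  { rewrite re_scal_l. assert (H := re_le_Cmod u). apply Rabs_le_between in H. assert (H0 := Cmod_ge_0 u). nra. }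
  destruct H as [H|H]. left; now apply exp_increasing. rewrite H. lra.
Qed.

Lemma cexp_bound1 u : Cmod (cexp u - 1) <= 2 * (Cmod u * exp (Cmod u)).
Proof.
  assert (H := path_mvt (fun t => cexp (RtoC t * u)%C) (fun t => u * cexp (RtoC t * u))%C (Cmod u * exp (Cmod u))).
  cbv beta in H. rewrite Cmult_1_l, Cmult_0_l, cexp_0 in H. apply H.
  - intros; apply cexp_path.
  - intros t Ht. rewrite Cmod_mult, Cmod_cexp. apply Rmult_le_compat_l. apply Cmod_ge_0. now apply Cmod_exp_scal.
Qed.

Lemma Cmod_scal_le (u : C) t : 0 <= t <= 1 -> Cmod (RtoC t * u) <= Cmod u.
Proof. intros Ht. rewrite Cmod_mult, Cmod_R, Rabs_pos_eq by lra. assert (H := Cmod_ge_0 u). nra. Qed.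

Lemma exp_le (x y : R) : x <= y -> exp x <= exp y.
Proof. intros [H|H]. left; now apply exp_increasing. subst; lra. Qed.

(** Along t -> t u the derivative of the remainder is u times the remainder of the previous order,
    so each further Taylor order costs a factor 2 and gains a factor [Cmod u]. The next estimate is
    obtained in the same way. *)
Lemma cexp_bound2 u : Cmod (cexp u - 1 - u) <= 4 * (Cmod u ^ 2 * exp (Cmod u)).
Proof.
  assert (H := path_mvt (fun t => cexp (RtoC t * u) - RtoC t * u)%C (fun t => u * (cexp (RtoC t * u) - 1))%C (2 * (Cmod u ^ 2 * exp (Cmod u)))).
  cbv beta in H. rewrite Cmult_1_l, Cmult_0_l, cexp_0 in H.
  replace (cexp u - u - (1 - 0))%C with (cexp u - 1 - u)%C in H by ring.
  eapply Rle_trans; [apply H|].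
  - intros t Ht. destruct (cexp_path u t) as [H1 H2]. split.
    + apply (is_derive_ext (fun t => Re (cexp (RtoC t * u)) - t * Re u)). intros; match goal with |- ?a = ?b => change (@eq R a b) end; rewrite ?Re_minus, ?Im_minus, ?re_scal_l, ?im_scal_l; ring.
      replace (Re (u * (cexp (t * u) - 1))) with (Re (u * cexp (t * u)) - 1 * Re u) by (destruct u as [a b], (cexp (t * (a, b))) as [p q]; unfold Re, Im; simpl; ring).
      apply (is_derive_minus (V := R_NormedModule)); auto. auto_derive; auto.
    + apply (is_derive_ext (fun t => Im (cexp (RtoC t * u)) - t * Im u)). intros; match goal with |- ?a = ?b => change (@eq R a b) end; rewrite ?Re_minus, ?Im_minus, ?re_scal_l, ?im_scal_l; ring.
      replace (Im (u * (cexp (t * u) - 1))) with (Im (u * cexp (t * u)) - 1 * Im u) by (destruct u as [a b], (cexp (t * (a, b))) as [p q]; unfold Re, Im; simpl; ring).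
      apply (is_derive_minus (V := R_NormedModule)); auto. auto_derive; auto.
  - intros t Ht. rewrite Cmod_mult. assert (Hu := Cmod_ge_0 u).
    assert (B := cexp_bound1 (t * u)). assert (B1 := Cmod_scal_le u t Ht).
    assert (B2 : Cmod (t * u) * exp (Cmod (t * u)) <= Cmod u * exp (Cmod u)).
    { apply Rmult_le_compat; auto. apply Cmod_ge_0. left; apply exp_pos. now apply exp_le. }
    replace (2 * (Cmod u ^ 2 * exp (Cmod u))) with (Cmod u * (2 * (Cmod u * exp (Cmod u)))) by ring.
    apply Rmult_le_compat_l; auto. lra.
  - right. ring.
Qed.

Lemma cexp_bound3 u : Cmod (cexp u - 1 - u - u * u / 2) <= 8 * (Cmod u ^ 3 * exp (Cmod u)).
Proof.
  assert (H := path_mvt (fun t => cexp (RtoC t * u) - RtoC t * u - RtoC (t * t / 2) * (u * u))%C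
     (fun t => u * (cexp (RtoC t * u) - 1 - RtoC t * u))%C (4 * (Cmod u ^ 3 * exp (Cmod u)))).
  cbv beta in H. rewrite Cmult_1_l, Cmult_0_l, cexp_0 in H.
  replace (cexp u - u - (1 * 1 / 2)%R * (u * u) - (1 - 0 - (0 * 0 / 2)%R * (u * u)))%C with (cexp u - 1 - u - u * u / 2)%C in H.
  2:{ replace (1 * 1 / 2)%R with (/2)%R by field. replace (0 * 0 / 2)%R with 0 by field. rewrite RtoC_inv by lra. field. }
  eapply Rle_trans; [apply H|].
  - intros t Ht. destruct (cexp_path u t) as [H1 H2]. split.
    + apply (is_derive_ext (fun t => Re (cexp (RtoC t * u)) - (t * Re u + t * t / 2 * Re (u * u)%C))). intros; match goal with |- ?a = ?b => change (@eq R a b) end; rewrite ?Re_minus, ?Im_minus, ?re_scal_l, ?im_scal_l; ring.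
      replace (Re (u * (cexp (t * u) - 1 - t * u))) with (Re (u * cexp (t * u)) - (1 * Re u + t * Re (u * u)%C)) by (destruct u as [a b], (cexp (t * (a, b))) as [p q]; unfold Re, Im; simpl; ring).
      apply (is_derive_minus (V := R_NormedModule)); auto. auto_derive; auto. unfold Re, Im; simpl; field.
    + apply (is_derive_ext (fun t => Im (cexp (RtoC t * u)) - (t * Im u + t * t / 2 * Im (u * u)%C))). intros; match goal with |- ?a = ?b => change (@eq R a b) end; rewrite ?Re_minus, ?Im_minus, ?re_scal_l, ?im_scal_l; ring.
      replace (Im (u * (cexp (t * u) - 1 - t * u))) with (Im (u * cexp (t * u)) - (1 * Im u + t * Im (u * u)%C)) by (destruct u as [a b], (cexp (t * (a, b))) as [p q]; unfold Re, Im; simpl; ring).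
      apply (is_derive_minus (V := R_NormedModule)); auto. auto_derive; auto. unfold Re, Im; simpl; field.
  - intros t Ht. rewrite Cmod_mult. assert (Hu := Cmod_ge_0 u).
    assert (B := cexp_bound2 (t * u)). assert (B1 := Cmod_scal_le u t Ht).
    assert (B2 : Cmod (t * u) ^ 2 * exp (Cmod (t * u)) <= Cmod u ^ 2 * exp (Cmod u)).
    { apply Rmult_le_compat; auto. apply pow_le, Cmod_ge_0. left; apply exp_pos.
      apply pow_incr; split; auto; apply Cmod_ge_0. now apply exp_le. }
    replace (4 * (Cmod u ^ 3 * exp (Cmod u))) with (Cmod u * (4 * (Cmod u ^ 2 * exp (Cmod u)))) by ring.
    apply Rmult_le_compat_l; auto. lra.
  - right. ring.
Qed.

(** * Partial fractions *)

(** With x = Re u, y = Im u and r = exp(-2 PI y), |1 - cE u|^2 = (1 - r)^2 + 4 r sin(PI x)^2. In the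
    window |x| <= 3/4 the only zero is u = 0, and it is simple, so both summands are bounded below
    by a multiple of y^2 and x^2. *)
Lemma one_minus_cE_lower :
  exists c, 0 < c /\ forall u, Rabs (Re u) <= 3 / 4 -> Rabs (Im u) <= 1 -> c * Cmod u <= Cmod (1 - cE u).
Proof.
  assert (Hpi := PI_RGT_0). assert (HPI4 := PI_4). assert (HPI3 := PI2_3_2).
  set (rho := exp (- (2 * PI))). assert (Hr : 0 < rho) by apply exp_pos.
  assert (Hr1 : rho < 1). { unfold rho. rewrite <- exp_0. apply exp_increasing. lra. }
  (* The constant 1/100 is far from sharp. Up to 1/2 a Taylor polynomial bounds the sine from below;
     beyond 1/2, reflection at PI/2 brings the argument back to at least PI/4. *)
  assert (Hsin : forall x, 0 <= x <= 3 / 4 -> x / 100 <= sin (PI * x)).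
  { intros x Hx. destruct (Rle_dec x (1 / 2)) as [Hl|Hl].
    - destruct (SIN (PI * x)) as [S1 _]; [nra|nra|].
      apply Rle_trans with (2 := S1).
      unfold sin_lb, sin_approx, sum_f_R0, sin_term; simpl.
      set (s := PI * x). assert (Hs : 3 * x <= s <= 4 * x) by (unfold s; nra).
      assert (Hs2 : 0 <= s <= 2) by lra.
      replace (1 * (s * 1 / 1) + - (1) * 1 * (s * (s * (s * 1)) / (1 + 1 + 1 + 1 + 1 + 1)) +
         - (1) * (- (1) * 1) * _ + _) with (s - s^3/6 + s^5/120 - s^7/5040) by field.
      assert (0 <= s^5/120 - s^7/5040).
      { replace (s^5/120 - s^7/5040) with (s^5 * (42 - s^2) / 5040) by field.
        apply Rdiv_le_0_compat; [|lra]. apply Rmult_le_pos. apply pow_le; lra. nra. }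
      assert (s^3 <= 4 * s) by nra. nra.
    - apply Rle_trans with (sin (PI / 4)).
      + rewrite sin_PI4. apply Rle_trans with (1/100). lra.
        assert (H0 : 0 < sqrt 2) by (apply sqrt_lt_R0; lra).
        assert (H2 : sqrt 2 <= 2). { rewrite <- (sqrt_square 2) at 2 by lra. apply sqrt_le_1_alt; lra. }
        apply (proj1 (Rle_div_r (1 / 100) 1 (sqrt 2) H0)). lra.
      + rewrite <- (sin_PI_x (PI * x)). apply sin_incr_1; nra. }
  assert (Hsin2 : forall x, Rabs x <= 3 / 4 -> (x / 100)^2 <= sin (PI * x) ^ 2).
  { intros x Hx. unfold Rabs in Hx. destruct (Rcase_abs x) as [Hn|Hn].
    - specialize (Hsin (- x) ltac:(lra)). replace (PI * - x) with (- (PI * x)) in Hsin by ring. rewrite sin_neg in Hsin. nra.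
    - specialize (Hsin x ltac:(lra)). nra. }
  assert (Hexp : forall y, Rabs y <= 1 -> rho * Rabs y <= Rabs (1 - exp (- (2 * PI) * y)) /\ rho <= exp (- (2 * PI) * y)).
  { intros y Hy. assert (E := exp_ineq1_le). split.
    - apply Rabs_le_between in Hy. destruct (Rle_or_lt 0 y) as [Hn|Hn].
      2:{ rewrite (Rabs_left y) by auto. assert (E1 := E (- (2 * PI) * y)). rewrite Rabs_left1; nra. }
      + rewrite (Rabs_pos_eq y) by auto. assert (E2 := E (2 * PI * y)). rewrite Rabs_pos_eq.
        2:{ assert (exp (- (2 * PI) * y) <= exp 0) by (apply exp_le; nra). rewrite exp_0 in *. lra. }
        assert (E3 : exp (- (2 * PI) * y) * exp (2 * PI * y) = 1) by (rewrite <- exp_plus; replace (_ + _) with 0 by ring; apply exp_0).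
        assert (E4 : rho <= exp (- (2 * PI) * y)) by (apply exp_le; nra).
        assert (E5 := exp_pos (- (2 * PI) * y)). set (p := exp (- (2 * PI) * y)) in *. set (r := exp (2 * PI * y)) in *.
        assert (p * (1 + 2 * PI * y) <= 1) by nra.
        assert (0 <= p * y) by (apply Rmult_le_pos; lra).
        assert (rho * y <= p * y) by (apply Rmult_le_compat_r; lra).
        assert (3 * (p * y) <= PI * (p * y)) by (apply Rmult_le_compat_r; lra). lra.
    - apply exp_le. unfold Rabs in Hy; destruct (Rcase_abs y); nra. }
  exists (rho / 100). split; [nra|].
  intros u Hx Hy. set (x := Re u) in *. set (y := Im u) in *.
  destruct (Hexp y Hy) as [He1 He2]. specialize (Hsin2 x Hx).
  apply Rsqr_incr_0_var; [|apply Cmod_ge_0].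
  rewrite !Rsqr_pow2, Rpow_mult_distr, !Cmod2_alt, cE_eq. simpl Re; simpl Im. fold x y.
  set (r := exp (- (2 * PI) * y)) in *.
  assert (Hcos : cos (2 * PI * x) = 1 - 2 * sin (PI * x) ^ 2).
  { replace (2 * PI * x) with (2 * (PI * x)) by ring. rewrite cos_2a_sin. ring. }
  assert (Hsq : sin (2 * PI * x) ^ 2 = 1 - cos (2 * PI * x) ^ 2).
  { assert (H := sin2_cos2 (2 * PI * x)). rewrite !Rsqr_pow2 in H. lra. }
  replace ((1 + - (r * cos (2 * PI * x))) ^ 2 + (0 + - (r * sin (2 * PI * x))) ^ 2) with ((1 - r)^2 + 4 * r * sin (PI * x) ^ 2).
  2:{ set (s := sin (2 * PI * x)) in *. set (k := cos (2 * PI * x)) in *. set (t := sin (PI * x)) in *.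
      transitivity ((1 - r * k)^2 + r^2 * s ^ 2); [rewrite Hsq, Hcos; ring | ring]. }
  assert (Ha : (rho * y)^2 <= (1 - r)^2).
  { rewrite <- (pow2_abs (1 - r)), <- (pow2_abs (rho * y)), Rabs_mult, (Rabs_pos_eq rho) by lra.
    apply pow_incr. split; auto. apply Rmult_le_pos; [lra|apply Rabs_pos]. }
  set (t := sin (PI * x)) in *.
  assert (H0 : 0 <= t ^ 2) by apply pow2_ge_0.
  assert (H1 : 0 <= y ^ 2) by apply pow2_ge_0. assert (H2 : 0 <= x ^ 2) by apply pow2_ge_0.
  assert (H3 : rho ^ 2 * (x / 100) ^ 2 <= 4 * r * t ^ 2).
  { apply Rle_trans with (1 * r * t ^ 2); [|nra]. apply Rmult_le_compat; auto; try apply pow2_ge_0. nra. }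
  replace ((rho / 100) ^ 2 * (x ^ 2 + y ^ 2)) with (rho ^ 2 * (x / 100) ^ 2 + (rho * y) ^ 2 / 10000) by field.
  assert (0 <= (rho * y)^2) by apply pow2_ge_0. lra.
Qed.

Lemma csum_add a n m : csum a (n + m) = (csum a n + csum (fun k => a (n + k)%nat) m)%C.
Proof.
  induction m. rewrite Nat.add_0_r. simpl. ring.
  rewrite Nat.add_succ_r. simpl. rewrite IHm. ring.
Qed.

Lemma csum_rev a n : csum a n = csum (fun i => a (n - 1 - i)%nat) n.
Proof.
  revert a. induction n; intros a; auto.
  rewrite (csum_S_l (fun i => a (S n - 1 - i)%nat)). simpl csum at 1. rewrite IHn.
  replace (S n - 1 - 0)%nat with n by lia. rewrite Cplus_comm. f_equal.
  apply csum_ext. intros k Hk. f_equal. lia.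
Qed.

Lemma Csum_finite a n : (forall k, (n <= k)%nat -> a k = RtoC 0) -> Csum a = csum a n.
Proof.
  intros H. apply Csum_unique. apply Clim_ext_ev with (fun _ => csum a n) n; [|apply Clim_const].
  intros k Hk. replace k with (n + (k - n))%nat by lia. rewrite csum_add.
  replace (csum (fun k0 => a (n + k0)%nat) (k - n)) with (RtoC 0). ring.
  generalize (k - n)%nat. intros m. induction m; simpl; auto. rewrite <- IHm, H by lia. ring.
Qed.

Definition p2 (k : nat) : C := RtoC (2 ^ k).
Lemma p2_S k : p2 (S k) = (2 * p2 k)%C. Proof. unfold p2. rewrite <- RtoC_mult. reflexivity. Qed.
Lemma p2_pos k : 0 < 2 ^ k. Proof. apply pow_lt; lra. Qed.
Lemma p2_nz k : p2 k <> 0.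
Proof. unfold p2. intros E. apply RtoC_inj in E. assert (H := p2_pos k). lra. Qed.
Lemma INR_pow2 k : INR (2 ^ k)%nat = 2 ^ k.
Proof. rewrite pow_INR. reflexivity. Qed.
Lemma C2_nz : RtoC 2 <> RtoC 0. Proof. intros E; apply RtoC_inj in E; lra. Qed.

Section Dyadic.
Context (t : C -> C) (lam : C).
Context (Hdup : forall w, cE w <> 1 -> t w = (lam * (t (w / 2) + t ((w + 1) / 2)))%C).
Context (Hper : forall w, t (w + 1)%C = t w).

Lemma cE_p2_neq w k j : cE w <> 1 -> cE ((w + RtoC (INR j)) / p2 k) <> 1.
Proof.
  intros Hw E. apply Hw.
  assert (H := cE_pow ((w + RtoC (INR j)) / p2 k) (2 ^ k)). rewrite E, Cpow_1_l in H.
  rewrite INR_pow2 in H. fold (p2 k) in H.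
  replace (p2 k * ((w + INR j) / p2 k))%C with (w + INR j * 1)%C in H by (field; apply p2_nz).
  rewrite cE_plus, cE_pow, cE_1, Cpow_1_l, Cmult_1_r in H. exact H.
Qed.

(** Iterating the duplication formula k times spreads w over the 2^k points (w + j) / 2^k. *)
Lemma dyadic_sum k w : cE w <> 1 ->
  t w = (lam ^ k * csum (fun j => t ((w + RtoC (INR j)) / p2 k)) (2 ^ k))%C.
Proof.
  intros Hw. induction k.
  - simpl. replace ((w + 0) / p2 0)%C with w by (unfold p2; simpl; field). ring.
  - rewrite IHk. replace (2 ^ S k)%nat with (2 ^ k + 2 ^ k)%nat by (simpl; lia).
    rewrite csum_add, <- csum_plus. simpl Cpow.
    rewrite (csum_ext _ (fun j => lam * (t ((w + INR j) / p2 (S k)) + t ((w + INR (2 ^ k + j)) / p2 (S k))))%C).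
    + rewrite csum_scal. ring.
    + intros j _. rewrite Hdup by (now apply cE_p2_neq). do 3 f_equal; rewrite p2_S.
      * field. apply p2_nz.
      * rewrite plus_INR, INR_pow2, RtoC_plus. fold (p2 k). field. apply p2_nz.
Qed.

(** The period 1 turns the upper half of the indices into negative translates. The points then lie
    symmetrically about w - 1/2, which brings them near the pole at 0 and away from the one at 1. *)
Lemma dyadic_pairs k w : cE w <> 1 ->
  t w = (lam ^ S k * csum (fun j => t ((w + RtoC (INR j)) / p2 (S k)) + t ((w - 1 - RtoC (INR j)) / p2 (S k)))%C (2 ^ k))%C.
Proof.
  intros Hw. rewrite (dyadic_sum (S k) w Hw).
  replace (2 ^ S k)%nat with (2 ^ k + 2 ^ k)%nat by (simpl; lia).
  rewrite csum_add, csum_plus. do 2 f_equal.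
  rewrite csum_rev. apply csum_ext. intros j Hj.
  rewrite <- (Hper ((w - 1 - INR j) / p2 (S k))). f_equal.
  rewrite plus_INR, !minus_INR by lia. rewrite INR_pow2. simpl INR.
  rewrite p2_S. rewrite !RtoC_plus, !RtoC_minus. fold (p2 k). field. apply p2_nz.
Qed.

(** Partial fractions from a duplication formula: termwise the rescaled function tends to its
    principal part [r], and [tannery] lets the limit pass through the sum. Since the domination
    holds only from [k0] on, the sequence of finite sums is started there. *)
Lemma dyadic_limit (w : C) (r : C -> C) (v : nat -> R) (k0 : nat) :
  cE w <> 1 -> ex_series v -> (forall j, 0 <= v j) ->
  (forall k j, (k0 <= k)%nat -> (j < 2 ^ k)%nat ->
     Cmod (lam ^ S k * (t ((w + RtoC (INR j)) / p2 (S k)) + t ((w - 1 - RtoC (INR j)) / p2 (S k))))%C <= v j) ->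
  (forall j, Clim (fun k => lam ^ S k * t ((w + RtoC (INR j)) / p2 (S k)))%C (r (w + RtoC (INR j))%C)) ->
  (forall j, Clim (fun k => lam ^ S k * t ((w - 1 - RtoC (INR j)) / p2 (S k)))%C (r (w - 1 - RtoC (INR j))%C)) ->
  Csum (fun j => r (w + RtoC (INR j)) + r (w - 1 - RtoC (INR j)))%C = t w.
Proof.
  intros Hw Hv Hv0 Hb Hl1 Hl2.
  set (D := fun k j => if (j <? 2 ^ (k0 + k))%nat then
     (lam ^ S (k0 + k) * (t ((w + RtoC (INR j)) / p2 (S (k0 + k))) + t ((w - 1 - RtoC (INR j)) / p2 (S (k0 + k)))))%C else RtoC 0).
  apply (Clim_unique (fun k => Csum (D k))).
  - apply tannery with v; auto.
    + intros k j. unfold D. destruct (Nat.ltb_spec j (2 ^ (k0 + k))).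
      apply Hb; auto; lia. rewrite Cmod_0; auto.
    + intros j. apply Clim_ext_ev with (fun k => (lam ^ S (k0 + k) * t ((w + RtoC (INR j)) / p2 (S (k0 + k))) + lam ^ S (k0 + k) * t ((w - 1 - RtoC (INR j)) / p2 (S (k0 + k))))%C) j.
      * intros k Hk. unfold D. destruct (Nat.ltb_spec j (2 ^ (k0 + k))). ring.
        exfalso. assert (H1 := Nat.pow_gt_lin_r 2 (k0 + k) ltac:(lia)). lia.
      * apply Clim_plus.
        apply (Clim_comp (fun k => lam ^ S k * t ((w + INR j) / p2 (S k)))%C _ (fun k => (k0 + k)%nat) ltac:(intros; cbv beta; lia) (Hl1 j)).
        apply (Clim_comp (fun k => lam ^ S k * t ((w - 1 - INR j) / p2 (S k)))%C _ (fun k => (k0 + k)%nat) ltac:(intros; cbv beta; lia) (Hl2 j)).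
  - apply Clim_ext with (fun _ => t w); [|apply Clim_const].
    intros k. rewrite (Csum_finite (D k) (2 ^ (k0 + k))).
    + rewrite (dyadic_pairs (k0 + k) w Hw) at 1. rewrite <- csum_scal. apply csum_ext.
      intros j Hj. unfold D. destruct (Nat.ltb_spec j (2 ^ (k0 + k))); auto. lia.
    + intros j Hj. unfold D. destruct (Nat.ltb_spec j (2 ^ (k0 + k))); auto. lia.
Qed.
End Dyadic.

Lemma ex_series_inv_sq : ex_series (fun n => / (1 + INR n ^ 2)).
Proof.
  apply ex_series_nn_bounded with 4.
  - intros n. left. apply Rinv_0_lt_compat. assert (H := pow2_ge_0 (INR n)). lra.
  - assert (H : forall n, rsum (fun n => / (1 + INR n ^ 2)) n <= 4 - 4 / (INR n + 1)).
    { induction n. simpl. lra. cbn [rsum]. rewrite S_INR. assert (Hn := pos_INR n). set (x := INR n) in *.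
      apply Rle_trans with (4 - 4 / (x + 1) + / (1 + x ^ 2)). lra.
      assert (/ (1 + x ^ 2) <= 4 / ((x + 1) * (x + 2))).
      { apply Rmult_le_reg_l with ((1 + x ^ 2) * ((x + 1) * (x + 2))). apply Rmult_lt_0_compat; nra.
        replace ((1 + x ^ 2) * ((x + 1) * (x + 2)) * / (1 + x ^ 2)) with ((x + 1) * (x + 2)) by (field; nra).
        replace ((1 + x ^ 2) * ((x + 1) * (x + 2)) * (4 / ((x + 1) * (x + 2)))) with (4 * (1 + x ^ 2)) by (field; lra). nra. }
      replace (4 / ((x + 1) * (x + 2))) with (4 / (x + 1) - 4 / (x + 1 + 1)) in H by (field; lra). lra. }
    intros n. specialize (H n). assert (Hn := pos_INR n).
    assert (0 < 4 / (INR n + 1)) by (apply Rdiv_lt_0_compat; lra). lra.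
Qed.

(** A quantitative form of w not being an integer: one constant serves all integer translates, and
    series over them are then dominated by the sum of 1 / (1 + n^2). *)
Definition away (c : R) (w : C) : Prop :=
  0 < c /\ forall n : R, (exists z : Z, n = IZR z) -> c * (1 + n ^ 2) <= Cmod (w + RtoC n) ^ 2.

(** After multiplication by s = 1 + x^2 + y^2 the difference of the two sides is p^2 + (x p + y^2
    m)^2 with p = m x + n. *)
Lemma quad_form_lower (x y m n : R) : y <> 0 ->
  y ^ 2 / (1 + x ^ 2 + y ^ 2) * (m ^ 2 + n ^ 2) <= (m * x + n) ^ 2 + m ^ 2 * y ^ 2.
Proof.
  intros Hy. set (s := 1 + x ^ 2 + y ^ 2). assert (Hs : 0 < s) by (unfold s; nra).
  apply Rmult_le_reg_l with s; auto.
  replace (s * (y ^ 2 / s * (m ^ 2 + n ^ 2))) with (y ^ 2 * (m ^ 2 + n ^ 2)) by (field; lra).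
  set (p := m * x + n). replace n with (p - m * x) by (unfold p; ring). unfold s.
  assert (H0 : 0 <= p ^ 2 + (x * p + y ^ 2 * m) ^ 2) by (apply Rplus_le_le_0_compat; apply pow2_ge_0).
  apply Rminus_le_0. match goal with |- 0 <= ?e => replace e with (p ^ 2 + (x * p + y ^ 2 * m) ^ 2) by ring end. exact H0.
Qed.

Lemma lattice_lower z : 0 < Im z ->
  exists c, 0 < c /\ forall m n : R, c * (m ^ 2 + n ^ 2) <= Cmod (RtoC m * z + RtoC n) ^ 2.
Proof.
  intros Hz. set (x := Re z). set (y := Im z) in *.
  exists (y ^ 2 / (1 + x ^ 2 + y ^ 2)). split.
  apply Rdiv_lt_0_compat; nra.
  intros m n. rewrite Cmod2_alt.
  replace (Re (m * z + n)) with (m * x + n) by (unfold x; simpl; unfold Re; ring).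
  replace (Im (m * z + n)) with (m * y) by (unfold y; simpl; unfold Im; ring).
  rewrite Rpow_mult_distr. apply quad_form_lower. lra.
Qed.

Lemma away_H z : 0 < Im z -> exists c, away c z.
Proof.
  intros Hz. destruct (lattice_lower z Hz) as [c [Hc H]]. exists c. split; auto.
  intros n _. specialize (H 1 n). rewrite Cmult_1_l in H. replace (1 ^ 2) with 1 in H by ring. exact H.
Qed.

Lemma away_half : away (1 / 8) (RtoC (1 / 2)).
Proof.
  split. lra. intros n [z ->]. rewrite <- RtoC_plus, Cmod_R, pow2_abs.
  destruct (Z_le_gt_dec 0 z) as [Hz|Hz].
  apply IZR_le in Hz. nra. assert (H : (z <= -1)%Z) by lia. apply IZR_le in H. nra.
Qed.

Lemma away_pos c w n : away c w -> (exists z : Z, n = IZR z) -> 0 < c * (1 + n ^ 2) <= Cmod (w + RtoC n) ^ 2.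
Proof. intros [Hc H] Hn. split; auto. nra. Qed.

Lemma INR_isZ j : exists z : Z, INR j = IZR z.
Proof. exists (Z.of_nat j). apply INR_IZR_INZ. Qed.
Lemma mINR_isZ j : exists z : Z, - 1 - INR j = IZR z.
Proof. exists (- 1 - Z.of_nat j)%Z. rewrite minus_IZR, <- INR_IZR_INZ. reflexivity. Qed.

Definition c2pi : C := (RtoC (2 * PI) * Ci)%C.
Lemma c2pi_nz : c2pi <> 0.
Proof.
  unfold c2pi. apply Cmult_neq_0. intros E; apply RtoC_inj in E. assert (H := PI_RGT_0). lra. apply Ci_nz.
Qed.
Lemma Cmod_c2pi : Cmod c2pi = 2 * PI.
Proof. unfold c2pi. rewrite Cmod_mult, Cmod_Ci, Cmod_R, Rabs_pos_eq. ring. assert (H := PI_RGT_0). lra. Qed.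
Lemma cE_c2pi u : cE u = cexp (c2pi * u). Proof. reflexivity. Qed.

Lemma Clim_cE_p2 v : Clim (fun k => cE (v / p2 (S k))) 1.
Proof.
  replace (RtoC 1) with (RtoC 0 + 1)%C by ring.
  apply Clim_ext with (fun k => (cE (v / p2 (S k)) - 1) + 1)%C. intros; ring.
  apply Clim_plus; [|apply Clim_const].
  set (e := exp (Cmod (c2pi * v))).
  apply Clim_0_le with (fun k => 2 * (Cmod (c2pi * v) * e) * (/ 2) ^ S k).
  - intros k. rewrite cE_c2pi. eapply Rle_trans; [apply cexp_bound1|].
    assert (E : Cmod (c2pi * (v / p2 (S k))) = Cmod (c2pi * v) * (/ 2) ^ S k).
    { unfold Cdiv. rewrite Cmult_assoc, Cmod_mult, Cmod_inv by apply p2_nz. unfold p2.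
      rewrite Cmod_R, Rabs_pos_eq by (left; apply p2_pos). rewrite <- pow_inv. ring. }
    rewrite E. assert (H0 := Cmod_ge_0 (c2pi * v)).
    assert (Hp : 0 < (/ 2) ^ S k <= 1). { split. apply pow_lt; lra. rewrite <- (pow1 (S k)). apply pow_incr; lra. }
    assert (exp (Cmod (c2pi * v) * (/ 2) ^ S k) <= e) by (apply exp_le; nra).
    set (a := Cmod (c2pi * v)) in *. set (h := (/ 2) ^ S k) in *.
    replace (2 * (a * e) * h) with (2 * (a * h * e)) by ring.
    apply Rmult_le_compat_l; [lra|]. apply Rmult_le_compat_l; auto. nra.
  - replace (Finite 0) with (Rbar_mult (2 * (Cmod (c2pi * v) * e)) 0) by (simpl; f_equal; ring).
    apply is_lim_seq_scal_l. apply (is_lim_seq_incr_1 (fun k => (/ 2) ^ k)). apply is_lim_seq_geom.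
    rewrite Rabs_pos_eq; lra.
Qed.

Lemma Clim_deriv_p2 v : Clim (fun k => p2 (S k) * (1 - cE (v / p2 (S k))))%C (- (c2pi * v))%C.
Proof.
  apply Clim_ext with (fun k => - (p2 (S k) * (cexp (c2pi * (v / p2 (S k))) - 1 - c2pi * (v / p2 (S k)))) + - (c2pi * v))%C.
  { intros k. rewrite cE_c2pi. field. apply p2_nz. }
  replace (- (c2pi * v))%C with (- 0 + - (c2pi * v))%C at 1 by ring.
  apply Clim_plus; [|apply Clim_const]. apply Clim_opp.
  set (e := exp (Cmod (c2pi * v))). set (a := Cmod (c2pi * v)) in *.
  apply Clim_0_le with (fun k => 4 * (a ^ 2 * e) * (/ 2) ^ S k).
  - intros k. rewrite Cmod_mult. unfold p2 at 1. rewrite Cmod_R, Rabs_pos_eq by (left; apply p2_pos).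
    assert (E : Cmod (c2pi * (v / p2 (S k))) = a * (/ 2) ^ S k).
    { unfold Cdiv. rewrite Cmult_assoc, Cmod_mult, Cmod_inv by apply p2_nz. unfold p2.
      rewrite Cmod_R, Rabs_pos_eq by (left; apply p2_pos). rewrite <- pow_inv. unfold a. ring. }
    assert (B := cexp_bound2 (c2pi * (v / p2 (S k)))). rewrite E in B.
    assert (H0 : 0 <= a) by apply Cmod_ge_0.
    assert (Hp : 0 < (/ 2) ^ S k <= 1). { split. apply pow_lt; lra. rewrite <- (pow1 (S k)). apply pow_incr; lra. }
    assert (Hi : 2 ^ S k * (/ 2) ^ S k = 1). { rewrite <- Rpow_mult_distr. replace (2 * / 2) with 1 by field. apply pow1. }
    assert (exp (a * (/ 2) ^ S k) <= e) by (apply exp_le; fold a; nra).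
    set (h := (/ 2) ^ S k) in *. assert (P := p2_pos (S k)). set (N := 2 ^ S k) in *.
    apply Rle_trans with (N * (4 * ((a * h) ^ 2 * e))).
    + apply Rmult_le_compat_l; [lra|]. eapply Rle_trans; [apply B|]. apply Rmult_le_compat_l; [lra|].
      apply Rmult_le_compat_l; auto. apply pow2_ge_0.
    + right. replace (N * (4 * ((a * h) ^ 2 * e))) with (4 * (a ^ 2 * e) * h * (N * h)) by ring. rewrite Hi. ring.
  - replace (Finite 0) with (Rbar_mult (4 * (a ^ 2 * e)) 0) by (simpl; f_equal; ring).
    apply is_lim_seq_scal_l. apply (is_lim_seq_incr_1 (fun k => (/ 2) ^ k)). apply is_lim_seq_geom.
    rewrite Rabs_pos_eq; lra.
Qed.

(* Up to constant factors these are pi cot(pi w) and pi^2 / sin(pi w)^2. *)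
Definition cotan (w : C) : C := ((1 + cE w) / (1 - cE w))%C.
Definition cosec2 (w : C) : C := (cE w / (1 - cE w) ^ 2)%C.

Lemma cE_half_sq w : (cE (w / 2) * cE (w / 2))%C = cE w.
Proof. rewrite <- cE_plus. f_equal. field. Qed.
Lemma cE_half_shift w : cE ((w + 1) / 2) = (- cE (w / 2))%C.
Proof.
  replace ((w + 1) / 2)%C with (w / 2 + RtoC (1 / 2))%C by (rewrite RtoC_div by lra; field).
  rewrite cE_plus, cE_half. replace (RtoC (- 1)) with (- RtoC 1)%C by (apply C_eq; simpl; ring). ring.
Qed.

Lemma cotan_dup w : cE w <> 1 -> cotan w = (/ 2 * (cotan (w / 2) + cotan ((w + 1) / 2)))%C.
Proof.
  intros H. unfold cotan. rewrite cE_half_shift, <- (cE_half_sq w). rewrite <- (cE_half_sq w) in H.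
  set (x := cE (w / 2)) in *.
  assert (H1 : (1 - x <> 0)%C). { intros E. apply H. replace x with (1 - (1 - x))%C by ring. rewrite E. ring. }
  assert (H2 : (1 + x <> 0)%C). { intros E. apply H. replace x with ((1 + x) - 1)%C by ring. rewrite E. ring. }
  replace (1 - - x)%C with (1 + x)%C by ring.
  assert (H3 : (1 - x * x <> 0)%C). { replace (1 - x * x)%C with ((1 - x) * (1 + x))%C by ring. now apply Cmult_neq_0. }
  field. auto.
Qed.

Lemma cosec2_dup w : cE w <> 1 -> cosec2 w = (/ 4 * (cosec2 (w / 2) + cosec2 ((w + 1) / 2)))%C.
Proof.
  intros H. unfold cosec2. rewrite cE_half_shift, <- (cE_half_sq w). rewrite <- (cE_half_sq w) in H.
  set (x := cE (w / 2)) in *.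
  assert (H1 : (1 - x <> 0)%C). { intros E. apply H. replace x with (1 - (1 - x))%C by ring. rewrite E. ring. }
  assert (H2 : (1 + x <> 0)%C). { intros E. apply H. replace x with ((1 + x) - 1)%C by ring. rewrite E. ring. }
  replace (1 - - x)%C with (1 + x)%C by ring.
  assert (H3 : (1 - x * x <> 0)%C). { replace (1 - x * x)%C with ((1 - x) * (1 + x))%C by ring. now apply Cmult_neq_0. }
  field. auto.
Qed.

Lemma cotan_per w : cotan (w + 1) = cotan w. Proof. unfold cotan. now rewrite cE_per. Qed.
Lemma cosec2_per w : cosec2 (w + 1) = cosec2 w. Proof. unfold cosec2. now rewrite cE_per. Qed.

Lemma one_minus_nz X : X <> RtoC 1 -> (1 - X)%C <> 0.
Proof. intros H E. apply H. replace X with (1 - (1 - X))%C by ring. rewrite E. ring. Qed.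

(** [pole1] and [pole2] are the principal parts of [cotan] and [cosec2] at 0, because [1 - cE v] is
    - c2pi v to first order. *)
Definition pole1 (v : C) : C := (2 / - (c2pi * v))%C.
Definition pole2 (v : C) : C := (/ (c2pi * v) ^ 2)%C.

(** With 1/0 = 0 the rewritings in [Clim_cosec2_p2] and [Clim_cotan_p2] hold for every k, also where
    the rescaled argument hits a pole. *)
Lemma Cinv_0 : (/ 0)%C = 0.
Proof. unfold Cinv; apply C_eq; simpl; unfold Rdiv; ring. Qed.

Lemma half_pow k : ((/ 2) ^ S k)%C = (/ p2 (S k))%C.
Proof. rewrite Cpow_inv by apply C2_nz. unfold p2. now rewrite RtoC_pow. Qed.
Lemma quarter_pow k : ((/ 4) ^ S k)%C = (/ p2 (S k) ^ 2)%C.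
Proof.
  replace (/ 4)%C with (/ 2 * / 2)%C by (field; apply C2_nz).
  rewrite Cpow_mult_l, half_pow. field. apply p2_nz.
Qed.

Lemma one_minus_cE_p2_lower :
  exists c, 0 < c /\ forall k v, Rabs (Re v) <= 3 / 4 * 2 ^ S k -> Rabs (Im v) <= 2 ^ S k ->
    c * Cmod v <= Cmod (p2 (S k) * (1 - cE (v / p2 (S k))))%C.
Proof.
  destruct one_minus_cE_lower as [c [Hc H]]. exists c. split; auto. intros k v H1 H2.
  assert (P := p2_pos (S k)).
  assert (E : (v / p2 (S k) = RtoC (/ 2 ^ S k) * v)%C).
  { unfold p2. rewrite RtoC_inv by lra. unfold Cdiv. ring. }
  specialize (H (v / p2 (S k))%C).
  rewrite E in H at 1 2. rewrite re_scal_l, im_scal_l in H.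
  rewrite !Rabs_mult, (Rabs_pos_eq (/ _)) in H by (left; now apply Rinv_0_lt_compat).
  assert (G := H ltac:(apply Rmult_le_reg_l with (2 ^ S k); auto; rewrite <- Rmult_assoc, Rinv_r by lra; lra)
    ltac:(apply Rmult_le_reg_l with (2 ^ S k); auto; rewrite <- Rmult_assoc, Rinv_r by lra; lra)).
  rewrite Cmod_div in G by apply p2_nz. unfold p2 at 1 in G. rewrite Cmod_R, Rabs_pos_eq in G by lra.
  rewrite Cmod_mult. unfold p2 at 1. rewrite Cmod_R, Rabs_pos_eq by lra.
  apply Rle_trans with (2 ^ S k * (c * (Cmod v / 2 ^ S k))).
  right; field; lra. apply Rmult_le_compat_l; lra.
Qed.

(** Once |w| + 1 < 2^k / 2, an index j < 2^k keeps the real parts below 3/2 * 2^k = 3/4 * 2^(k+1).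
    This explains the width 3/4 of the window in [one_minus_cE_lower]. *)
Lemma dyadic_threshold (w : C) : exists k0, forall k j, (k0 <= k)%nat -> (j < 2 ^ k)%nat ->
  (Rabs (Re (w + RtoC (INR j))%C) <= 3 / 4 * 2 ^ S k /\ Rabs (Im (w + RtoC (INR j))%C) <= 2 ^ S k) /\
  (Rabs (Re (w - 1 - RtoC (INR j))%C) <= 3 / 4 * 2 ^ S k /\ Rabs (Im (w - 1 - RtoC (INR j))%C) <= 2 ^ S k).
Proof.
  destruct (INR_unbounded (2 * (Cmod w + 1))) as [n Hn]. exists n. intros k j Hk Hj.
  assert (H1 := Nat.pow_gt_lin_r 2 n ltac:(lia)). apply lt_INR in H1. rewrite INR_pow2 in H1.
  assert (H2 : 2 ^ n <= 2 ^ k) by (apply Rle_pow; [lra|lia]).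
  apply lt_INR in Hj. rewrite INR_pow2 in Hj. assert (Hj0 := pos_INR j).
  assert (R := re_le_Cmod w). assert (I := im_le_Cmod w).
  apply Rabs_le_between in R. apply Rabs_le_between in I.
  replace (2 ^ S k) with (2 * 2 ^ k) by reflexivity.
  assert (Hw := Cmod_ge_0 w).
  rewrite !Re_plus, !Im_plus, !Re_minus, !Im_minus, re_RtoC, im_RtoC. simpl (Re 1). simpl (Im 1).
  change (Re 1) with 1. change (Im 1) with 0.
  repeat split; apply Rabs_le; lra.
Qed.

Lemma Clim_cosec2_p2 (v : C) : v <> RtoC 0 -> Clim (fun k => (/ 4) ^ S k * cosec2 (v / p2 (S k)))%C (pole2 v).
Proof.
  intros Hv.
  apply Clim_ext with (fun k => cE (v / p2 (S k)) * / ((p2 (S k) * (1 - cE (v / p2 (S k)))) * (p2 (S k) * (1 - cE (v / p2 (S k))))))%C.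
  { intros k. rewrite quarter_pow. unfold cosec2.
    destruct (Ceq_dec (1 - cE (v / p2 (S k))) 0) as [E|E].
    - rewrite E. replace (0 ^ 2)%C with (RtoC 0) by ring. replace (p2 (S k) * 0 * (p2 (S k) * 0))%C with (RtoC 0) by ring.
      unfold Cdiv. rewrite Cinv_0. ring.
    - field. split; auto using p2_nz. }
  assert (Hn : (- (c2pi * v) <> 0)%C).
  { intros E. apply (Cmult_neq_0 c2pi v c2pi_nz Hv). replace (c2pi * v)%C with (- - (c2pi * v))%C by ring. rewrite E. ring. }
  unfold pole2. replace (/ (c2pi * v) ^ 2)%C with (1 * / (- (c2pi * v) * - (c2pi * v)))%C.
  2:{ field. repeat split; auto using c2pi_nz. }
  apply Clim_mult. apply Clim_cE_p2. apply Clim_inv. now apply Cmult_neq_0.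
  apply Clim_mult; apply Clim_deriv_p2.
Qed.

Lemma Clim_cotan_p2 (v : C) : v <> RtoC 0 -> Clim (fun k => (/ 2) ^ S k * cotan (v / p2 (S k)))%C (pole1 v).
Proof.
  intros Hv.
  apply Clim_ext with (fun k => (1 + cE (v / p2 (S k))) * / (p2 (S k) * (1 - cE (v / p2 (S k)))))%C.
  { intros k. rewrite half_pow. unfold cotan.
    destruct (Ceq_dec (1 - cE (v / p2 (S k))) 0) as [E|E].
    - rewrite E. unfold Cdiv. replace (p2 (S k) * 0)%C with (RtoC 0) by ring.
      rewrite Cinv_0. ring.
    - field. split; auto using p2_nz. }
  unfold pole1. assert (Hn : (- (c2pi * v) <> 0)%C).
  { intros E. apply (Cmult_neq_0 c2pi v c2pi_nz Hv). replace (c2pi * v)%C with (- - (c2pi * v))%C by ring. rewrite E. ring. }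
  replace (2 / - (c2pi * v))%C with ((1 + 1) * / - (c2pi * v))%C by (unfold Cdiv; ring).
  apply Clim_mult. apply Clim_plus. apply Clim_const. apply Clim_cE_p2. apply Clim_inv; auto. apply Clim_deriv_p2.
Qed.

Lemma away_bounds c w j : away c w ->
  0 < c * (1 + INR j ^ 2) <= Cmod (w + RtoC (INR j)) ^ 2 /\ c * (1 + INR j ^ 2) <= Cmod (w - 1 - RtoC (INR j)) ^ 2.
Proof.
  intros H. split. apply (away_pos c w (INR j) H (INR_isZ j)).
  destruct (away_pos c w (- 1 - INR j) H (mINR_isZ j)) as [H1 H2].
  replace (w - 1 - INR j)%C with (w + (- 1 - INR j)%R)%C by (apply C_eq; simpl; ring).
  apply Rle_trans with (2 := H2). apply Rmult_le_compat_l. destruct H; lra. assert (H3 := pos_INR j). nra.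
Qed.

Lemma away_nz_half c w j : away c w -> (w + RtoC (INR j) <> 0)%C /\ (w - 1 - RtoC (INR j) <> 0)%C.
Proof.
  intros H. destruct (away_bounds c w j H) as [H1 H2].
  split; intros E; rewrite E, Cmod_0 in *; replace (0 ^ 2) with 0 in * by ring; lra.
Qed.

Lemma ex_series_scal_inv_sq K : ex_series (fun j => K * / (1 + INR j ^ 2)).
Proof. apply (ex_series_scal (V := R_NormedModule) K _ ex_series_inv_sq). Qed.

Lemma lipschitz2_half c w : away c w -> cE w <> 1 ->
  Csum (fun j => pole2 (w + RtoC (INR j)) + pole2 (w - 1 - RtoC (INR j)))%C = cosec2 w.
Proof.
  intros Ha Hw. destruct one_minus_cE_p2_lower as [c0 [Hc0 Hl]]. destruct (dyadic_threshold w) as [k0 Hk0].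
  assert (Hc : 0 < c) by apply Ha.
  set (K := exp (2 * PI) / (c0 ^ 2 * c)).
  assert (Hpt : forall k v m, Rabs (Re v) <= 3 / 4 * 2 ^ S k -> Rabs (Im v) <= 2 ^ S k -> 0 < c * m -> c * m <= Cmod v ^ 2 ->
     Cmod ((/ 4) ^ S k * cosec2 (v / p2 (S k)))%C <= K * / m).
  { intros k v m H1 H2 H3 H4. assert (L := Hl k v H1 H2).
    assert (Hvp : 0 < Cmod v). { assert (Hv0 := Cmod_ge_0 v). destruct Hv0 as [Hv0|Hv0]; auto. rewrite <- Hv0 in H4. simpl in H4. lra. }
    assert (Hd : 0 < Cmod (p2 (S k) * (1 - cE (v / p2 (S k))))%C) by nra.
    set (d := (p2 (S k) * (1 - cE (v / p2 (S k))))%C) in *.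
    assert (Hdn : d <> 0) by (now apply Cmod_gt_0).
    assert (H1n : (1 - cE (v / p2 (S k)) <> 0)%C). { intros E. apply Hdn. unfold d. rewrite E. ring. }
    replace ((/ 4) ^ S k * cosec2 (v / p2 (S k)))%C with (cE (v / p2 (S k)) / d ^ 2)%C.
    2:{ rewrite quarter_pow. unfold cosec2, d. field. split; auto using p2_nz. }
    rewrite Cmod_div by (now apply Cpow_nz). rewrite Cmod_pow.
    assert (HX : Cmod (cE (v / p2 (S k))) <= exp (2 * PI)).
    { rewrite Cmod_cE. apply exp_le. assert (Hpi := PI_RGT_0). assert (P := p2_pos (S k)).
      assert (E : (v / p2 (S k) = RtoC (/ 2 ^ S k) * v)%C).
      { unfold p2. rewrite RtoC_inv by lra. unfold Cdiv. ring. }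
      rewrite E, im_scal_l. apply Rabs_le_between in H2.
      assert (- 1 <= / 2 ^ S k * Im v). { apply Rmult_le_reg_l with (2 ^ S k); auto. rewrite <- Rmult_assoc, Rinv_r by lra. lra. }
      nra. }
    assert (Hm : 0 < m) by nra.
    assert (Hd2 : c0 ^ 2 * (c * m) <= Cmod d ^ 2).
    { apply Rle_trans with ((c0 * Cmod v) ^ 2). rewrite Rpow_mult_distr. apply Rmult_le_compat_l; auto. apply pow2_ge_0.
      apply pow_incr. split; auto. apply Rmult_le_pos; lra. }
    assert (Hpos : 0 < c0 ^ 2 * (c * m)) by (apply Rmult_lt_0_compat; auto; apply pow_lt; auto).
    unfold K. replace (exp (2 * PI) / (c0 ^ 2 * c) * / m) with (exp (2 * PI) * / (c0 ^ 2 * (c * m))) by (field; lra).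
    apply Rmult_le_compat; auto. apply Cmod_ge_0. left; apply Rinv_0_lt_compat. lra. apply Rinv_le_contravar; auto. }
  apply (dyadic_limit cosec2 (/ 4)%C cosec2_dup cosec2_per w pole2 (fun j => 2 * K * / (1 + INR j ^ 2)) k0); auto.
  - apply ex_series_scal_inv_sq.
  - intros j. apply Rmult_le_pos. apply Rmult_le_pos. lra. left. apply Rdiv_lt_0_compat. apply exp_pos.
    apply Rmult_lt_0_compat; auto. apply pow_lt; auto. left. apply Rinv_0_lt_compat. assert (H := pow2_ge_0 (INR j)). lra.
  - intros k j Hk Hj. destruct (Hk0 k j Hk Hj) as [[A1 A2] [A3 A4]].
    destruct (away_bounds c w j Ha) as [[B0 B1] B2].
    rewrite Cmult_plus_distr_l. eapply Rle_trans; [apply Cmod_triangle|].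
    assert (C1 := Hpt k _ _ A1 A2 B0 B1). assert (C2 := Hpt k _ _ A3 A4 B0 B2). lra.
  - intros j. apply Clim_cosec2_p2. now apply (away_nz_half c).
  - intros j. apply Clim_cosec2_p2. now apply (away_nz_half c).
Qed.

(** A single term is only of size 1/j, so the domination must use the cancellation inside a pair:
    [cotan a + cotan b] has numerator 2 (1 - cE (a + b)), and a + b = (2 w - 1) / 2^(k+1) is small
    independently of j. *)
Lemma lipschitz1_half c w : away c w -> cE w <> 1 ->
  Csum (fun j => pole1 (w + RtoC (INR j)) + pole1 (w - 1 - RtoC (INR j)))%C = cotan w.
Proof.
  intros Ha Hw. destruct one_minus_cE_p2_lower as [c0 [Hc0 Hl]]. destruct (dyadic_threshold w) as [k0 Hk0].
  assert (Hc : 0 < c) by apply Ha.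
  set (s := Cmod (c2pi * (2 * w - 1))).
  set (K := 4 * (s * exp s) / (c0 ^ 2 * c)).
  assert (Hs : 0 <= s) by apply Cmod_ge_0.
  apply (dyadic_limit cotan (/ 2)%C cotan_dup cotan_per w pole1 (fun j => K * / (1 + INR j ^ 2)) k0); auto.
  - apply ex_series_scal_inv_sq.
  - intros j. apply Rmult_le_pos. apply Rdiv_le_0_compat. assert (H := exp_pos s). nra.
    apply Rmult_lt_0_compat; auto. apply pow_lt; auto. left. apply Rinv_0_lt_compat. assert (H := pow2_ge_0 (INR j)). lra.
  - intros k j Hk Hj. destruct (Hk0 k j Hk Hj) as [[A1 A2] [A3 A4]].
    destruct (away_bounds c w j Ha) as [[B0 B1] B2].
    destruct (away_nz_half c w j Ha) as [N1 N2].
    set (v1 := (w + INR j)%C) in *. set (v2 := (w - 1 - INR j)%C) in *.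
    assert (L1 := Hl k v1 A1 A2). assert (L2 := Hl k v2 A3 A4).
    apply Cmod_gt_0 in N1. apply Cmod_gt_0 in N2.
    set (d1 := (p2 (S k) * (1 - cE (v1 / p2 (S k))))%C) in *. set (d2 := (p2 (S k) * (1 - cE (v2 / p2 (S k))))%C) in *.
    assert (D1 : d1 <> 0) by (apply Cmod_gt_0; nra). assert (D2 : d2 <> 0) by (apply Cmod_gt_0; nra).
    assert (E1 : (1 - cE (v1 / p2 (S k)) <> 0)%C). { intros E. apply D1. unfold d1. rewrite E. ring. }
    assert (E2 : (1 - cE (v2 / p2 (S k)) <> 0)%C). { intros E. apply D2. unfold d2. rewrite E. ring. }
    replace ((/ 2) ^ S k * (cotan (v1 / p2 (S k)) + cotan (v2 / p2 (S k))))%C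
      with (2 * (p2 (S k) * (1 - cE ((2 * w - 1) / p2 (S k)))) / (d1 * d2))%C.
    2:{ rewrite half_pow. unfold cotan, d1, d2.
        replace ((2 * w - 1) / p2 (S k))%C with (v1 / p2 (S k) + v2 / p2 (S k))%C by (unfold v1, v2; field; apply p2_nz).
        rewrite cE_plus. field. repeat split; auto using p2_nz. }
    rewrite Cmod_div by (now apply Cmult_neq_0). rewrite !Cmod_mult, Cmod_R, (Rabs_pos_eq 2) by lra.
    assert (P := p2_pos (S k)). assert (P1 : 1 <= 2 ^ S k) by (apply pow_R1_Rle; lra).
    assert (Hnum : Cmod (p2 (S k)) * Cmod (1 - cE ((2 * w - 1) / p2 (S k))) <= 2 * (s * exp s)).
    { unfold p2 at 1. rewrite Cmod_R, Rabs_pos_eq by lra. rewrite Cmod_minus_sym, cE_c2pi.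
      assert (B := cexp_bound1 (c2pi * ((2 * w - 1) / p2 (S k)))).
      assert (E : Cmod (c2pi * ((2 * w - 1) / p2 (S k))) = s / 2 ^ S k).
      { unfold Cdiv. rewrite Cmult_assoc, Cmod_mult, Cmod_inv by apply p2_nz. unfold p2.
        rewrite Cmod_R, Rabs_pos_eq by lra. reflexivity. }
      rewrite E in B.
      assert (s / 2 ^ S k <= s). { apply Rmult_le_reg_r with (2 ^ S k); auto. unfold Rdiv. rewrite Rmult_assoc, Rinv_l by lra. nra. }
      apply Rle_trans with (2 ^ S k * (2 * (s / 2 ^ S k * exp s))).
      apply Rmult_le_compat_l; [lra|]. eapply Rle_trans; [apply B|]. apply Rmult_le_compat_l; [lra|].
      apply Rmult_le_compat_l. apply Rdiv_le_0_compat; lra. now apply exp_le.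
      right. field. lra. }
    set (m := 1 + INR j ^ 2) in *. assert (Hm : 0 < m) by nra.
    assert (Hv : c * m <= Cmod v1 * Cmod v2).
    { apply Rnot_lt_le. intros Hlt. assert (Q : (Cmod v1 * Cmod v2) ^ 2 < (c * m) ^ 2).
      { assert (0 < Cmod v1 * Cmod v2) by (now apply Rmult_lt_0_compat). nra. }
      rewrite Rpow_mult_distr in Q. assert ((c * m) * (c * m) <= Cmod v1 ^ 2 * Cmod v2 ^ 2) by (apply Rmult_le_compat; lra). lra. }
    assert (Hd : c0 ^ 2 * (c * m) <= Cmod d1 * Cmod d2).
    { apply Rle_trans with ((c0 * Cmod v1) * (c0 * Cmod v2)).
      replace (c0 * Cmod v1 * (c0 * Cmod v2)) with (c0 ^ 2 * (Cmod v1 * Cmod v2)) by ring.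
      apply Rmult_le_compat_l; auto. apply pow2_ge_0. apply Rmult_le_compat; auto; apply Rmult_le_pos; lra. }
    assert (Hpos : 0 < c0 ^ 2 * (c * m)) by (apply Rmult_lt_0_compat; auto; apply pow_lt; auto).
    unfold K. replace (4 * (s * exp s) / (c0 ^ 2 * c) * / m) with ((2 * (2 * (s * exp s))) * / (c0 ^ 2 * (c * m))) by (field; lra).
    apply Rmult_le_compat.
    apply Rmult_le_pos; [lra|]. apply Rmult_le_pos; apply Cmod_ge_0.
    left; apply Rinv_0_lt_compat. lra. lra. apply Rinv_le_contravar; auto.
  - intros j. apply Clim_cotan_p2. now apply (away_nz_half c).
  - intros j. apply Clim_cotan_p2. now apply (away_nz_half c).
Qed.

Definition nC (n : nat) : C := RtoC (INR n).
Lemma nC_S n : nC (S n) = (nC n + 1)%C.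
Proof. unfold nC. rewrite S_INR, RtoC_plus. reflexivity. Qed.
Lemma nC_nz n : nC (S n) <> 0.
Proof. unfold nC. intros E. apply RtoC_inj in E. assert (H := pos_INR n). rewrite S_INR in E. lra. Qed.

(** Passes from pairs symmetric about w - 1/2, as the dyadic sums produce them, to pairs w + n, w -
    n without the centre; the extra boundary term tends to 0 in both applications. *)
Lemma csum_sym_half (r : C -> C) w J :
  csum (fun j => r (w + nC (S j)) + r (w - nC (S j)))%C J =
  (csum (fun j => r (w + nC j) + r (w - 1 - nC j)) J - r w + r (w + nC J))%C.
Proof.
  induction J.
  - simpl. unfold nC. simpl INR. rewrite Cplus_0_r. ring.
  - cbn [csum]. rewrite IHJ. replace (w - nC (S J))%C with (w - 1 - nC J)%C by (rewrite nC_S; ring). ring.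
Qed.

Lemma is_lim_seq_inv_S : is_lim_seq (fun n => / (INR n + 1)) 0.
Proof.
  apply is_lim_seq_ext with (fun n => / INR (S n)). intros; now rewrite S_INR.
  apply (is_lim_seq_incr_1 (fun n => / INR n)).
  replace (Finite 0) with (Rbar_inv p_infty) by reflexivity.
  apply is_lim_seq_inv. apply is_lim_seq_INR. discriminate.
Qed.

Lemma inv_bound_of_sq (v : C) (c x : R) : 0 < c -> 0 <= x -> c * (1 + x ^ 2) <= Cmod v ^ 2 ->
  Cmod (/ v)%C <= (1 + 2 / c) * / (x + 1).
Proof.
  intros Hc Hx H. assert (Hv0 := Cmod_ge_0 v).
  assert (Hv : 0 < Cmod v). { destruct Hv0 as [|E]; auto. rewrite <- E in H. simpl in H. nra. }
  rewrite Cmod_inv by (now apply Cmod_gt_0).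
  apply Rmult_le_reg_l with (Cmod v * (x + 1)). apply Rmult_lt_0_compat; lra.
  replace (Cmod v * (x + 1) * / Cmod v) with (x + 1) by (field; lra).
  replace (Cmod v * (x + 1) * ((1 + 2 / c) * / (x + 1))) with (Cmod v * (1 + 2 / c)) by (field; lra).
  assert (Hk : 0 < 2 / c) by (apply Rdiv_lt_0_compat; lra). assert (Hk2 : c * (2 / c) = 2) by (field; lra).
  set (k := 2 / c) in *. apply Rnot_lt_le. intros Hl.
  assert (H1 : (Cmod v * (1 + k)) ^ 2 < (x + 1) ^ 2).
  { assert (0 <= Cmod v * (1 + k)) by (apply Rmult_le_pos; lra). set (a := Cmod v * (1 + k)) in *. nra. }
  rewrite Rpow_mult_distr in H1.
  assert (c * (1 + x ^ 2) * (1 + k) ^ 2 <= Cmod v ^ 2 * (1 + k) ^ 2) by (apply Rmult_le_compat_r; auto; apply pow2_ge_0).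
  assert (2 * (1 + x ^ 2) <= c * (1 + x ^ 2) * (1 + k) ^ 2).
  { replace (c * (1 + x ^ 2) * (1 + k) ^ 2) with ((1 + x ^ 2) * (c + 2 * (c * k) + (c * k) * k)) by ring. rewrite Hk2.
    rewrite (Rmult_comm 2). apply Rmult_le_compat_l; nra. }
  nra.
Qed.

Lemma Clim_inv_away c w : away c w -> Clim (fun J => / (w + nC J))%C 0 /\ Clim (fun J => / (w - nC J))%C 0.
Proof.
  intros H. assert (Hc : 0 < c) by apply H.
  assert (L : is_lim_seq (fun J => (1 + 2 / c) * / (INR J + 1)) 0).
  { replace (Finite 0) with (Rbar_mult (1 + 2 / c) 0) by (simpl; f_equal; ring).
    apply is_lim_seq_scal_l. apply is_lim_seq_inv_S. }
  split; apply Clim_0_le with (2 := L); intros J; apply inv_bound_of_sq; auto using pos_INR; unfold nC.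
  - apply (away_pos c w (INR J) H (INR_isZ J)).
  - replace (w - INR J)%C with (w + (- INR J)%R)%C by (apply C_eq; simpl; ring).
    replace (INR J ^ 2) with ((- INR J) ^ 2) by ring. apply (away_pos c w (- INR J) H).
    exists (- Z.of_nat J)%Z. rewrite opp_IZR, <- INR_IZR_INZ. reflexivity.
Qed.

Lemma away_bounds_sym c w j : away c w ->
  c * (1 + INR j ^ 2) <= Cmod (w + nC (S j)) ^ 2 /\ c * (1 + INR j ^ 2) <= Cmod (w - nC (S j)) ^ 2.
Proof.
  intros H. assert (Hj := pos_INR j). assert (Hc : 0 < c) by apply H.
  destruct (away_pos c w (INR (S j)) H (INR_isZ _)) as [_ H1].
  destruct (away_bounds c w j H) as [_ H2]. split.
  - apply Rle_trans with (2 := H1). rewrite S_INR. nra.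
  - rewrite nC_S. replace (w - (nC j + 1))%C with (w - 1 - INR j)%C by (unfold nC; ring). auto.
Qed.

Lemma sym_nz c w j : away c w -> (w + nC (S j) <> 0)%C /\ (w - nC (S j) <> 0)%C.
Proof.
  intros H. destruct (away_bounds_sym c w j H) as [H1 H2]. assert (Hc : 0 < c) by apply H.
  assert (0 < c * (1 + INR j ^ 2)) by nra.
  split; intros E; rewrite E, Cmod_0 in *; replace (0 ^ 2) with 0 in * by ring; lra.
Qed.

Lemma Cmod_inv_sq_le (v : C) (b : R) : 0 < b -> b <= Cmod v ^ 2 -> Cmod (pole2 v) <= / b.
Proof.
  intros Hb H. assert (Hv : v <> 0). { intros E. rewrite E, Cmod_0 in H. replace (0 ^ 2) with 0 in H by ring. lra. }
  unfold pole2. assert (Hn := Cmult_neq_0 _ _ c2pi_nz Hv). rewrite Cmod_inv by (now apply Cpow_nz).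
  rewrite Cmod_pow, Cmod_mult, Cmod_c2pi. apply Rinv_le_contravar; auto.
  assert (Hpi := PI2_3_2). rewrite Rpow_mult_distr.
  assert (1 <= (2 * PI) ^ 2) by nra. nra.
Qed.

Lemma summ_pole2_sym c w : away c w ->
  summ (fun j => pole2 (w + nC (S j))) /\ summ (fun j => pole2 (w - nC (S j))) /\ summ (fun j => pole2 (w + nC j)).
Proof.
  intros H. assert (Hc : 0 < c) by apply H.
  assert (B : forall j, / (c * (1 + INR j ^ 2)) = / c * / (1 + INR j ^ 2)).
  { intros. assert (H0 := pow2_ge_0 (INR j)). field. lra. }
  assert (P : forall j, 0 < c * (1 + INR j ^ 2)) by (intros; assert (H0 := pow2_ge_0 (INR j)); nra).
  split; [|split]; apply summ_le with (2 := ex_series_scal_inv_sq (/ c)); intros j; rewrite <- B; apply Cmod_inv_sq_le; auto.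
  apply (away_bounds_sym c w j H). apply (away_bounds_sym c w j H). apply (away_bounds c w j H).
Qed.

Lemma lipschitz2 c w : away c w -> cE w <> 1 ->
  Csum (fun j => pole2 (w + nC (S j)) + pole2 (w - nC (S j)))%C = (cosec2 w - pole2 w)%C.
Proof.
  intros H Hw. destruct (summ_pole2_sym c w H) as [S1 [S2 S3]].
  apply Csum_unique. apply Clim_ext with (fun J => csum (fun j => pole2 (w + nC j) + pole2 (w - 1 - nC j)) J - pole2 w + pole2 (w + nC J))%C.
  intros; now rewrite csum_sym_half.
  replace (cosec2 w - pole2 w)%C with (cosec2 w - pole2 w + 0)%C by ring. apply Clim_plus.
  - apply Clim_minus; [|apply Clim_const]. rewrite <- (lipschitz2_half c w H Hw). apply Clim_Csum.
    apply summ_plus; auto. apply summ_ext with (2 := S2). intros j. f_equal. rewrite nC_S. unfold nC. ring.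
  - destruct (Clim_inv_away c w H) as [L _].
    replace (RtoC 0) with (/ c2pi * / c2pi * (0 * 0))%C by ring.
    apply Clim_ext with (fun J => / c2pi * / c2pi * (/ (w + nC J) * / (w + nC J)))%C.
    + intros J. unfold pole2. destruct (away_nz_half c w J H) as [N _]. fold (nC J) in N. field. split; auto using c2pi_nz.
    + apply Clim_scal. now apply Clim_mult.
Qed.

Lemma pole1_inv v : v <> RtoC 0 -> pole1 v = (- (2 / c2pi) * / v)%C.
Proof. intros H. unfold pole1. field. split; auto using c2pi_nz. Qed.

Lemma summ_pole1_sym c w : away c w -> summ (fun j => / (w + nC (S j)) + / (w - nC (S j)))%C.
Proof.
  intros H. assert (Hc : 0 < c) by apply H.
  apply summ_le with (2 := ex_series_scal_inv_sq (2 * Cmod w / c)). intros j.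
  destruct (sym_nz c w j H) as [N1 N2]. destruct (away_bounds_sym c w j H) as [B1 B2].
  replace (/ (w + nC (S j)) + / (w - nC (S j)))%C with (2 * w / ((w + nC (S j)) * (w - nC (S j))))%C by (field; auto).
  rewrite Cmod_div by (now apply Cmult_neq_0). rewrite !Cmod_mult, Cmod_R, (Rabs_pos_eq 2) by lra.
  set (v1 := (w + nC (S j))%C) in *. set (v2 := (w - nC (S j))%C) in *.
  apply Cmod_gt_0 in N1. apply Cmod_gt_0 in N2.
  assert (H0 := pow2_ge_0 (INR j)).
  set (m := 1 + INR j ^ 2) in *. assert (Hm : 0 < m) by (unfold m; lra).
  assert (Hv : c * m <= Cmod v1 * Cmod v2).
  { apply Rnot_lt_le. intros Hlt. assert (Q : (Cmod v1 * Cmod v2) ^ 2 < (c * m) ^ 2).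
    { assert (0 < Cmod v1 * Cmod v2) by (now apply Rmult_lt_0_compat). nra. }
    rewrite Rpow_mult_distr in Q. assert ((c * m) * (c * m) <= Cmod v1 ^ 2 * Cmod v2 ^ 2) by (apply Rmult_le_compat; nra). lra. }
  replace (2 * Cmod w / c * / m) with (2 * Cmod w * / (c * m)) by (field; lra).
  apply Rmult_le_compat_l. assert (Hw := Cmod_ge_0 w); lra. apply Rinv_le_contravar; auto. nra.
Qed.

(** The expansion of PI cot(PI w), which is exactly - c2pi / 2 * [cotan w]. *)
Lemma lipschitz1 c w : away c w -> cE w <> 1 ->
  Csum (fun j => / (w + nC (S j)) + / (w - nC (S j)))%C = (- (c2pi / 2) * cotan w - / w)%C.
Proof.
  intros H Hw. assert (Hs := summ_pole1_sym c w H).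
  assert (Hw0 : w <> 0). { destruct (away_nz_half c w 0 H) as [N _]. simpl in N. now rewrite Cplus_0_r in N. }
  assert (L : Clim (csum (fun j => pole1 (w + nC j) + pole1 (w - 1 - nC j))%C) (cotan w)).
  { rewrite <- (lipschitz1_half c w H Hw). apply Clim_Csum.
    apply summ_le with (2 := ex_series_scal_inv_sq (2 / PI * Cmod (2 * w - 1) / c)).
    intros j. destruct (away_nz_half c w j H) as [N1 N2]. destruct (away_bounds c w j H) as [[B0 B1] B2].
    fold (nC j) in *.
    assert (Hc : 0 < c) by apply H. assert (Hpi := PI_RGT_0).
    rewrite !pole1_inv by auto.
    replace (- (2 / c2pi) * / (w + nC j) + - (2 / c2pi) * / (w - 1 - nC j))%C with (- (2 / c2pi) * ((2 * w - 1) / ((w + nC j) * (w - 1 - nC j))))%C by (field; auto using c2pi_nz).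
    rewrite Cmod_mult, Cmod_opp, !Cmod_div by (auto using c2pi_nz, Cmult_neq_0). rewrite Cmod_c2pi, Cmod_R, (Rabs_pos_eq 2) by lra.
    rewrite Cmod_mult.
    set (v1 := (w + nC j)%C) in *. set (v2 := (w - 1 - nC j)%C) in *.
    apply Cmod_gt_0 in N1. apply Cmod_gt_0 in N2.
    assert (H0 := pow2_ge_0 (INR j)). set (m := 1 + INR j ^ 2) in *. assert (Hm : 0 < m) by (unfold m; lra).
    assert (Hv : c * m <= Cmod v1 * Cmod v2).
    { apply Rnot_lt_le. intros Hlt. assert (Q : (Cmod v1 * Cmod v2) ^ 2 < (c * m) ^ 2).
      { assert (0 < Cmod v1 * Cmod v2) by (now apply Rmult_lt_0_compat). nra. }
      rewrite Rpow_mult_distr in Q. assert ((c * m) * (c * m) <= Cmod v1 ^ 2 * Cmod v2 ^ 2) by (apply Rmult_le_compat; nra). lra. }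
    replace (2 / PI * Cmod (2 * w - 1) / c * / m) with (2 / PI * (Cmod (2 * w - 1) * / (c * m))) by (field; lra).
    apply Rmult_le_compat. apply Rdiv_le_0_compat; lra.
    apply Rdiv_le_0_compat. apply Cmod_ge_0. now apply Rmult_lt_0_compat.
    unfold Rdiv. apply Rmult_le_compat_l; [lra|]. apply Rinv_le_contravar; lra.
    apply Rmult_le_compat_l. apply Cmod_ge_0. apply Rinv_le_contravar; auto. }
  assert (L2 : Clim (csum (fun j => / (w + nC (S j)) + / (w - nC (S j)))%C) (- (c2pi / 2) * (cotan w - pole1 w + 0))%C).
  { apply Clim_ext with (fun J => - (c2pi / 2) * (csum (fun j => pole1 (w + nC j) + pole1 (w - 1 - nC j)) J - pole1 w + pole1 (w + nC J)))%C.
    - intros J. rewrite <- csum_sym_half, <- csum_scal. apply csum_ext. intros j _. destruct (sym_nz c w j H) as [N1 N2].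
      rewrite !pole1_inv by auto. field. auto using c2pi_nz.
    - apply Clim_scal. apply Clim_plus. apply Clim_minus; auto. apply Clim_const.
      replace (RtoC 0) with (- (2 / c2pi) * 0)%C by ring.
      apply Clim_ext with (fun J => - (2 / c2pi) * / (w + nC J))%C.
      intros J. rewrite pole1_inv; auto. apply (away_nz_half c w J H).
      apply Clim_scal. apply (Clim_inv_away c w H). }
  rewrite (Csum_unique _ _ L2). rewrite pole1_inv by auto. field. auto using c2pi_nz.
Qed.

(** * The value of zeta(2) *)

Lemma csum_pairs a n : csum a (2 * n) = csum (fun j => a (2 * j)%nat + a (2 * j + 1)%nat)%C n.
Proof.
  induction n; auto. replace (2 * S n)%nat with (S (S (2 * n))) by lia. cbn [csum]. rewrite IHn.
  replace (S (2 * n)) with (2 * n + 1)%nat by lia. ring.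
Qed.

(** Equal to - zeta(2) / (4 PI^2), so that its value -1/24 amounts to zeta(2) = PI^2 / 6. *)
Definition zeta2 : C := Csum (fun j => pole2 (nC (S j))).

Lemma pole2_scale a v : a <> RtoC 0 -> v <> RtoC 0 -> pole2 (a * v) = (/ a ^ 2 * pole2 v)%C.
Proof. intros Ha Hv. unfold pole2. field. auto using c2pi_nz. Qed.

Lemma summ_pole2_nat : summ (fun j => pole2 (nC (S j))).
Proof.
  apply summ_le with (2 := ex_series_inv_sq). intros j. apply Cmod_inv_sq_le. assert (H := pow2_ge_0 (INR j)); lra.
  unfold nC. rewrite Cmod_R, pow2_abs, S_INR. assert (H := pos_INR j). nra.
Qed.

(** Partial fractions of [cosec2] at 1/2 evaluate the sum over odd numbers as -1/32. The even
    numbers contribute a quarter of the whole, and the resulting linear equation is solved. *)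
Lemma zeta2_value : zeta2 = (- / 24)%C.
Proof.
  assert (Hw : cE (RtoC (1 / 2)) <> 1). { rewrite cE_half. intros E. apply RtoC_inj in E. lra. }
  assert (H := lipschitz2_half _ _ away_half Hw).
  destruct (summ_pole2_sym _ _ away_half) as [_ [_ S3]].
  assert (E : cosec2 (RtoC (1 / 2)) = (- / 4)%C).
  { unfold cosec2. rewrite cE_half. replace (RtoC (- 1)) with (- RtoC 1)%C by (apply C_eq; simpl; ring).
    replace (1 - - (1))%C with (RtoC 2) by ring. field. }
  rewrite E in H.
  rewrite (Csum_ext _ (fun j => 2 * pole2 (RtoC (1 / 2) + nC j))%C) in H.
  2:{ intros j. fold (nC j). replace (RtoC (1 / 2) - 1 - nC j)%C with (- (RtoC (1 / 2) + nC j))%C.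
      unfold pole2. replace ((c2pi * - (RtoC (1 / 2) + nC j)) ^ 2)%C with ((c2pi * (RtoC (1 / 2) + nC j)) ^ 2)%C by ring. ring.
      apply C_eq; unfold nC; simpl; lra. }
  rewrite Csum_scal in H by auto.
  set (A := Csum (fun j => pole2 (RtoC (1 / 2) + nC j))) in *.
  assert (HA : A = (- / 8)%C). { replace A with (/ 2 * (2 * A))%C by (field). rewrite H. field. }
  assert (Hodd : Csum (fun j => pole2 (nC (S (2 * j)))) = (- / 32)%C).
  { rewrite (Csum_ext _ (fun j => / 4 * pole2 (RtoC (1 / 2) + nC j))%C).
    rewrite Csum_scal by auto. fold A. rewrite HA. field.
    intros j. replace (nC (S (2 * j))) with (2 * (RtoC (1 / 2) + nC j))%C.
    rewrite pole2_scale. field. apply C2_nz. apply (away_nz_half _ _ j away_half).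
    unfold nC. rewrite S_INR, mult_INR. apply C_eq; simpl; lra. }
  assert (Heven : Csum (fun j => pole2 (nC (S (2 * j + 1)))) = (/ 4 * zeta2)%C).
  { unfold zeta2. rewrite <- Csum_scal by apply summ_pole2_nat. apply Csum_ext. intros j.
    replace (nC (S (2 * j + 1))) with (2 * nC (S j))%C.
    rewrite pole2_scale. field. apply C2_nz. apply nC_nz.
    unfold nC. rewrite !S_INR, plus_INR, mult_INR. apply C_eq; simpl; lra. }
  assert (Z : zeta2 = (- / 32 + / 4 * zeta2)%C).
  { rewrite <- Hodd, <- Heven. rewrite <- Csum_plus.
    - unfold zeta2. symmetry. apply Csum_unique.
      apply Clim_ext with (fun n => csum (fun j => pole2 (nC (S j))) (2 * n)). intros n. apply csum_pairs.
      apply (Clim_comp (csum (fun j => pole2 (nC (S j)))) _ (fun n => (2 * n)%nat)). intros; cbv beta; lia.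
      apply Clim_Csum, summ_pole2_nat.
    - apply summ_ext with (fun j => / 4 * pole2 (RtoC (1 / 2) + nC j))%C; [|now apply summ_scal].
      intros j. replace (nC (S (2 * j))) with (2 * (RtoC (1 / 2) + nC j))%C.
      rewrite pole2_scale. field. apply C2_nz. apply (away_nz_half _ _ j away_half).
      unfold nC. rewrite S_INR, mult_INR. apply C_eq; simpl; lra.
    - apply summ_ext with (fun j => / 4 * pole2 (nC (S j)))%C; [|apply summ_scal, summ_pole2_nat].
      intros j. replace (nC (S (2 * j + 1))) with (2 * nC (S j))%C.
      rewrite pole2_scale. field. apply C2_nz. apply nC_nz.
      unfold nC. rewrite !S_INR, plus_INR, mult_INR. apply C_eq; simpl; lra. }
  replace zeta2 with (4 / 3 * (zeta2 - / 4 * zeta2))%C by field.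
  rewrite Z at 1. field.
Qed.

(** * The inversion z -> -1/z for the weight 2 lattice sum *)

Lemma Clim_eq s l m : Clim s l -> l = m -> Clim s m. Proof. now intros H <-. Qed.

(** Equal to 1 / (c2pi^2 (w^2 - 1)): it differs from [pole2 w] by a term of order w^-4, and it
    telescopes under unit translations. The difference [dif2] is therefore absolutely summable over
    the lattice. *)
Definition tele (w : C) : C := (/ (2 * c2pi ^ 2) * (/ (w - 1) - / (w + 1)))%C.
Definition dif2 (w : C) : C := (pole2 w - tele w)%C.
(** The points n and -n of a row are grouped, with n = 0 counted once, so that rows and columns are
    indexed by [nat]; row m belongs to the multiple m + 1 of z. *)
Definition row_term (z : C) (m n : nat) : C :=
  match n with
  | O => dif2 (nC (S m) * z)
  | S k => (dif2 (nC (S m) * z + nC (S k)) + dif2 (nC (S m) * z - nC (S k)))%C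
  end.

Lemma Im_pos_nz w : 0 < Im w -> w <> RtoC 0.
Proof. intros H E. rewrite E in H. simpl in H. lra. Qed.
Lemma Im_nCz m z : 0 < Im z -> 0 < Im (nC (S m) * z)%C.
Proof.
  intros H. unfold nC. rewrite im_scal_l, S_INR. assert (Hm := pos_INR m). nra.
Qed.
Lemma Im_add_R w (x : R) : Im (w + RtoC x)%C = Im w.
Proof. simpl. unfold Im. ring. Qed.
Lemma Im_sub_R w (x : R) : Im (w - RtoC x)%C = Im w.
Proof. simpl. unfold Im. ring. Qed.
Lemma Im_pos_add_nz w (x : R) : 0 < Im w -> (w + RtoC x <> 0)%C.
Proof. intros H. apply Im_pos_nz. now rewrite Im_add_R. Qed.
Lemma Im_pos_sub_nz w (x : R) : 0 < Im w -> (w - RtoC x <> 0)%C.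
Proof. intros H. apply Im_pos_nz. now rewrite Im_sub_R. Qed.

Lemma dif2_eq w : 0 < Im w -> dif2 w = (- / (c2pi ^ 2 * w ^ 2 * ((w - 1) * (w + 1))))%C.
Proof.
  intros H. unfold dif2, pole2, tele. assert (H1 := Im_pos_sub_nz w 1 H). assert (H2 := Im_pos_add_nz w 1 H).
  assert (H3 := Im_pos_nz w H). field. repeat split; auto using c2pi_nz.
Qed.

Lemma dif2_bound z : 0 < Im z -> exists K, 0 <= K /\ forall (m : nat) (n : R),
  Cmod (dif2 (nC (S m) * z + RtoC n)) <= K * / (1 + INR m ^ 2) * / (1 + n ^ 2).
Proof.
  intros Hz. destruct (lattice_lower z Hz) as [c [Hc H]].
  exists (3 / c ^ 2). split. apply Rdiv_le_0_compat. lra. now apply pow_lt.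
  intros m n. set (w := (nC (S m) * z + n)%C).
  assert (Hw : 0 < Im w) by (unfold w; rewrite Im_add_R; now apply Im_nCz).
  rewrite dif2_eq, Cmod_opp by auto.
  set (M := INR (S m)). assert (HM : 1 <= M) by (unfold M; rewrite S_INR; assert (H0 := pos_INR m); lra).
  set (s := M ^ 2 + n ^ 2).
  assert (HM2 : 1 <= M ^ 2) by nra.
  assert (Hs : 1 + n ^ 2 <= s) by (unfold s; lra).
  assert (B0 : c * s <= Cmod w ^ 2) by apply (H M n).
  (* Shifting n by 1 costs at most a factor 3 in M^2 + n^2, because M >= 1. *)
  assert (B1 : c * s <= 3 * Cmod (w - 1) ^ 2).
  { assert (H1 := H M (n - 1)). replace (M * z + (n - 1)%R)%C with (w - 1)%C in H1 by (unfold w, nC, M; rewrite RtoC_minus; ring).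
    apply Rle_trans with (3 * (c * (M ^ 2 + (n - 1) ^ 2))); [|lra].
    replace (3 * (c * (M ^ 2 + (n - 1) ^ 2))) with (c * (3 * (M ^ 2 + (n - 1) ^ 2))) by ring.
    apply Rmult_le_compat_l; [lra|]. unfold s. assert (0 <= (2 * n - 3) ^ 2) by apply pow2_ge_0. nra. }
  assert (B2 : c * s <= 3 * Cmod (w + 1) ^ 2).
  { assert (H1 := H M (n + 1)). replace (M * z + (n + 1)%R)%C with (w + 1)%C in H1 by (unfold w, nC, M; rewrite RtoC_plus; ring).
    apply Rle_trans with (3 * (c * (M ^ 2 + (n + 1) ^ 2))); [|lra].
    replace (3 * (c * (M ^ 2 + (n + 1) ^ 2))) with (c * (3 * (M ^ 2 + (n + 1) ^ 2))) by ring.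
    apply Rmult_le_compat_l; [lra|]. unfold s. assert (0 <= (2 * n + 3) ^ 2) by apply pow2_ge_0. nra. }
  assert (N1 := Im_pos_sub_nz w 1 Hw). assert (N2 := Im_pos_add_nz w 1 Hw). assert (N3 := Im_pos_nz w Hw).
  rewrite Cmod_inv by (apply Cmult_neq_0; [apply Cmult_neq_0; apply Cpow_nz; auto using c2pi_nz | now apply Cmult_neq_0]).
  rewrite !Cmod_mult, !Cmod_pow, Cmod_c2pi.
  set (a := Cmod w) in *. set (b := Cmod (w - 1)) in *. set (d := Cmod (w + 1)) in *.
  assert (Ha : 0 <= a) by apply Cmod_ge_0. assert (Hb : 0 <= b) by apply Cmod_ge_0. assert (Hd : 0 <= d) by apply Cmod_ge_0.
  assert (Hcs : 0 < c * s) by nra.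
  assert (Hbd : c * s <= 3 * (b * d)).
  { apply Rnot_lt_le. intros Hl. assert ((3 * (b * d)) ^ 2 < (c * s) ^ 2).
    { assert (0 <= 3 * (b * d)) by (apply Rmult_le_pos; [lra|now apply Rmult_le_pos]). set (e := 3 * (b * d)) in *. nra. }
    assert ((c * s) * (c * s) <= (3 * b ^ 2) * (3 * d ^ 2)) by (apply Rmult_le_compat; lra). nra. }
  assert (Hpi : 1 <= (2 * PI) ^ 2) by (assert (Hpi := PI2_3_2); nra).
  assert (Hall : c ^ 2 / 3 * ((1 + INR m ^ 2) * (1 + n ^ 2)) <= (2 * PI) ^ 2 * a ^ 2 * (b * d)).
  { apply Rle_trans with (c ^ 2 / 3 * (s * s)).
    - apply Rmult_le_compat_l. apply Rdiv_le_0_compat; [apply pow2_ge_0|lra].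
      assert (1 + INR m ^ 2 <= s). { unfold s, M. rewrite S_INR. assert (H0 := pos_INR m). assert (H1 := pow2_ge_0 n). nra. }
      assert (0 <= INR m ^ 2) by apply pow2_ge_0. assert (0 <= n ^ 2) by apply pow2_ge_0.
      apply Rmult_le_compat; lra.
    - replace (c ^ 2 / 3 * (s * s)) with (1 * (c * s) * ((c * s) / 3)) by field.
      apply Rmult_le_compat; [nra|lra| |lra]. apply Rmult_le_compat; lra. }
  assert (P : 0 < (1 + INR m ^ 2) * (1 + n ^ 2)).
  { assert (0 <= INR m ^ 2) by apply pow2_ge_0. assert (0 <= n ^ 2) by apply pow2_ge_0. apply Rmult_lt_0_compat; lra. }
  replace (3 / c ^ 2 * / (1 + INR m ^ 2) * / (1 + n ^ 2)) with (/ (c ^ 2 / 3 * ((1 + INR m ^ 2) * (1 + n ^ 2)))).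
  2:{ field. assert (0 <= INR m ^ 2) by apply pow2_ge_0. assert (0 <= n ^ 2) by apply pow2_ge_0. repeat split; nra. }
  apply Rinv_le_contravar; auto. apply Rmult_lt_0_compat; auto. apply Rdiv_lt_0_compat; [nra|lra].
Qed.

Lemma row_term_bound z : 0 < Im z -> exists K, 0 <= K /\ forall m n,
  Cmod (row_term z m n) <= K * / (1 + INR m ^ 2) * / (1 + INR n ^ 2).
Proof.
  intros Hz. destruct (dif2_bound z Hz) as [K [HK H]]. exists (2 * K). split. lra.
  intros m n.
  assert (P : forall x : R, 0 < / (1 + x ^ 2)).
  { intros x. apply Rinv_0_lt_compat. assert (0 <= x ^ 2) by apply pow2_ge_0. lra. }
  assert (Q : 0 <= K * / (1 + INR m ^ 2) * / (1 + INR n ^ 2)).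
  { apply Rmult_le_pos; [apply Rmult_le_pos; auto|]; left; apply P. }
  destruct n; simpl row_term.
  - specialize (H m 0). replace (nC (S m) * z + 0)%C with (nC (S m) * z)%C in H by ring. simpl INR in *. lra.
  - eapply Rle_trans; [apply Cmod_triangle|].
    assert (H1 := H m (INR (S n))). assert (H2 := H m (- INR (S n))).
    replace (nC (S m) * z + (- INR (S n))%R)%C with (nC (S m) * z - nC (S n))%C in H2 by (unfold nC; rewrite RtoC_opp; ring).
    fold (nC (S n)) in H1. replace ((- INR (S n)) ^ 2) with (INR (S n) ^ 2) in H2 by ring. lra.
Qed.

Lemma summ_row_term_col z n : 0 < Im z -> summ (fun m => row_term z m n).
Proof.
  intros Hz. destruct (row_term_bound z Hz) as [K [HK H]].
  apply summ_le with (2 := ex_series_scal_inv_sq (K * / (1 + INR n ^ 2))).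
  intros m. specialize (H m n). lra.
Qed.

Lemma row_term_fubini z : 0 < Im z ->
  Csum (fun n => Csum (fun m => row_term z m n)) = Csum (fun m => Csum (fun n => row_term z m n)) /\
  summ (fun n => Csum (fun m => row_term z m n)) /\ summ (fun m => Csum (fun n => row_term z m n)).
Proof.
  intros Hz. destruct (row_term_bound z Hz) as [K [HK H]].
  apply fubini with (fun m n => K * / (1 + INR m ^ 2) * / (1 + INR n ^ 2)); auto.
  - intros m. apply ex_series_scal_inv_sq.
  - apply ex_series_ext with (fun m => (K * Series (fun n => / (1 + INR n ^ 2))) * / (1 + INR m ^ 2)).
    intros m. rewrite Series_scal_l. match goal with |- ?a = ?b => change (@eq R a b) end. ring.
    apply ex_series_scal_inv_sq.
Qed.

Definition gap (J : nat) (w : C) : C := (/ (w - nC J) - / (w + nC J))%C.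
(** What is left of the telescoping terms [tele (w + n)] summed over n from -J to J. *)
Definition tele_sum (J : nat) (w : C) : C := (/ (2 * c2pi ^ 2) * (gap (S J) w + gap J w))%C.

Lemma csum_row_term z m J : 0 < Im z ->
  csum (row_term z m) (S J) = (pole2 (nC (S m) * z) + csum (fun j => pole2 (nC (S m) * z + nC (S j)) + pole2 (nC (S m) * z - nC (S j))) J
     - tele_sum J (nC (S m) * z))%C.
Proof.
  intros Hz. assert (Hw := Im_nCz m z Hz). set (w := (nC (S m) * z)%C) in *.
  induction J.
  - simpl csum. fold w. unfold dif2, tele_sum, tele, gap.
    replace (nC 1) with (RtoC 1) by (unfold nC; simpl; reflexivity). replace (nC 0) with (RtoC 0) by reflexivity.
    replace (w - 0)%C with w by ring. replace (w + 0)%C with w by ring.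
    ring.
  - change (csum (row_term z m) (S (S J))) with (csum (row_term z m) (S J) + row_term z m (S J))%C.
    rewrite IHJ. simpl row_term. fold w. cbn [csum]. unfold dif2, tele_sum, tele, gap.
    replace (w + nC (S J) - 1)%C with (w + nC J)%C by (rewrite nC_S; ring).
    replace (w - nC (S J) + 1)%C with (w - nC J)%C by (rewrite nC_S; ring).
    replace (w + nC (S J) + 1)%C with (w + nC (S (S J)))%C by (rewrite !nC_S; ring).
    replace (w - nC (S J) - 1)%C with (w - nC (S (S J)))%C by (rewrite !nC_S; ring).
    ring.
Qed.

(** Along a row the boundary terms of the telescope tend to 0, so the subtraction of [tele] does not
    change the row sum, which [lipschitz2] evaluates. *)
Lemma row_term_row_sum z m : 0 < Im z -> Csum (row_term z m) = cosec2 (nC (S m) * z).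
Proof.
  intros Hz. assert (Hw := Im_nCz m z Hz). set (w := (nC (S m) * z)%C) in *.
  destruct (away_H w Hw) as [c Hc]. assert (Hl := lipschitz2 c w Hc (cE_neq_1 w Hw)).
  destruct (Clim_inv_away c w Hc) as [L1 L2]. destruct (summ_pole2_sym c w Hc) as [S1 [S2 _]].
  apply Csum_unique. apply Clim_shift_inv.
  apply Clim_ext with (fun J => pole2 w + csum (fun j => pole2 (w + nC (S j)) + pole2 (w - nC (S j))) J - tele_sum J w)%C.
  { intros J. rewrite csum_row_term by auto. reflexivity. }
  replace (cosec2 w) with (pole2 w + (cosec2 w - pole2 w) - / (2 * c2pi ^ 2) * ((0 - 0) + (0 - 0)))%C by ring.
  apply Clim_minus. apply Clim_plus. apply Clim_const. rewrite <- Hl. apply Clim_Csum. now apply summ_plus.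
  apply Clim_scal. apply Clim_plus; apply Clim_minus; auto.
  apply (Clim_shift (fun J => / (w - nC J))%C _ L2). apply (Clim_shift (fun J => / (w + nC J))%C _ L1).
Qed.

Lemma csum_Csum_exch (D : nat -> nat -> C) N : (forall n, summ (fun m => D m n)) ->
  csum (fun n => Csum (fun m => D m n)) N = Csum (fun m => csum (D m) N) /\ summ (fun m => csum (D m) N).
Proof.
  intros H. induction N.
  - simpl. split. symmetry. apply (Csum_finite _ 0). auto.
    apply (ex_series_ext (fun n => 0 * / (1 + INR n ^ 2))).
    intros n. match goal with |- ?a = ?b => change (@eq R a b) end. rewrite Cmod_0. ring. apply ex_series_scal_inv_sq.
  - destruct IHN as [E S]. cbn [csum]. split. rewrite E, <- Csum_plus; auto. now apply summ_plus.
Qed.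

Lemma cosec2_norm w : 0 < Im w -> Cmod (cosec2 w) <= Cmod (cE w) / (1 - Cmod (cE w)) ^ 2.
Proof.
  intros H. unfold cosec2. assert (H1 := Cmod_cE_lt1 w H). assert (Hn := one_minus_nz _ (cE_neq_1 w H)).
  rewrite Cmod_div by (now apply Cpow_nz). rewrite Cmod_pow.
  apply Rmult_le_compat_l. apply Cmod_ge_0. apply Rinv_le_contravar. apply pow_lt. lra.
  apply pow_incr. split. lra. assert (H2 := Cmod_triangle_inv 1 (cE w)). rewrite Cmod_1 in H2. lra.
Qed.

Lemma Cmod_cE_nC n w : Cmod (cE (nC n * w)) = Cmod (cE w) ^ n.
Proof. unfold nC. rewrite cE_pow, Cmod_pow. reflexivity. Qed.

Lemma pow_S_le x n : 0 <= x <= 1 -> x ^ S n <= x.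
Proof. intros H. simpl. assert (0 <= x ^ n <= 1). split. apply pow_le; lra. rewrite <- (pow1 n). apply pow_incr; lra. nra. Qed.

Lemma summ_cosec2 w : 0 < Im w -> summ (fun n => cosec2 (nC (S n) * w)).
Proof.
  intros H. set (r := Cmod (cE w)). assert (Hr : 0 <= r < 1) by (split; [apply Cmod_ge_0|now apply Cmod_cE_lt1]).
  apply summ_le with (fun n => / (1 - r) ^ 2 * r ^ n).
  - intros n. eapply Rle_trans; [apply cosec2_norm; now apply Im_nCz|]. rewrite Cmod_cE_nC. fold r.
    assert (H1 := pow_S_le r n ltac:(lra)).
    rewrite Rmult_comm. apply Rmult_le_compat. apply pow_le; lra.
    left. apply Rinv_0_lt_compat, pow_lt. lra.
    simpl. assert (0 <= r ^ n) by (apply pow_le; lra). nra.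
    apply Rinv_le_contravar. apply pow_lt; lra. apply pow_incr; lra.
  - apply (ex_series_scal (V := R_NormedModule)). apply ex_series_geom. rewrite Rabs_pos_eq; lra.
Qed.

Lemma Im_neg_inv z : 0 < Im z -> 0 < Im (- / z)%C.
Proof.
  intros H. assert (Hn := Im_pos_nz z H). simpl. unfold Im, Re in *. destruct z as [x y]; simpl in *.
  assert (0 < x * (x * 1) + y * (y * 1)) by nra. unfold Rdiv.
  replace (- (- y * / (x * (x * 1) + y * (y * 1)))) with (y * / (x * (x * 1) + y * (y * 1))) by ring.
  apply Rmult_lt_0_compat; auto. now apply Rinv_0_lt_compat.
Qed.

(** Taking out the factor z turns the sum over multiples of z into the partial fractions of [cotan]
    at - (J + 1) / z. *)
Lemma gap_col z J : 0 < Im z ->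
  Csum (fun m => gap (S J) (nC (S m) * z)) = (- (c2pi / (2 * z)) * (cotan (nC (S J) * (- / z)) - pole1 (nC (S J) * (- / z))))%C
  /\ summ (fun m => gap (S J) (nC (S m) * z)).
Proof.
  intros Hz. assert (Hz' := Im_neg_inv z Hz). assert (Hw := Im_nCz J _ Hz'). assert (Hn := Im_pos_nz z Hz).
  set (w := (nC (S J) * (- / z))%C) in *.
  destruct (away_H w Hw) as [c Hc]. assert (L := lipschitz1 c w Hc (cE_neq_1 w Hw)). assert (Sm := summ_pole1_sym c w Hc).
  assert (E : forall m, gap (S J) (nC (S m) * z) = (/ z * (/ (w + nC (S m)) + / (w - nC (S m))))%C).
  { intros m. unfold gap. destruct (sym_nz c w m Hc) as [N1 N2].
    assert (E1 : (nC (S m) * z - nC (S J) <> 0)%C) by (unfold nC at 2; apply Im_pos_sub_nz; now apply Im_nCz).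
    assert (E2 : (nC (S m) * z + nC (S J) <> 0)%C) by (unfold nC at 2; apply Im_pos_add_nz; now apply Im_nCz).
    replace (nC (S m) * z - nC (S J))%C with (z * (w + nC (S m)))%C by (unfold w; field; auto).
    replace (nC (S m) * z + nC (S J))%C with (- z * (w - nC (S m)))%C by (unfold w; field; auto).
    field. repeat split; auto. }
  split.
  - rewrite (Csum_ext _ _ E), Csum_scal, L by auto. rewrite pole1_inv by (now apply Im_pos_nz). field.
    repeat split; auto using c2pi_nz, Im_pos_nz.
  - apply summ_ext with (2 := summ_scal (/ z)%C _ Sm). intros; now rewrite E.
Qed.

Lemma Clim_cE_mult w : 0 < Im w -> Clim (fun n => cE (nC n * w)) 0.
Proof.
  intros H. apply Clim_0_le with (fun n => Cmod (cE w) ^ n). intros; rewrite Cmod_cE_nC; lra.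
  apply is_lim_seq_geom. rewrite Rabs_pos_eq by apply Cmod_ge_0. now apply Cmod_cE_lt1.
Qed.

(** As -1/z lies in the upper half-plane, [cotan] of its large multiples tends to 1 and not to 0.
    This nonzero limit is the source of the quasi-modular term. *)
Lemma Clim_gap_col z : 0 < Im z ->
  Clim (fun J => Csum (fun m => gap (S J) (nC (S m) * z))) (- (c2pi / (2 * z)))%C.
Proof.
  intros Hz. assert (Hz' := Im_neg_inv z Hz). assert (Hn := Im_pos_nz z Hz).
  apply Clim_ext with (fun J => - (c2pi / (2 * z)) * (cotan (nC (S J) * (- / z)) - pole1 (nC (S J) * (- / z))))%C.
  intros; symmetry; now apply gap_col.
  apply Clim_eq with (- (c2pi / (2 * z)) * ((1 + 0) * / (1 - 0) - (2 * z / c2pi) * 0))%C; [|field; auto using c2pi_nz].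
  apply Clim_scal. apply Clim_minus.
  - assert (L := Clim_shift _ _ (Clim_cE_mult _ Hz')). cbv beta in L.
    apply Clim_mult. apply Clim_plus; auto using Clim_const. apply Clim_inv.
    replace (1 - 0)%C with (RtoC 1) by ring. apply C1_nz. apply Clim_minus; auto using Clim_const.
  - apply Clim_ext with (fun J => (2 * z / c2pi) * RtoC (/ (INR J + 1)))%C.
    + intros J. rewrite pole1_inv by (apply Im_pos_nz; now apply Im_nCz).
      rewrite RtoC_inv by (assert (H := pos_INR J); lra). rewrite <- S_INR. fold (nC (S J)).
      field. repeat split; auto using c2pi_nz, nC_nz.
    + apply Clim_scal. apply Clim_0_le with (2 := is_lim_seq_inv_S). intros J. rewrite Cmod_R, Rabs_pos_eq. lra.
      left. apply Rinv_0_lt_compat. assert (H := pos_INR J); lra.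
Qed.

Lemma pole2_col z n : 0 < Im z ->
  Csum (fun m => pole2 (nC (S m) * z + nC (S n)) + pole2 (nC (S m) * z - nC (S n)))%C =
    (/ z ^ 2 * cosec2 (nC (S n) * (- / z)) - pole2 (nC (S n)))%C
  /\ summ (fun m => pole2 (nC (S m) * z + nC (S n)) + pole2 (nC (S m) * z - nC (S n)))%C.
Proof.
  intros Hz. assert (Hz' := Im_neg_inv z Hz). assert (Hw := Im_nCz n _ Hz'). assert (Hn := Im_pos_nz z Hz).
  set (w := (nC (S n) * (- / z))%C) in *. assert (Hwn := Im_pos_nz w Hw).
  destruct (away_H w Hw) as [c Hc]. assert (L := lipschitz2 c w Hc (cE_neq_1 w Hw)).
  destruct (summ_pole2_sym c w Hc) as [S1 [S2 _]].
  assert (E : forall m, (pole2 (nC (S m) * z + nC (S n)) + pole2 (nC (S m) * z - nC (S n)))%C = (/ z ^ 2 * (pole2 (w + nC (S m)) + pole2 (w - nC (S m))))%C).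
  { intros m. destruct (sym_nz c w m Hc) as [N1 N2].
    replace (nC (S m) * z - nC (S n))%C with (z * (w + nC (S m)))%C by (unfold w; field; auto).
    replace (nC (S m) * z + nC (S n))%C with (- z * (w - nC (S m)))%C by (unfold w; field; auto).
    assert (Hmz : (- z <> 0)%C). { intros E. apply Hn. replace z with (- - z)%C by ring. rewrite E. ring. }
    rewrite !pole2_scale by auto. replace ((- z) ^ 2)%C with (z ^ 2)%C by ring. ring. }
  split.
  - rewrite (Csum_ext _ _ E), Csum_scal, L by (now apply summ_plus).
    replace (pole2 (nC (S n))) with (pole2 ((- z) * w)).
    2:{ f_equal. unfold w. field. auto. }
    assert (Hmz : (- z <> 0)%C). { intros E'. apply Hn. replace z with (- - z)%C by ring. rewrite E'. ring. }
    rewrite pole2_scale by auto. replace ((- z) ^ 2)%C with (z ^ 2)%C by ring. ring.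
  - apply summ_ext with (2 := summ_scal (/ z ^ 2)%C _ (summ_plus _ _ S1 S2)). intros; now rewrite E.
Qed.

Definition sum_cosec2 (z : C) : C := Csum (fun m => cosec2 (nC (S m) * z)).

(** Summing [row_term] by rows gives the left side, summing by columns the sum at -1/z. Both [gap]
    sums tend to - c2pi / (2 z), which leaves 1 / (2 c2pi z); the [zeta2] terms come from column 0
    and from the points on the real axis, absent from the lattice sum. *)
Lemma sum_cosec2_inversion z : 0 < Im z ->
  sum_cosec2 z = (/ z ^ 2 * sum_cosec2 (- / z) + zeta2 * (/ z ^ 2 - 1) + / (2 * c2pi * z))%C.
Proof.
  intros Hz. assert (Hz' := Im_neg_inv z Hz). assert (Hn := Im_pos_nz z Hz).
  destruct (row_term_fubini z Hz) as [F [F1 F2]].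
  assert (E1 : sum_cosec2 z = Csum (fun n => Csum (fun m => row_term z m n))).
  { rewrite F. apply Csum_ext. intros m. symmetry. now apply row_term_row_sum. }
  rewrite E1. apply (Clim_unique (fun J => csum (fun n => Csum (fun m => row_term z m n)) (S (S J)))).
  { apply (Clim_shift (fun J => csum (fun n => Csum (fun m => row_term z m n)) (S J))). apply Clim_shift. now apply Clim_Csum. }
  assert (S0 : summ (fun m => pole2 (nC (S m) * z))).
  { apply summ_ext with (fun m => / z ^ 2 * pole2 (nC (S m)))%C; [|apply summ_scal, summ_pole2_nat].
    intros m. rewrite Cmult_comm with (x := nC (S m)). rewrite pole2_scale; auto using nC_nz. }
  assert (EJ : forall J, csum (fun n => Csum (fun m => row_term z m n)) (S (S J)) =
    (/ z ^ 2 * zeta2 + csum (fun n => / z ^ 2 * cosec2 (nC (S n) * (- / z)) - pole2 (nC (S n))) (S J)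
     - / (2 * c2pi ^ 2) * (Csum (fun m => gap (S (S J)) (nC (S m) * z)) + Csum (fun m => gap (S J) (nC (S m) * z))))%C).
  { intros J. destruct (csum_Csum_exch (row_term z) (S (S J)) (fun n => summ_row_term_col z n Hz)) as [X _]. rewrite X.
    rewrite (Csum_ext _ _ (fun m => csum_row_term z m (S J) Hz)).
    destruct (csum_Csum_exch (fun m j => pole2 (nC (S m) * z + nC (S j)) + pole2 (nC (S m) * z - nC (S j)))%C (S J) (fun n => proj2 (pole2_col z n Hz))) as [Y1 Y2].
    destruct (gap_col z J Hz) as [_ G1]. destruct (gap_col z (S J) Hz) as [_ G2].
    assert (GB : summ (fun m => tele_sum (S J) (nC (S m) * z))) by (apply summ_scal; now apply summ_plus).
    rewrite Csum_minus; auto; [|now apply summ_plus].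
    rewrite Csum_plus; auto. rewrite <- Y1. f_equal; [f_equal|].
    - unfold zeta2. rewrite <- Csum_scal by apply summ_pole2_nat. apply Csum_ext. intros m.
      rewrite Cmult_comm with (x := nC (S m)). rewrite pole2_scale; auto using nC_nz.
    - apply csum_ext. intros n _. apply pole2_col; auto.
    - f_equal. unfold tele_sum. rewrite Csum_scal by (now apply summ_plus). f_equal. now apply Csum_plus. }
  apply Clim_ext with (1 := fun J => eq_sym (EJ J)).
  replace (/ z ^ 2 * sum_cosec2 (- / z) + zeta2 * (/ z ^ 2 - 1) + / (2 * c2pi * z))%C with
    (/ z ^ 2 * zeta2 + (/ z ^ 2 * sum_cosec2 (- / z) - zeta2) - / (2 * c2pi ^ 2) * (- (c2pi / (2 * z)) + - (c2pi / (2 * z))))%C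
    by (field; auto using c2pi_nz).
  assert (G := Clim_gap_col z Hz).
  apply Clim_minus; [apply Clim_plus; [apply Clim_const|]|apply Clim_scal, Clim_plus; auto].
  2:{ apply (Clim_shift _ _ G). }
  apply (Clim_shift (csum (fun n => / z ^ 2 * cosec2 (nC (S n) * (- / z)) - pole2 (nC (S n)))%C)).
  unfold sum_cosec2, zeta2. rewrite <- Csum_scal, <- Csum_minus by (auto using summ_cosec2, summ_scal, summ_pole2_nat).
  apply Clim_Csum. apply summ_minus; auto using summ_cosec2, summ_scal, summ_pole2_nat.
Qed.

(** * Power series in the nome and their values on the upper half-plane *)

Definition pconv (a : nat -> C) : Prop :=
  forall r, 0 <= r < 1 -> ex_series (fun n => Cmod (a n) * r ^ n).
Definition Ev (a : nat -> C) (z : C) : C := Csum (fun n => a n * cE (nC n * z))%C.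

Definition cadd (a b : nat -> C) : nat -> C := fun n => (a n + b n)%C.
Definition cscal (c : C) (a : nat -> C) : nat -> C := fun n => (c * a n)%C.
Definition cmul (a b : nat -> C) : nat -> C := fun n => csum (fun k => a k * b (n - k)%nat)%C (S n).
Definition ctheta (a : nat -> C) : nat -> C := fun n => (nC n * a n)%C.
Definition cinfl (m : nat) (a : nat -> C) : nat -> C :=
  fun n => if (n mod m =? 0)%nat then a (n / m)%nat else RtoC 0.
Definition cone : nat -> C := fun n => if (n =? 0)%nat then RtoC 1 else RtoC 0.

Lemma pconv_le (a b : nat -> C) : (forall n, Cmod (a n) <= Cmod (b n)) -> pconv b -> pconv a.
Proof.
  intros H Hb r Hr. apply ex_series_le_nn with (2 := Hb r Hr). intros n.
  assert (0 <= r ^ n) by (apply pow_le; lra). split. apply Rmult_le_pos; auto using Cmod_ge_0.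
  apply Rmult_le_compat_r; auto.
Qed.

Lemma pconv_ext a b : (forall n, a n = b n) -> pconv a -> pconv b.
Proof. intros H. apply pconv_le. intros. rewrite H. lra. Qed.

Lemma pconv_add a b : pconv a -> pconv b -> pconv (cadd a b).
Proof.
  intros Ha Hb r Hr. apply ex_series_le_nn with (fun n => Cmod (a n) * r ^ n + Cmod (b n) * r ^ n).
  - intros n. assert (0 <= r ^ n) by (apply pow_le; lra). split. apply Rmult_le_pos; auto using Cmod_ge_0.
    assert (H1 := Cmod_triangle (a n) (b n)). unfold cadd. nra.
  - apply (ex_series_plus (V := R_NormedModule)); auto.
Qed.

Lemma pconv_scal c a : pconv a -> pconv (cscal c a).
Proof.
  intros Ha r Hr. apply ex_series_ext with (fun n => Cmod c * (Cmod (a n) * r ^ n)).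
  intros. unfold cscal. rewrite Cmod_mult. match goal with |- ?a = ?b => change (@eq R a b) end. ring.
  apply (ex_series_scal (V := R_NormedModule)); auto.
Qed.

Lemma n_pow_bounded x : 0 <= x < 1 -> exists K, 0 <= K /\ forall n, INR n * x ^ n <= K.
Proof.
  intros Hx. destruct (Req_dec x 0) as [->|Hn].
  - exists 0. split. lra. intros [|n]; simpl. lra. rewrite Rmult_0_l. lra.
  - set (d := / x - 1). assert (H1 : 1 < / x) by (rewrite <- Rinv_1; apply Rinv_lt_contravar; lra).
    assert (Hd : 0 < d) by (unfold d; lra). exists (/ d). split. left; now apply Rinv_0_lt_compat.
    intros n. assert (P := poly n d Hd). replace (1 + d) with (/ x) in P by (unfold d; ring).
    assert (Hp : 0 < x ^ n) by (apply pow_lt; lra). rewrite pow_inv in P.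
    assert ((1 + INR n * d) * x ^ n <= 1).
    { apply Rle_trans with (/ x ^ n * x ^ n). apply Rmult_le_compat_r; lra. rewrite Rinv_l; lra. }
    apply Rmult_le_reg_l with d; auto. rewrite Rinv_r by lra. lra.
Qed.

Lemma pconv_theta a : pconv a -> pconv (ctheta a).
Proof.
  intros Ha r Hr. set (rho := (1 + r) / 2). assert (Hrho : 0 < rho < 1) by (unfold rho; lra).
  assert (Hx : 0 <= r / rho < 1). { split. apply Rdiv_le_0_compat; lra. apply Rlt_div_l; unfold rho in *; lra. }
  destruct (n_pow_bounded _ Hx) as [K [HK H]].
  apply ex_series_le_nn with (fun n => K * (Cmod (a n) * rho ^ n)).
  - intros n. assert (0 <= r ^ n) by (apply pow_le; lra). split. apply Rmult_le_pos; auto using Cmod_ge_0.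
    unfold ctheta. rewrite Cmod_mult. unfold nC. rewrite Cmod_R, Rabs_pos_eq by apply pos_INR.
    specialize (H n). replace (r ^ n) with ((r / rho) ^ n * rho ^ n).
    2:{ rewrite <- Rpow_mult_distr. f_equal. field. lra. }
    assert (0 <= Cmod (a n) * rho ^ n). { apply Rmult_le_pos. apply Cmod_ge_0. apply pow_le; lra. }
    replace (INR n * Cmod (a n) * ((r / rho) ^ n * rho ^ n)) with (INR n * (r / rho) ^ n * (Cmod (a n) * rho ^ n)) by ring.
    now apply Rmult_le_compat_r.
  - apply (ex_series_scal (V := R_NormedModule)). apply Ha. lra.
Qed.

Lemma pconv_cst c : pconv (fun _ => c).
Proof.
  intros r Hr. apply (ex_series_scal (V := R_NormedModule)). apply ex_series_geom. rewrite Rabs_pos_eq; lra.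
Qed.
Lemma pconv_one : pconv cone.
Proof.
  apply pconv_le with (2 := pconv_cst 1). intros n. unfold cone. destruct (n =? 0)%nat; rewrite ?Cmod_0, Cmod_1; lra.
Qed.

Lemma Cmod_qn n z : Cmod (cE (nC n * z)) = Cmod (cE z) ^ n.
Proof. apply Cmod_cE_nC. Qed.
Lemma cE_nC n z : cE (nC n * z) = (cE z ^ n)%C.
Proof. apply cE_pow. Qed.
Lemma cE_lt1 z : 0 < Im z -> 0 <= Cmod (cE z) < 1.
Proof. intros. split. apply Cmod_ge_0. now apply Cmod_cE_lt1. Qed.

Lemma summ_Ev a z : pconv a -> 0 < Im z -> summ (fun n => a n * cE (nC n * z))%C.
Proof.
  intros Ha Hz. apply ex_series_ext with (2 := Ha _ (cE_lt1 z Hz)).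
  intros n. rewrite Cmod_mult, Cmod_qn. reflexivity.
Qed.

Lemma Ev_ext a b z : (forall n, a n = b n) -> Ev a z = Ev b z.
Proof. intros H. apply Csum_ext. intros; now rewrite H. Qed.

Lemma Ev_add a b z : pconv a -> pconv b -> 0 < Im z -> Ev (cadd a b) z = (Ev a z + Ev b z)%C.
Proof.
  intros Ha Hb Hz. unfold Ev. rewrite <- Csum_plus by (now apply summ_Ev). apply Csum_ext. intros. unfold cadd. ring.
Qed.
Lemma Ev_scal c a z : pconv a -> 0 < Im z -> Ev (cscal c a) z = (c * Ev a z)%C.
Proof.
  intros Ha Hz. unfold Ev. rewrite <- Csum_scal by (now apply summ_Ev). apply Csum_ext. intros. unfold cscal. ring.
Qed.
Lemma Ev_one z : Ev cone z = 1.
Proof.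
  unfold Ev. rewrite (Csum_finite _ 1).
  - simpl. unfold cone. simpl. replace (nC 0 * z)%C with (RtoC 0) by (unfold nC; simpl; ring). rewrite cE_0. ring.
  - intros [|k] Hk. lia. unfold cone. simpl. ring.
Qed.

Lemma Ev_per a z : Ev a (z + 1) = Ev a z.
Proof.
  unfold Ev. apply Csum_ext. intros n. f_equal. rewrite Cmult_plus_distr_l, Cmult_1_r, cE_plus.
  assert (E : cE (nC n) = 1). { replace (nC n) with (nC n * 1)%C by ring. rewrite cE_nC, cE_1, Cpow_1_l. reflexivity. }
  rewrite E. ring.
Qed.

(** * Products *)

Lemma Csum_shifted (a : nat -> C) i : (forall n, (n < i)%nat -> a n = RtoC 0) -> Csum a = Csum (fun k => a (i + k)%nat).
Proof.
  intros H. unfold Csum. f_equal.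
  - apply (Series_incr_n_aux (fun n => Re (a n)) i). intros k Hk; now rewrite H.
  - apply (Series_incr_n_aux (fun n => Im (a n)) i). intros k Hk; now rewrite H.
Qed.

(** The majorant of a Cauchy product, indexed by the degree of the first factor and the total degree
    and extended by 0 outside the triangle. It feeds the Fubini lemmas both for convergence and for
    the value of the product. *)
Lemma cauchy_dom (a b : nat -> R) r : (forall n, 0 <= a n) -> (forall n, 0 <= b n) -> 0 <= r ->
  ex_series (fun n => a n * r ^ n) -> ex_series (fun n => b n * r ^ n) ->
  let u := fun i n => if (i <=? n)%nat then a i * b (n - i)%nat * r ^ n else 0 in
  (forall i n, 0 <= u i n) /\ (forall i, ex_series (u i)) /\ ex_series (fun i => Series (u i)).
Proof.
  intros Ha Hb Hr Sa Sb u.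
  assert (Hu : forall i k, u i (i + k)%nat = (a i * r ^ i) * (b k * r ^ k)).
  { intros i k. unfold u. destruct (Nat.leb_spec i (i + k)); [|lia]. replace (i + k - i)%nat with k by lia.
    rewrite pow_add. ring. }
  assert (Hr2 : forall i, ex_series (u i)).
  { intros i. apply ex_series_incr_n with i. apply ex_series_ext with (fun k => (a i * r ^ i) * (b k * r ^ k)).
    intros k. now rewrite Hu. now apply (ex_series_scal (V := R_NormedModule)). }
  split; [|split]; auto.
  - intros i n. unfold u. destruct (i <=? n)%nat; [|lra]. repeat apply Rmult_le_pos; auto. now apply pow_le.
  - apply ex_series_ext with (fun i => (a i * r ^ i) * Series (fun k => b k * r ^ k)).
    + intros i. rewrite (Series_incr_n_aux (u i) i).
      2:{ intros k Hk. unfold u. destruct (Nat.leb_spec i k); auto. lia. }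
      rewrite (Series_ext (fun k => u i (i + k)%nat) (fun k => a i * r ^ i * (b k * r ^ k))) by apply Hu. rewrite Series_scal_l. reflexivity.
    + apply (ex_series_scal_r (Series (fun k => b k * r ^ k)) (fun i => a i * r ^ i)). auto.
Qed.

Lemma rsum_le_csum a n : Cmod (csum a n) <= rsum (fun k => Cmod (a k)) n.
Proof. induction n; simpl. rewrite Cmod_0; lra. eapply Rle_trans; [apply Cmod_triangle|]. lra. Qed.

Lemma rsum_indicator (f : nat -> R) n : rsum (fun i => if (i <=? n)%nat then f i else 0) (S n) = rsum f (S n).
Proof. apply rsum_ext. intros k Hk. destruct (Nat.leb_spec k n); auto. lia. Qed.

Lemma pconv_mul a b : pconv a -> pconv b -> pconv (cmul a b).
Proof.
  intros Ha Hb r Hr.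
  destruct (cauchy_dom (fun n => Cmod (a n)) (fun n => Cmod (b n)) r) as [H1 [H2 H3]]; auto using Cmod_ge_0; try lra.
  destruct (fubini_nn _ H1 H2 H3) as [H4 [H5 _]].
  apply ex_series_le_nn with (2 := H5). intros n.
  assert (Hp : 0 <= r ^ n) by (apply pow_le; lra).
  split. apply Rmult_le_pos; auto using Cmod_ge_0.
  eapply Rle_trans. apply Rmult_le_compat_r; auto. apply rsum_le_csum.
  eapply Rle_trans; [|apply (rsum_le_Series _ (S n)); auto].
  rewrite (rsum_indicator (fun i => Cmod (a i) * Cmod (b (n - i)%nat) * r ^ n)). right.
  generalize (S n). intros m. induction m; cbn [rsum]. ring. rewrite Rmult_plus_distr_r, IHm, Cmod_mult. ring.
Qed.

Lemma Ev_mul a b z : pconv a -> pconv b -> 0 < Im z -> Ev (cmul a b) z = (Ev a z * Ev b z)%C.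
Proof.
  intros Ha Hb Hz. set (r := Cmod (cE z)). assert (Hr := cE_lt1 z Hz). fold r in Hr.
  destruct (cauchy_dom (fun n => Cmod (a n)) (fun n => Cmod (b n)) r) as [H1 [H2 H3]]; auto using Cmod_ge_0; try lra.
  set (D := fun i n => if (i <=? n)%nat then (a i * b (n - i)%nat * cE (nC n * z))%C else RtoC 0).
  assert (HD : forall m n, Cmod (D m n) <= if (m <=? n)%nat then Cmod (a m) * Cmod (b (n - m)%nat) * r ^ n else 0).
  { intros m n. unfold D. destruct (m <=? n)%nat. rewrite !Cmod_mult, Cmod_qn. fold r. lra. rewrite Cmod_0. lra. }
  destruct (fubini D _ HD H2 H3) as [F _].
  transitivity (Csum (fun n => Csum (fun m => D m n))).
  - apply Csum_ext. intros n. rewrite (Csum_finite _ (S n)).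
    + unfold cmul. rewrite Cmult_comm, <- csum_scal. apply csum_ext. intros k Hk. unfold D. destruct (Nat.leb_spec k n); [ring|lia].
    + intros k Hk. unfold D. destruct (Nat.leb_spec k n); [lia|auto].
  - rewrite F. unfold Ev at 1.
    transitivity (Csum (fun m => Ev b z * (a m * cE (nC m * z)))%C).
    + apply Csum_ext. intros m. rewrite (Csum_shifted _ m).
      2:{ intros n Hn. unfold D. destruct (Nat.leb_spec m n); [lia|auto]. }
      unfold Ev. rewrite Cmult_comm, <- Csum_scal by (now apply summ_Ev). apply Csum_ext. intros k. unfold D.
      destruct (Nat.leb_spec m (m + k)); [|lia]. replace (m + k - m)%nat with k by lia.
      rewrite !cE_nC, Cpow_add_r. ring.
    + rewrite Csum_scal by (now apply summ_Ev). fold (Ev a z). ring.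
Qed.

(** * Substitution z -> m z *)

Lemma csum_blocks (c : nat -> C) m N :
  csum c (m * N) = csum (fun k => csum (fun j => c (m * k + j)%nat) m) N.
Proof.
  induction N. rewrite Nat.mul_0_r. reflexivity.
  replace (m * S N)%nat with (m * N + m)%nat by lia. rewrite csum_add, IHN. reflexivity.
Qed.
Lemma rsum_add a n m : rsum a (n + m) = rsum a n + rsum (fun k => a (n + k)%nat) m.
Proof.
  induction m. rewrite Nat.add_0_r. simpl. ring.
  rewrite Nat.add_succ_r. simpl. rewrite IHm. ring.
Qed.
Lemma rsum_blocks (c : nat -> R) m N :
  rsum c (m * N) = rsum (fun k => rsum (fun j => c (m * k + j)%nat) m) N.
Proof.
  induction N. rewrite Nat.mul_0_r. reflexivity.
  replace (m * S N)%nat with (m * N + m)%nat by lia. rewrite rsum_add, IHN. reflexivity.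
Qed.

Lemma sparse_series (c : nat -> C) m : (0 < m)%nat ->
  (forall k j, (0 < j < m)%nat -> c (m * k + j)%nat = RtoC 0) ->
  summ (fun k => c (m * k)%nat) -> summ c /\ Csum c = Csum (fun k => c (m * k)%nat).
Proof.
  intros Hm Hc Hs.
  assert (Hblk : forall k, csum (fun j => c (m * k + j)%nat) m = c (m * k)%nat).
  { intros k. destruct m; [lia|]. rewrite csum_S_l, Nat.add_0_r.
    rewrite (csum_ext _ (fun _ => RtoC 0)) by (intros j Hj; apply Hc; lia).
    assert (E : forall n, csum (fun _ : nat => RtoC 0) n = RtoC 0) by (induction n; simpl; [auto|rewrite IHn; ring]).
    rewrite E. ring. }
  assert (Hblk' : forall k, rsum (fun j => Cmod (c (m * k + j)%nat)) m = Cmod (c (m * k)%nat)).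
  { intros k. destruct m; [lia|]. replace (S m) with (1 + m)%nat by lia. rewrite rsum_add. cbn [rsum]. rewrite Nat.add_0_r.
    rewrite (rsum_ext _ (fun _ => 0)) by (intros j Hj; replace (1 + m)%nat with (S m) by lia; rewrite Hc by lia; apply Cmod_0).
    assert (E : forall n, rsum (fun _ : nat => 0) n = 0) by (induction n; simpl; [auto|rewrite IHn; ring]).
    rewrite E. replace (1 + m)%nat with (S m) by lia. ring. }
  assert (Sc : summ c).
  { apply ex_series_nn_bounded with (Series (fun k => Cmod (c (m * k)%nat))). intros; apply Cmod_ge_0.
    intros n. apply Rle_trans with (rsum (fun k => Cmod (c k)) (m * n)).
    - replace (m * n)%nat with (n + (m * n - n))%nat by nia. rewrite rsum_add.
      assert (forall f N, (forall k, 0 <= f k) -> 0 <= rsum f N). { intros f N Hf. induction N; simpl. lra. specialize (Hf N). lra. }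
      assert (0 <= rsum (fun k => Cmod (c (n + k)%nat)) (m * n - n)) by (apply H; intros; apply Cmod_ge_0). lra.
    - rewrite rsum_blocks. rewrite (rsum_ext _ (fun k => Cmod (c (m * k)%nat))) by (intros; apply Hblk').
      apply rsum_le_Series; auto. intros; apply Cmod_ge_0. }
  split; auto. symmetry. apply Csum_unique. apply Clim_ext with (fun N => csum c (m * N)).
  - intros N. rewrite csum_blocks. apply csum_ext. intros; apply Hblk.
  - apply (Clim_comp (csum c) _ (fun N => (m * N)%nat)). intros n; nia. now apply Clim_Csum.
Qed.

Lemma cinfl_mul m a k : (0 < m)%nat -> cinfl m a (m * k) = a k.
Proof.
  intros H. unfold cinfl. rewrite Nat.mul_comm, Nat.Div0.mod_mul. simpl. rewrite Nat.div_mul by lia. reflexivity.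
Qed.
Lemma cinfl_off m a k j : (0 < j < m)%nat -> cinfl m a (m * k + j) = RtoC 0.
Proof.
  intros H. unfold cinfl. replace (m * k + j)%nat with (j + k * m)%nat by lia. rewrite Nat.Div0.mod_add, Nat.mod_small by lia.
  destruct (Nat.eqb_spec j 0); [lia|auto].
Qed.

Lemma pconv_infl m a : (0 < m)%nat -> pconv a -> pconv (cinfl m a).
Proof.
  intros Hm Ha r Hr.
  destruct (sparse_series (fun n => cinfl m a n * RtoC (r ^ n))%C m Hm) as [H _].
  - intros k j Hj. rewrite cinfl_off by auto. ring.
  - apply ex_series_ext with (fun k => Cmod (a k) * (r ^ m) ^ k).
    + intros k. rewrite cinfl_mul by auto. rewrite Cmod_mult, Cmod_R, Rabs_pos_eq, pow_mult by (apply pow_le; lra). reflexivity.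
    + apply Ha. split. apply pow_le; lra. destruct m; [lia|]. assert (H := pow_S_le r m ltac:(lra)). lra.
  - apply ex_series_ext with (2 := H). intros n. rewrite Cmod_mult, Cmod_R, Rabs_pos_eq by (apply pow_le; lra). reflexivity.
Qed.

Lemma Ev_infl m a z : (0 < m)%nat -> pconv a -> 0 < Im z -> Ev (cinfl m a) z = Ev a (nC m * z).
Proof.
  intros Hm Ha Hz. unfold Ev.
  assert (E : forall k, (cinfl m a (m * k) * cE (nC (m * k) * z))%C = (a k * cE (nC k * (nC m * z)))%C).
  { intros k. rewrite cinfl_mul by auto. do 2 f_equal. unfold nC. rewrite mult_INR, RtoC_mult. ring. }
  destruct (sparse_series (fun n => cinfl m a n * cE (nC n * z))%C m Hm) as [_ H].
  - intros k j Hj. rewrite cinfl_off by auto. ring.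
  - apply summ_ext with (fun k => a k * cE (nC k * (nC m * z)))%C. intros; now rewrite E.
    apply summ_Ev; auto. destruct m; [lia|]. now apply Im_nCz.
  - rewrite H. apply Csum_ext. apply E.
Qed.

(** * Growth and uniqueness *)

Lemma Ev_decay a N y0 : pconv a -> (forall n, (n < N)%nat -> a n = RtoC 0) -> 0 < y0 ->
  exists K, 0 <= K /\ forall z, y0 <= Im z -> Cmod (Ev a z) <= K * Cmod (cE z) ^ N.
Proof.
  intros Ha HN Hy. set (r := exp (- (2 * PI) * y0)). assert (Hpi := PI_RGT_0).
  assert (Hr : 0 < r < 1). { split. apply exp_pos. unfold r. rewrite <- exp_0. apply exp_increasing. nra. }
  assert (Sb : ex_series (fun k => Cmod (a (N + k)%nat) * r ^ k)).
  { apply ex_series_ext with (fun k => / r ^ N * (Cmod (a (N + k)%nat) * r ^ (N + k))).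
    intros k. rewrite pow_add. match goal with |- ?a = ?b => change (@eq R a b) end. field. apply pow_nonzero; lra.
    apply (ex_series_scal (V := R_NormedModule)). apply (ex_series_incr_n (fun n => Cmod (a n) * r ^ n)). apply Ha. lra. }
  exists (Series (fun k => Cmod (a (N + k)%nat) * r ^ k)). split.
  apply Series_nonneg; auto. intros; apply Rmult_le_pos. apply Cmod_ge_0. apply pow_le; lra.
  intros z Hz. assert (Hz0 : 0 < Im z) by lra. set (x := Cmod (cE z)).
  assert (Hx : 0 <= x <= r). { split. apply Cmod_ge_0. unfold x. rewrite Cmod_cE. apply exp_le. nra. }
  unfold Ev. rewrite (Csum_shifted _ N) by (intros n Hn; rewrite HN by auto; ring).
  rewrite <- Series_scal_r. apply Cmod_Csum_le_bound.
  - intros k. rewrite Cmod_mult, Cmod_qn. fold x. rewrite pow_add.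
    replace (Cmod (a (N + k)%nat) * (x ^ N * x ^ k)) with (Cmod (a (N + k)%nat) * x ^ k * x ^ N) by ring.
    apply Rmult_le_compat_r. apply pow_le; lra. apply Rmult_le_compat_l. apply Cmod_ge_0. apply pow_incr; lra.
  - now apply ex_series_scal_r.
Qed.

Lemma Ev_bounded a y0 : pconv a -> 0 < y0 -> exists K, 0 <= K /\ forall z, y0 <= Im z -> Cmod (Ev a z) <= K.
Proof.
  intros Ha Hy. destruct (Ev_decay a 0 y0 Ha ltac:(intros; lia) Hy) as [K [HK H]]. exists K. split; auto.
  intros z Hz. specialize (H z Hz). simpl in H. lra.
Qed.

(** Strong induction: once the lower coefficients vanish, the term of degree n equals minus a series
    of order n + 1, hence |a n| <= K |cE z|, and Im z is sent to infinity. *)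
Lemma Ev_zero a Y : pconv a -> (forall z, Y < Im z -> 0 < Im z -> Ev a z = 0) -> forall n, a n = RtoC 0.
Proof.
  intros Ha H n. induction n as [n IH] using (well_founded_induction lt_wf).
  set (b := fun k => if (k =? n)%nat then RtoC 0 else a k).
  assert (Hb : pconv b). { apply pconv_le with (2 := Ha). intros k. unfold b. destruct (k =? n)%nat. rewrite Cmod_0; apply Cmod_ge_0. lra. }
  destruct (Ev_decay b (S n) 1 Hb) as [K [HK HD]]; [|lra|].
  { intros k Hk. unfold b. destruct (Nat.eqb_spec k n); auto. apply IH. lia. }
  assert (Hle : forall z, Y < Im z -> 1 <= Im z -> Cmod (a n) <= K * Cmod (cE z)).
  { intros z Hz Hz1. assert (Hz0 : 0 < Im z) by lra. specialize (HD z Hz1).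
    assert (E : Ev a z = (Ev b z + a n * cE (nC n * z))%C).
    { unfold Ev. set (dl := fun k => if (k =? n)%nat then (a n * cE (nC n * z))%C else RtoC 0).
      assert (Sd : summ dl).
      { apply (ex_series_incr_n _ (S n)). apply (ex_series_ext (fun k => 0 * / (1 + INR k ^ 2))); [|apply ex_series_scal_inv_sq].
        intros k. unfold dl. destruct (Nat.eqb_spec (S n + k) n); [lia|]. rewrite Cmod_0. match goal with |- ?a = ?b => change (@eq R a b) end. ring. }
      replace (a n * cE (nC n * z))%C with (Csum dl).
      - rewrite <- Csum_plus by (auto; now apply summ_Ev). apply Csum_ext. intros k. unfold b, dl.
        destruct (Nat.eqb_spec k n); subst; ring.
      - rewrite (Csum_finite dl (S n)). cbn [csum]. rewrite (csum_ext dl (fun _ => RtoC 0)).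
        assert (E : forall n, csum (fun _ : nat => RtoC 0) n = RtoC 0) by (induction n0; simpl; [auto|rewrite IHn0; ring]).
        rewrite E. unfold dl. rewrite Nat.eqb_refl. ring.
        intros k Hk. unfold dl. destruct (Nat.eqb_spec k n); [lia|auto].
        intros k Hk. unfold dl. destruct (Nat.eqb_spec k n); [lia|auto]. }
    rewrite H in E by auto.
    assert (E2 : (a n * cE (nC n * z) = - Ev b z)%C). { replace (a n * cE (nC n * z))%C with ((Ev b z + a n * cE (nC n * z)) - Ev b z)%C by ring. rewrite <- E. ring. }
    assert (E3 : Cmod (a n) * Cmod (cE z) ^ n <= K * Cmod (cE z) ^ S n).
    { rewrite <- Cmod_qn, <- Cmod_mult, E2, Cmod_opp. auto. }
    assert (Hp : 0 < Cmod (cE z)) by (apply Cmod_gt_0, cE_nz).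
    apply Rmult_le_reg_r with (Cmod (cE z) ^ n). now apply pow_lt. simpl in E3. lra. }
  apply Cmod_eq_0. apply Rle_antisym; [|apply Cmod_ge_0]. apply le_epsilon. intros e He. rewrite Rplus_0_l.
  assert (Hpi := PI2_3_2).
  set (y := Rmax (Rmax (Y + 1) 1) (K / e)).
  assert (Hy1 : Y < y) by (assert (A1 := Rmax_l (Y + 1) 1); assert (A2 := Rmax_l (Rmax (Y + 1) 1) (K / e)); fold y in A2; lra).
  assert (Hy2 : 1 <= y) by (assert (A1 := Rmax_r (Y + 1) 1); assert (A2 := Rmax_l (Rmax (Y + 1) 1) (K / e)); fold y in A2; lra).
  assert (Hy3 : K / e <= y) by apply Rmax_r.
  assert (HL := Hle (0, y) Hy1 Hy2). rewrite Cmod_cE in HL. simpl (Im (0, y)) in HL.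
  apply Rle_trans with (1 := HL).
  replace (- (2 * PI) * y) with (- (2 * PI * y)) by ring. rewrite exp_Ropp.
  assert (E := exp_ineq1_le (2 * PI * y)). assert (Hq : y <= exp (2 * PI * y)) by nra.
  assert (HKy : K <= e * y). { apply Rmult_le_reg_r with (/ e). now apply Rinv_0_lt_compat. unfold Rdiv in Hy3. replace (e * y * / e) with y by (field; lra). lra. }
  apply Rmult_le_reg_r with (exp (2 * PI * y)). apply exp_pos. rewrite Rmult_assoc, Rinv_l by (assert (H0 := exp_pos (2 * PI * y)); lra).
  nra.
Qed.

(** * Second-order Taylor expansions *)

(* [g h = c0 + c1 h + c2 h^2 + O(h^3)] at the origin: the only regularity notion used here. *)
Definition Jet (g : C -> C) (c0 c1 c2 : C) : Prop :=
  exists K d, 0 <= K /\ 0 < d /\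
    forall h, Cmod h < d -> Cmod (g h - (c0 + c1 * h + c2 * (h * h))) <= K * Cmod h ^ 3.

Definition J2 (F : C -> C) (z l : C) : Prop := exists l2, Jet (fun h => F (z + h)%C) (F z) l l2.

Lemma Jet_ext f g c0 c1 c2 d0 : 0 < d0 -> (forall h, Cmod h < d0 -> f h = g h) -> Jet f c0 c1 c2 -> Jet g c0 c1 c2.
Proof.
  intros Hd0 H [K [d [HK [Hd HF]]]]. exists K, (Rmin d d0). split; auto. split. now apply Rmin_glb_lt.
  intros h Hh. rewrite <- H. apply HF. eapply Rlt_le_trans; [apply Hh|apply Rmin_l].
  eapply Rlt_le_trans; [apply Hh|apply Rmin_r].
Qed.

Lemma Jet_const c : Jet (fun _ => c) c 0 0.
Proof.
  exists 0, 1. split. lra. split. lra. intros h _.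
  replace (c - (c + 0 * h + 0 * (h * h)))%C with (RtoC 0) by ring. rewrite Cmod_0. lra.
Qed.

Lemma Jet_affine a b : Jet (fun h => a + b * h)%C a b 0.
Proof.
  exists 0, 1. split. lra. split. lra. intros h _.
  replace (a + b * h - (a + b * h + 0 * (h * h)))%C with (RtoC 0) by ring. rewrite Cmod_0. lra.
Qed.

Lemma Jet_plus f g a0 a1 a2 b0 b1 b2 : Jet f a0 a1 a2 -> Jet g b0 b1 b2 ->
  Jet (fun h => f h + g h)%C (a0 + b0) (a1 + b1) (a2 + b2).
Proof.
  intros [K [d [HK [Hd HF]]]] [K' [d' [HK' [Hd' HG]]]].
  exists (K + K'), (Rmin d d'). split. lra. split. now apply Rmin_glb_lt. intros h Hh.
  specialize (HF h ltac:(eapply Rlt_le_trans; [apply Hh|apply Rmin_l])).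
  specialize (HG h ltac:(eapply Rlt_le_trans; [apply Hh|apply Rmin_r])).
  match goal with |- Cmod ?e <= _ =>
    replace e with ((f h - (a0 + a1 * h + a2 * (h * h))) + (g h - (b0 + b1 * h + b2 * (h * h))))%C by ring end.
  eapply Rle_trans; [apply Cmod_triangle|]. lra.
Qed.

Lemma Cmod_poly2 a0 a1 a2 h : Cmod h <= 1 -> Cmod (a0 + a1 * h + a2 * (h * h))%C <= Cmod a0 + Cmod a1 + Cmod a2.
Proof.
  intros Hh. assert (H := Cmod_ge_0 h). assert (H1 := Cmod_ge_0 a1). assert (H2 := Cmod_ge_0 a2).
  eapply Rle_trans; [apply Cmod_triangle|]. rewrite !Cmod_mult.
  assert (Cmod (a0 + a1 * h) <= Cmod a0 + Cmod a1 * Cmod h). { eapply Rle_trans; [apply Cmod_triangle|]. rewrite Cmod_mult. lra. }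
  assert (Cmod a1 * Cmod h <= Cmod a1) by nra. assert (Cmod h * Cmod h <= 1) by nra.
  assert (Cmod a2 * (Cmod h * Cmod h) <= Cmod a2) by nra. lra.
Qed.

Lemma Jet_bounded g c0 c1 c2 : Jet g c0 c1 c2 -> exists B d, 0 <= B /\ 0 < d /\ forall h, Cmod h < d -> Cmod (g h) <= B.
Proof.
  intros [K [d [HK [Hd H]]]]. exists (Cmod c0 + Cmod c1 + Cmod c2 + K), (Rmin d 1).
  assert (H0 := Cmod_ge_0 c0). assert (H1 := Cmod_ge_0 c1). assert (H2 := Cmod_ge_0 c2).
  split. lra. split. apply Rmin_glb_lt; lra. intros h Hh.
  assert (Hh1 : Cmod h < d) by (eapply Rlt_le_trans; [apply Hh|apply Rmin_l]).
  assert (Hh2 : Cmod h < 1) by (eapply Rlt_le_trans; [apply Hh|apply Rmin_r]).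
  specialize (H h Hh1). assert (P := Cmod_poly2 c0 c1 c2 h ltac:(lra)).
  assert (T := Cmod_triangle_inv (g h) (c0 + c1 * h + c2 * (h * h))).
  assert (Cmod h ^ 3 <= 1). { rewrite <- (pow1 3). apply pow_incr. split; [apply Cmod_ge_0|lra]. }
  assert (K * Cmod h ^ 3 <= K) by nra. lra.
Qed.

Lemma Jet_mult f g a0 a1 a2 b0 b1 b2 : Jet f a0 a1 a2 -> Jet g b0 b1 b2 ->
  Jet (fun h => f h * g h)%C (a0 * b0) (a1 * b0 + a0 * b1) (a2 * b0 + a1 * b1 + a0 * b2).
Proof.
  intros Jf Jg. destruct (Jet_bounded _ _ _ _ Jg) as [B [dB [HB [HdB Hb]]]].
  destruct Jf as [K [d [HK [Hd HF]]]]. destruct Jg as [K' [d' [HK' [Hd' HG]]]].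
  set (A := Cmod a0 + Cmod a1 + Cmod a2). set (E := Cmod (a1 * b2 + a2 * b1) + Cmod (a2 * b2)).
  assert (H0 := Cmod_ge_0 a0). assert (H1 := Cmod_ge_0 a1). assert (H2 := Cmod_ge_0 a2).
  assert (HA : 0 <= A) by (unfold A; lra).
  assert (HE1 := Cmod_ge_0 (a1 * b2 + a2 * b1)). assert (HE2 := Cmod_ge_0 (a2 * b2)).
  exists (K * B + A * K' + E), (Rmin (Rmin d d') (Rmin dB 1)).
  split. assert (0 <= K * B) by nra. assert (0 <= A * K') by nra. unfold E; lra.
  split. repeat apply Rmin_glb_lt; lra. intros h Hh.
  assert (h1 : Cmod h < d) by (eapply Rlt_le_trans; [apply Hh|]; eapply Rle_trans; [apply Rmin_l|apply Rmin_l]).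
  assert (h2 : Cmod h < d') by (eapply Rlt_le_trans; [apply Hh|]; eapply Rle_trans; [apply Rmin_l|apply Rmin_r]).
  assert (h3 : Cmod h < dB) by (eapply Rlt_le_trans; [apply Hh|]; eapply Rle_trans; [apply Rmin_r|apply Rmin_l]).
  assert (h4 : Cmod h < 1) by (eapply Rlt_le_trans; [apply Hh|]; eapply Rle_trans; [apply Rmin_r|apply Rmin_r]).
  specialize (HF h h1). specialize (HG h h2). specialize (Hb h h3).
  assert (HP := Cmod_poly2 a0 a1 a2 h ltac:(lra)). fold A in HP.
  set (pf := (a0 + a1 * h + a2 * (h * h))%C) in *. set (pg := (b0 + b1 * h + b2 * (h * h))%C) in *.
  match goal with |- Cmod ?e <= _ =>
    replace e with ((f h - pf) * g h + pf * (g h - pg) + ((a1 * b2 + a2 * b1) + (a2 * b2) * h) * (h * h * h))%C by (unfold pf, pg; ring) end.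
  eapply Rle_trans; [apply Cmod_triangle|]. eapply Rle_trans; [apply Rplus_le_compat_r, Cmod_triangle|].
  rewrite !Cmod_mult. assert (Hh0 := Cmod_ge_0 h).
  assert (HQ : Cmod (a1 * b2 + a2 * b1 + a2 * b2 * h) <= E).
  { eapply Rle_trans; [apply Cmod_triangle|]. rewrite (Cmod_mult (a2 * b2) h). unfold E. nra. }
  replace (Cmod h * Cmod h * Cmod h) with (Cmod h ^ 3) by ring.
  assert (Hc : 0 <= Cmod h ^ 3) by (apply pow_le; auto).
  rewrite !Rmult_plus_distr_r. apply Rplus_le_compat; [apply Rplus_le_compat|].
  - replace (K * B * Cmod h ^ 3) with ((K * Cmod h ^ 3) * B) by ring. apply Rmult_le_compat; auto; apply Cmod_ge_0.
  - rewrite Rmult_assoc. apply Rmult_le_compat; auto; apply Cmod_ge_0.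
  - apply Rmult_le_compat_r; auto.
Qed.

(** With k = g h - w, which is O(h), the quadratic term is handled by k^2 - (m1 h)^2 = (k - m1 h) (k
    + m1 h): the first factor is O(h^2), the second O(h). *)
Lemma Jet_comp (F g : C -> C) w l0 l1 l2 m1 m2 :
  Jet (fun k => F (w + k)%C) l0 l1 l2 -> Jet g w m1 m2 ->
  Jet (fun h => F (g h)) l0 (l1 * m1) (l1 * m2 + l2 * (m1 * m1)).
Proof.
  intros [K [d [HK [Hd HF]]]] [K' [d' [HK' [Hd' HG]]]].
  assert (H1 := Cmod_ge_0 m1). assert (H2 := Cmod_ge_0 m2). assert (H3 := Cmod_ge_0 l1). assert (H4 := Cmod_ge_0 l2).
  set (B := Cmod m1 + Cmod m2 + K' + 1). assert (HB : 1 <= B) by (unfold B; lra).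
  assert (Hk : forall h, Cmod h < Rmin d' 1 -> Cmod (g h - w) <= B * Cmod h /\ Cmod (g h - w - m1 * h) <= B * Cmod h ^ 2).
  { intros h Hh. assert (h1 : Cmod h < d') by (eapply Rlt_le_trans; [apply Hh|apply Rmin_l]).
    assert (h2 : Cmod h < 1) by (eapply Rlt_le_trans; [apply Hh|apply Rmin_r]). specialize (HG h h1).
    assert (Hh0 := Cmod_ge_0 h).
    assert (S : Cmod (g h - w - m1 * h) <= (Cmod m2 + K') * Cmod h ^ 2).
    { replace (g h - w - m1 * h)%C with ((g h - (w + m1 * h + m2 * (h * h))) + m2 * (h * h))%C by ring.
      eapply Rle_trans; [apply Cmod_triangle|]. rewrite !Cmod_mult.
      assert (K' * Cmod h ^ 3 <= K' * Cmod h ^ 2) by (apply Rmult_le_compat_l; auto; nra). nra. }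
    split.
    - replace (g h - w)%C with ((g h - w - m1 * h) + m1 * h)%C by ring.
      eapply Rle_trans; [apply Cmod_triangle|]. rewrite Cmod_mult. unfold B.
      assert ((Cmod m2 + K') * Cmod h ^ 2 <= (Cmod m2 + K') * Cmod h) by (apply Rmult_le_compat_l; [lra|nra]). nra.
    - eapply Rle_trans; [apply S|]. apply Rmult_le_compat_r. apply pow2_ge_0. unfold B; lra. }
  exists (K * B ^ 3 + Cmod l1 * K' + Cmod l2 * (B * (B + Cmod m1))), (Rmin (Rmin d' 1) (d / B)).
  assert (Hd1 : 0 < d / B) by (apply Rdiv_lt_0_compat; lra).
  split. { assert (0 <= B ^ 3) by (apply pow_le; lra). assert (0 <= B * (B + Cmod m1)) by nra.
    assert (0 <= K * B ^ 3) by nra. assert (0 <= Cmod l1 * K') by nra. assert (0 <= Cmod l2 * (B * (B + Cmod m1))) by nra. lra. }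
  split. repeat apply Rmin_glb_lt; lra. intros h Hh.
  assert (h0 : Cmod h < Rmin d' 1) by (eapply Rlt_le_trans; [apply Hh|apply Rmin_l]).
  assert (h1 : Cmod h < d') by (eapply Rlt_le_trans; [apply h0|apply Rmin_l]).
  assert (h2 : Cmod h < d / B) by (eapply Rlt_le_trans; [apply Hh|apply Rmin_r]).
  destruct (Hk h h0) as [A1 A2]. specialize (HG h h1). assert (Hh0 := Cmod_ge_0 h).
  set (k := (g h - w)%C) in *.
  assert (Hkd : Cmod k < d). { apply Rle_lt_trans with (1 := A1). apply (Rlt_div_r _ _ B) in h2; lra. }
  specialize (HF k Hkd). replace (w + k)%C with (g h) in HF by (unfold k; ring).
  match goal with |- Cmod ?e <= _ =>
    replace e with ((F (g h) - (l0 + l1 * k + l2 * (k * k))) + l1 * (g h - (w + m1 * h + m2 * (h * h))) + l2 * ((k - m1 * h) * (k + m1 * h)))%C by (unfold k; ring) end.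
  eapply Rle_trans; [apply Cmod_triangle|]. eapply Rle_trans; [apply Rplus_le_compat_r, Cmod_triangle|].
  rewrite !Cmod_mult. rewrite !Rmult_plus_distr_r.
  apply Rplus_le_compat; [apply Rplus_le_compat|].
  - eapply Rle_trans; [apply HF|]. rewrite Rmult_assoc. apply Rmult_le_compat_l; auto.
    rewrite <- Rpow_mult_distr. apply pow_incr. split; auto. apply Cmod_ge_0.
  - rewrite Rmult_assoc. apply Rmult_le_compat_l; auto.
  - rewrite Rmult_assoc. apply Rmult_le_compat_l; auto.
    replace (B * (B + Cmod m1) * Cmod h ^ 3) with ((B * Cmod h ^ 2) * ((B + Cmod m1) * Cmod h)) by ring.
    apply Rmult_le_compat; auto; try apply Cmod_ge_0.
    eapply Rle_trans; [apply Cmod_triangle|]. rewrite Cmod_mult. lra.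
Qed.

Lemma J2_plus F G z l m : J2 F z l -> J2 G z m -> J2 (fun w => F w + G w)%C z (l + m)%C.
Proof. intros [a Ha] [b Hb]. exists (a + b)%C. exact (Jet_plus _ _ _ _ _ _ _ _ Ha Hb). Qed.
Lemma J2_mult F G z l m : J2 F z l -> J2 G z m -> J2 (fun w => F w * G w)%C z (l * G z + F z * m)%C.
Proof. intros [a Ha] [b Hb]. eexists. exact (Jet_mult _ _ _ _ _ _ _ _ Ha Hb). Qed.
Lemma J2_const c z : J2 (fun _ => c) z 0.
Proof. exists 0. apply Jet_const. Qed.
Lemma J2_id z : J2 (fun w => w) z 1.
Proof. exists 0. apply Jet_ext with (fun h => z + 1 * h)%C 1. lra. intros; ring. apply Jet_affine. Qed.
Lemma J2_comp F G z l m : J2 F (G z) l -> J2 G z m -> J2 (fun w => F (G w)) z (l * m)%C.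
Proof. intros [a Ha] [b Hb]. eexists. exact (Jet_comp F (fun h => G (z + h)%C) (G z) _ _ _ _ _ Ha Hb). Qed.
Lemma J2_scal c F z l : J2 F z l -> J2 (fun w => c * F w)%C z (c * l)%C.
Proof. intros H. replace (c * l)%C with (0 * F z + c * l)%C by ring. apply (J2_mult (fun _ => c)); auto. apply J2_const. Qed.
Lemma J2_eq F z l m : J2 F z l -> l = m -> J2 F z m.
Proof. now intros H <-. Qed.

Lemma J2_ext_H F G z l : (forall w, 0 < Im w -> F w = G w) -> 0 < Im z -> J2 F z l -> J2 G z l.
Proof.
  intros H Hz [a Ha]. exists a. rewrite <- H by auto. apply Jet_ext with (3 := Ha) (d0 := Im z); auto.
  intros h Hh. apply H. rewrite Im_plus. assert (A := im_le_Cmod h). apply Rabs_le_between in A. lra.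
Qed.

Lemma J2_cexp z : J2 cexp z (cexp z).
Proof.
  exists (cexp z * / 2)%C.
  exists (Cmod (cexp z) * (8 * exp 1)), 1. assert (H0 := Cmod_ge_0 (cexp z)). assert (He := exp_pos 1).
  split. nra. split. lra. intros h Hh.
  rewrite cexp_plus.
  replace (cexp z * cexp h - (cexp z + cexp z * h + cexp z * / 2 * (h * h)))%C with (cexp z * (cexp h - 1 - h - h * h / 2))%C by (field).
  rewrite Cmod_mult, Rmult_assoc. apply Rmult_le_compat_l; auto.
  eapply Rle_trans; [apply cexp_bound3|].
  assert (Cmod h ^ 3 * exp (Cmod h) <= Cmod h ^ 3 * exp 1).
  { apply Rmult_le_compat_l. apply pow_le, Cmod_ge_0. apply exp_le; lra. } lra.
Qed.

Lemma J2_neg_inv z : 0 < Im z -> J2 (fun w => - / w)%C z (/ (z * z))%C.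
Proof.
  intros Hz. assert (Hn := Im_pos_nz z Hz). exists (- / (z * z * z))%C.
  assert (Hp : 0 < Cmod z) by (now apply Cmod_gt_0).
  exists (2 / Cmod z ^ 4), (Cmod z / 2). split. apply Rdiv_le_0_compat. lra. now apply pow_lt. split. lra.
  intros h Hh. assert (T := Cmod_triangle_inv z (- h)). rewrite Cmod_opp in T. replace (z - - h)%C with (z + h)%C in T by ring.
  assert (Hz2 : Cmod z / 2 <= Cmod (z + h)) by lra.
  assert (Hzh : (z + h <> 0)%C). { apply Cmod_gt_0. lra. }
  replace (- / (z + h) - (- / z + / (z * z) * h + - / (z * z * z) * (h * h)))%C with (h ^ 3 * / (z ^ 3 * (z + h)))%C by (field; auto).
  rewrite Cmod_mult, Cmod_pow, Cmod_inv, Cmod_mult, Cmod_pow by (apply Cmult_neq_0; auto using Cpow_nz).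
  rewrite Rmult_comm. apply Rmult_le_compat_r. apply pow_le, Cmod_ge_0.
  replace (2 / Cmod z ^ 4) with (/ (Cmod z ^ 3 * (Cmod z / 2))) by (field; lra).
  assert (0 < Cmod z ^ 3) by (now apply pow_lt).
  apply Rinv_le_contravar. apply Rmult_lt_0_compat; lra. apply Rmult_le_compat_l; lra.
Qed.

(** Each exponential is expanded to second order. For |h| < Im z / 2 the factor exp(2 PI n |h|) of
    the remainder uses up at most half of the decay, hence rho = exp(- PI Im z); what remains is the
    series of theta^3 a at rho. *)
Lemma J2_Ev a z : pconv a -> 0 < Im z -> J2 (Ev a) z (c2pi * Ev (ctheta a) z)%C.
Proof.
  intros Ha Hz. exists (c2pi * c2pi / 2 * Ev (ctheta (ctheta a)) z)%C.
  assert (P1 := pconv_theta a Ha). assert (P2 := pconv_theta _ P1). assert (P3 := pconv_theta _ P2).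
  assert (Hpi := PI_RGT_0). set (rho := exp (- PI * Im z)).
  assert (Hrho : 0 <= rho < 1). { split. left; apply exp_pos. unfold rho. rewrite <- exp_0. apply exp_increasing. nra. }
  specialize (P3 rho Hrho).
  assert (P3' := ex_series_scal (V := R_NormedModule) (8 * (2 * PI) ^ 3) _ P3).
  exists (Series (fun n => 8 * (2 * PI) ^ 3 * (Cmod (ctheta (ctheta (ctheta a)) n) * rho ^ n))), (Im z / 2).
  split. { apply Series_nonneg; auto. intros n. assert (0 <= (2 * PI) ^ 3) by (apply pow_le; lra).
    assert (0 <= rho ^ n) by (apply pow_le; lra). assert (Hf0 := Cmod_ge_0 (ctheta (ctheta (ctheta a)) n)).
    assert (0 <= Cmod (ctheta (ctheta (ctheta a)) n) * rho ^ n) by (now apply Rmult_le_pos). nra. }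
  split. lra. intros h Hh.
  assert (Hzh : 0 < Im (z + h)). { rewrite Im_plus. assert (A := im_le_Cmod h). apply Rabs_le_between in A. lra. }
  assert (E : (Ev a (z + h) - (Ev a z + c2pi * Ev (ctheta a) z * h + c2pi * c2pi / 2 * Ev (ctheta (ctheta a)) z * (h * h)))%C =
    Csum (fun n => a n * cE (nC n * z) * (cexp (c2pi * (nC n * h)) - 1 - c2pi * (nC n * h) - (c2pi * (nC n * h)) * (c2pi * (nC n * h)) / 2))%C).
  { unfold Ev. assert (S0 := summ_Ev a z Ha Hz). assert (S1 := summ_Ev _ z P1 Hz). assert (S2 := summ_Ev _ z P2 Hz).
    assert (S4 := summ_Ev a _ Ha Hzh).
    replace (c2pi * Csum (fun n => ctheta a n * cE (nC n * z)) * h)%C with ((c2pi * h) * Csum (fun n => ctheta a n * cE (nC n * z)))%C by ring.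
    replace (c2pi * c2pi / 2 * Csum (fun n => ctheta (ctheta a) n * cE (nC n * z)) * (h * h))%C with ((c2pi * c2pi / 2 * (h * h)) * Csum (fun n => ctheta (ctheta a) n * cE (nC n * z)))%C by ring.
    rewrite <- !Csum_scal by auto. rewrite <- !Csum_plus by (repeat apply summ_plus; auto using summ_scal).
    rewrite <- Csum_minus by (repeat apply summ_plus; auto using summ_scal).
    apply Csum_ext. intros n. rewrite Cmult_plus_distr_l, cE_plus, (cE_c2pi (nC n * h)). unfold ctheta. field. }
  rewrite E. rewrite <- Series_scal_r. apply Cmod_Csum_le_bound; [|now apply ex_series_scal_r].
  intros n. rewrite !Cmod_mult, Cmod_qn.
  set (v := (c2pi * (nC n * h))%C). assert (Bv := cexp_bound3 v).
  assert (Ev' : Cmod v = 2 * PI * INR n * Cmod h). { unfold v. rewrite !Cmod_mult, Cmod_c2pi. unfold nC. rewrite Cmod_R, Rabs_pos_eq by apply pos_INR. ring. }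
  assert (Hn := pos_INR n). assert (Hh0 := Cmod_ge_0 h).
  assert (Q : Cmod (cE z) ^ n * exp (Cmod v) <= rho ^ n).
  { rewrite Cmod_cE, Ev'.
    assert (X : forall x k, exp x ^ k = exp (INR k * x)). { intros x k. induction k. simpl. rewrite Rmult_0_l, exp_0. auto.
      rewrite S_INR. simpl. rewrite IHk, <- exp_plus. f_equal. ring. }
    unfold rho. rewrite !X, <- exp_plus. apply exp_le.
    replace (INR n * (- (2 * PI) * Im z) + 2 * PI * INR n * Cmod h) with (INR n * (2 * PI) * (Cmod h - Im z)) by ring.
    replace (INR n * (- PI * Im z)) with (INR n * (2 * PI) * (- Im z / 2)) by field.
    apply Rmult_le_compat_l. nra. lra. }
  assert (Ha0 := Cmod_ge_0 (a n)).
  apply Rle_trans with (Cmod (a n) * Cmod (cE z) ^ n * (8 * (Cmod v ^ 3 * exp (Cmod v)))).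
  { apply Rmult_le_compat_l; auto. apply Rmult_le_pos; auto. apply pow_le, Cmod_ge_0. }
  replace (Cmod (a n) * Cmod (cE z) ^ n * (8 * (Cmod v ^ 3 * exp (Cmod v)))) with (Cmod (a n) * 8 * Cmod v ^ 3 * (Cmod (cE z) ^ n * exp (Cmod v))) by ring.
  apply Rle_trans with (Cmod (a n) * 8 * Cmod v ^ 3 * rho ^ n).
  { apply Rmult_le_compat_l; auto. apply Rmult_le_pos. lra. apply pow_le, Cmod_ge_0. }
  right. rewrite Ev'. unfold ctheta. rewrite !Cmod_mult. unfold nC. rewrite !Cmod_R, !Rabs_pos_eq by auto. ring.
Qed.

Lemma J2_linear_bound F z l : J2 F z l -> exists K d, 0 <= K /\ 0 < d /\
  forall h, Cmod h < d -> Cmod (F (z + h)%C - F z - l * h) <= K * Cmod h ^ 2.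
Proof.
  intros [l2 [K [d [HK [Hd H]]]]]. assert (H2 := Cmod_ge_0 l2).
  exists (Cmod l2 + K), (Rmin d 1). split. lra. split. apply Rmin_glb_lt; lra. intros h Hh.
  assert (h1 : Cmod h < d) by (eapply Rlt_le_trans; [apply Hh|apply Rmin_l]).
  assert (h2 : Cmod h < 1) by (eapply Rlt_le_trans; [apply Hh|apply Rmin_r]). specialize (H h h1). assert (Hh0 := Cmod_ge_0 h).
  replace (F (z + h) - F z - l * h)%C with ((F (z + h) - (F z + l * h + l2 * (h * h))) + l2 * (h * h))%C by ring.
  eapply Rle_trans; [apply Cmod_triangle|]. rewrite !Cmod_mult.
  assert (K * Cmod h ^ 3 <= K * Cmod h ^ 2) by (apply Rmult_le_compat_l; auto; nra). nra.
Qed.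

Lemma J2_unique F z l m : J2 F z l -> J2 F z m -> l = m.
Proof.
  intros H1 H2. destruct (J2_linear_bound _ _ _ H1) as [K [d [HK [Hd A]]]]. destruct (J2_linear_bound _ _ _ H2) as [K' [d' [HK' [Hd' A']]]].
  apply Ceq_minus. apply Cmod_eq_0. apply Rle_antisym; [|apply Cmod_ge_0]. apply le_epsilon. intros e He. rewrite Rplus_0_l.
  set (t := Rmin (Rmin (d / 2) (d' / 2)) (e / (K + K' + 1))).
  assert (He' : 0 < e / (K + K' + 1)) by (apply Rdiv_lt_0_compat; lra).
  assert (Ht : 0 < t) by (unfold t; repeat apply Rmin_glb_lt; lra).
  assert (t1 : t <= d / 2) by (eapply Rle_trans; [apply Rmin_l|apply Rmin_l]).
  assert (t2 : t <= d' / 2) by (eapply Rle_trans; [apply Rmin_l|apply Rmin_r]).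
  assert (t3 : t * (K + K' + 1) <= e). { apply (Rle_div_r t e (K + K' + 1)). lra. apply Rmin_r. }
  assert (Hm : Cmod (RtoC t) = t) by (rewrite Cmod_R, Rabs_pos_eq; lra).
  specialize (A (RtoC t) ltac:(lra)). specialize (A' (RtoC t) ltac:(lra)). rewrite Hm in A, A'.
  assert (X : Cmod (l - m) * t <= (K + K') * t ^ 2).
  { rewrite <- Hm at 1. rewrite <- Cmod_mult.
    replace ((l - m) * t)%C with ((F (z + t) - F z - m * t) - (F (z + t) - F z - l * t))%C by ring.
    eapply Rle_trans; [apply Cmod_triangle_minus|]. lra. }
  apply Rmult_le_reg_r with t; auto. nra.
Qed.

Lemma J2_path F p u l t : J2 F (p + RtoC t * u)%C l ->
  is_derive (fun t => Re (F (p + RtoC t * u)%C)) t (Re (l * u)) /\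
  is_derive (fun t => Im (F (p + RtoC t * u)%C)) t (Im (l * u)).
Proof.
  intros H. destruct (J2_linear_bound _ _ _ H) as [K [d [HK [Hd A]]]].
  assert (Hu := Cmod_ge_0 u). set (C0 := K * Cmod u ^ 2). assert (HC0 : 0 <= C0) by (apply Rmult_le_pos; auto; apply pow2_ge_0).
  assert (B : forall h, Rabs h < d / (Cmod u + 1) ->
     Cmod (F (p + RtoC (t + h) * u)%C - F (p + RtoC t * u)%C - RtoC h * (l * u)) <= C0 * (Rabs h * Rabs h)).
  { intros h Hh. assert (Hr := Rabs_pos h). assert (Hh2 : Cmod (RtoC h * u) < d).
    { rewrite Cmod_mult, Cmod_R. apply (Rlt_div_r _ _ (Cmod u + 1)) in Hh; nra. }
    specialize (A _ Hh2). rewrite Cmod_mult, Cmod_R in A.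
    replace (p + RtoC (t + h) * u)%C with (p + RtoC t * u + RtoC h * u)%C by (rewrite RtoC_plus; ring).
    replace (RtoC h * (l * u))%C with (l * (RtoC h * u))%C by ring. apply Rle_trans with (1 := A). right. unfold C0. ring. }
  assert (G : forall (phi : C -> R), (forall c, Rabs (phi c) <= Cmod c) -> (forall a b, phi (a - b)%C = phi a - phi b) ->
     (forall (x : R) c, phi (RtoC x * c)%C = x * phi c) ->
     is_derive (fun t => phi (F (p + RtoC t * u)%C)) t (phi (l * u)%C)).
  { intros phi P1 P2 P3. apply is_derive_Reals. intros e He.
    assert (Hdd : 0 < Rmin (d / (Cmod u + 1)) (e / (C0 + 1))).
    { apply Rmin_glb_lt; apply Rdiv_lt_0_compat; lra. }
    exists (mkposreal _ Hdd). intros h Hh0 Hh. simpl in Hh.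
    assert (h1 : Rabs h < d / (Cmod u + 1)) by (eapply Rlt_le_trans; [apply Hh|apply Rmin_l]).
    assert (h2 : Rabs h < e / (C0 + 1)) by (eapply Rlt_le_trans; [apply Hh|apply Rmin_r]).
    specialize (B h h1). assert (Hr : 0 < Rabs h) by (now apply Rabs_pos_lt).
    replace ((phi (F (p + RtoC (t + h) * u)%C) - phi (F (p + RtoC t * u)%C)) / h - phi (l * u)%C)
      with (phi (F (p + RtoC (t + h) * u)%C - F (p + RtoC t * u)%C - RtoC h * (l * u))%C / h).
    2:{ rewrite !P2, P3. field. auto. }
    unfold Rdiv. rewrite Rabs_mult, Rabs_inv.
    apply Rmult_lt_reg_r with (Rabs h); auto. rewrite Rmult_assoc, Rinv_l, Rmult_1_r by lra.
    apply Rle_lt_trans with (1 := P1 _). apply Rle_lt_trans with (1 := B).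
    rewrite <- Rmult_assoc. apply Rmult_lt_compat_r; auto.
    apply (Rlt_div_r _ _ (C0 + 1)) in h2; nra. }
  split.
  - apply (G (fun c => Re c)). apply re_le_Cmod. reflexivity. intros. apply re_scal_l.
  - apply (G (fun c => Im c)). apply im_le_Cmod. reflexivity. intros. apply im_scal_l.
Qed.

(** The upper half-plane is convex, so [path_mvt] applies with K = 0 along the segment from z to
    w. *)
Lemma J2_zero_const F : (forall z, 0 < Im z -> J2 F z 0) -> forall z w, 0 < Im z -> 0 < Im w -> F z = F w.
Proof.
  intros H z w Hz Hw. assert (L := path_mvt (fun t => F (z + RtoC t * (w - z))%C) (fun _ => RtoC 0) 0).
  cbv beta in L. symmetry. apply Ceq_minus. apply Cmod_eq_0. apply Rle_antisym; [|apply Cmod_ge_0].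
  replace (z + 1 * (w - z))%C with w in L by ring. replace (z + 0 * (w - z))%C with z in L by ring.
  eapply Rle_trans; [apply L|lra].
  - intros t Ht. assert (Hp : 0 < Im (z + t * (w - z))). { rewrite Im_plus, im_scal_l, Im_minus. nra. }
    assert (X := J2_path F z (w - z)%C 0 t (H _ Hp)). replace (0 * (w - z))%C with (RtoC 0) in X by ring. exact X.
  - intros. rewrite Cmod_0. lra.
Qed.

Lemma J2_ex_derive F z l : J2 F z l -> ex_derive (F : C_AbsRing -> C_NormedModule) z.
Proof.
  intros H. destruct (J2_linear_bound _ _ _ H) as [K [d [HK [Hd A]]]]. exists l. split.
  - apply is_linear_scal_l.
  - intros x Hx. apply (is_filter_lim_locally_unique (V := AbsRing_NormedModule C_AbsRing)) in Hx. subst x. intros e.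
    assert (Hdd : 0 < Rmin d (e / (K + 1))). { apply Rmin_glb_lt; auto. apply Rdiv_lt_0_compat. apply cond_pos. lra. }
    exists (mkposreal _ Hdd). intros y Hy. change (Cmod (y - z) < Rmin d (e / (K + 1))) in Hy.
    change (Cmod (F y - F z - (y - z) * l) <= e * Cmod (y - z)).
    set (h := (y - z)%C) in *. replace y with (z + h)%C by (unfold h; ring).
    assert (h1 : Cmod h < d) by (eapply Rlt_le_trans; [apply Hy|apply Rmin_l]).
    assert (h2 : Cmod h < e / (K + 1)) by (eapply Rlt_le_trans; [apply Hy|apply Rmin_r]).
    specialize (A h h1). rewrite Cmult_comm. apply Rle_trans with (1 := A).
    apply (Rlt_div_r _ _ (K + 1)) in h2; [|lra]. assert (H0 := Cmod_ge_0 h). nra.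
Qed.

(** * Integer power series *)

Fixpoint zsum (a : nat -> Z) (n : nat) : Z :=
  match n with O => 0%Z | S m => (zsum a m + a m)%Z end.
Definition zadd (a b : nat -> Z) : nat -> Z := fun n => (a n + b n)%Z.
Definition zscal (c : Z) (a : nat -> Z) : nat -> Z := fun n => (c * a n)%Z.
Definition zmul (a b : nat -> Z) : nat -> Z := fun n => zsum (fun k => a k * b (n - k)%nat)%Z (S n).
Definition ztheta (a : nat -> Z) : nat -> Z := fun n => (Z.of_nat n * a n)%Z.
Definition zinfl (m : nat) (a : nat -> Z) : nat -> Z :=
  fun n => if (n mod m =? 0)%nat then a (n / m)%nat else 0%Z.
Definition zone : nat -> Z := fun n => if (n =? 0)%nat then 1%Z else 0%Z.
Fixpoint zpow (a : nat -> Z) (k : nat) : nat -> Z :=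
  match k with O => zone | S j => zmul a (zpow a j) end.

Definition toC (a : nat -> Z) : nat -> C := fun n => RtoC (IZR (a n)).
Definition zconv (a : nat -> Z) : Prop := pconv (toC a).
Definition ZE (a : nat -> Z) (z : C) : C := Ev (toC a) z.

Lemma toC_add a b : toC (zadd a b) = cadd (toC a) (toC b).
Proof. apply functional_extensionality; intros n. unfold toC, zadd, cadd. now rewrite plus_IZR, RtoC_plus. Qed.
Lemma toC_scal c a : toC (zscal c a) = cscal (RtoC (IZR c)) (toC a).
Proof. apply functional_extensionality; intros n. unfold toC, zscal, cscal. now rewrite mult_IZR, RtoC_mult. Qed.
Lemma toC_zsum (a : nat -> Z) n : RtoC (IZR (zsum a n)) = csum (fun k => RtoC (IZR (a k))) n.
Proof. induction n; simpl; auto. now rewrite plus_IZR, RtoC_plus, IHn. Qed.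
Lemma toC_mul a b : toC (zmul a b) = cmul (toC a) (toC b).
Proof.
  apply functional_extensionality; intros n. unfold toC, zmul, cmul. rewrite toC_zsum. apply csum_ext. intros.
  now rewrite mult_IZR, RtoC_mult.
Qed.
Lemma toC_theta a : toC (ztheta a) = ctheta (toC a).
Proof. apply functional_extensionality; intros n. unfold toC, ztheta, ctheta, nC. now rewrite mult_IZR, RtoC_mult, <- INR_IZR_INZ. Qed.
Lemma toC_infl m a : toC (zinfl m a) = cinfl m (toC a).
Proof. apply functional_extensionality; intros n. unfold toC, zinfl, cinfl. now destruct (n mod m =? 0)%nat. Qed.
Lemma toC_one : toC zone = cone.
Proof. apply functional_extensionality; intros n. unfold toC, zone, cone. now destruct (n =? 0)%nat. Qed.

Lemma zconv_add a b : zconv a -> zconv b -> zconv (zadd a b).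
Proof. unfold zconv. rewrite toC_add. apply pconv_add. Qed.
Lemma zconv_scal c a : zconv a -> zconv (zscal c a).
Proof. unfold zconv. rewrite toC_scal. apply pconv_scal. Qed.
Lemma zconv_mul a b : zconv a -> zconv b -> zconv (zmul a b).
Proof. unfold zconv. rewrite toC_mul. apply pconv_mul. Qed.
Lemma zconv_theta a : zconv a -> zconv (ztheta a).
Proof. unfold zconv. rewrite toC_theta. apply pconv_theta. Qed.
Lemma zconv_infl m a : (0 < m)%nat -> zconv a -> zconv (zinfl m a).
Proof. unfold zconv. rewrite toC_infl. apply pconv_infl. Qed.
Lemma zconv_one : zconv zone.
Proof. unfold zconv. rewrite toC_one. apply pconv_one. Qed.

Lemma ZE_add a b z : zconv a -> zconv b -> 0 < Im z -> ZE (zadd a b) z = (ZE a z + ZE b z)%C.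
Proof. unfold ZE. rewrite toC_add. apply Ev_add. Qed.
Lemma ZE_scal c a z : zconv a -> 0 < Im z -> ZE (zscal c a) z = (RtoC (IZR c) * ZE a z)%C.
Proof. unfold ZE. rewrite toC_scal. apply Ev_scal. Qed.
Lemma ZE_mul a b z : zconv a -> zconv b -> 0 < Im z -> ZE (zmul a b) z = (ZE a z * ZE b z)%C.
Proof. unfold ZE. rewrite toC_mul. apply Ev_mul. Qed.
Lemma ZE_one z : ZE zone z = 1.
Proof. unfold ZE. rewrite toC_one. apply Ev_one. Qed.
Lemma ZE_infl m a z : (0 < m)%nat -> zconv a -> 0 < Im z -> ZE (zinfl m a) z = ZE a (nC m * z).
Proof. unfold ZE. rewrite toC_infl. apply Ev_infl. Qed.
Lemma J2_ZE a z : zconv a -> 0 < Im z -> J2 (ZE a) z (c2pi * ZE (ztheta a) z)%C.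
Proof. unfold ZE. rewrite toC_theta. apply J2_Ev. Qed.
Lemma ZE_per a z : ZE a (z + 1) = ZE a z.
Proof. apply Ev_per. Qed.

Ltac zconv_tac := repeat match goal with
  | |- zconv (zadd _ _) => apply zconv_add
  | |- zconv (zscal _ _) => apply zconv_scal
  | |- zconv (zmul _ _) => apply zconv_mul
  | |- zconv (ztheta _) => apply zconv_theta
  | |- zconv (zinfl _ _) => apply zconv_infl; [lia|]
  | |- zconv zone => apply zconv_one
  end; auto.

Lemma zsum_ext a b n : (forall k, (k < n)%nat -> a k = b k) -> zsum a n = zsum b n.
Proof. induction n; simpl; intros H; auto. rewrite IHn, H; auto. Qed.
Lemma zsum_plus a b n : zsum (fun k => a k + b k)%Z n = (zsum a n + zsum b n)%Z.
Proof. induction n; simpl; [|rewrite IHn]; ring. Qed.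
Lemma zsum_scal c a n : zsum (fun k => c * a k)%Z n = (c * zsum a n)%Z.
Proof. induction n; simpl; [|rewrite IHn]; ring. Qed.
Lemma zsum_zero n : zsum (fun _ => 0%Z) n = 0%Z.
Proof. induction n; simpl; auto. now rewrite IHn. Qed.
Lemma zsum_S_l a n : zsum a (S n) = (a O + zsum (fun k => a (S k)) n)%Z.
Proof.
  induction n. simpl. ring. change (zsum a (S (S n))) with (zsum a (S n) + a (S n))%Z. rewrite IHn. simpl. ring.
Qed.
Lemma zsum_rev a n : zsum a n = zsum (fun i => a (n - 1 - i)%nat) n.
Proof.
  revert a. induction n; intros a; auto.
  rewrite (zsum_S_l (fun i => a (S n - 1 - i)%nat)). simpl zsum at 1. rewrite IHn.
  replace (S n - 1 - 0)%nat with n by lia. rewrite Z.add_comm. f_equal. apply zsum_ext. intros k Hk. f_equal. lia.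
Qed.

Lemma zsum_triangle (f : nat -> nat -> Z) N :
  zsum (fun k => zsum (fun i => f i (k - i)%nat) (S k)) N = zsum (fun i => zsum (fun j => f i j) (N - i)%nat) N.
Proof.
  induction N; auto. cbn [zsum]. cbn [zsum] in IHN. rewrite IHN.
  rewrite (zsum_ext (fun i => zsum (fun j => f i j) (S N - i)%nat) (fun i => zsum (fun j => f i j) (N - i)%nat + f i (N - i)%nat)%Z).
  2:{ intros k Hk. replace (S N - k)%nat with (S (N - k)) by lia. reflexivity. }
  rewrite zsum_plus. replace (S N - N)%nat with 1%nat by lia. cbn [zsum]. rewrite Nat.sub_diag. ring.
Qed.

Lemma zmul_comm a b : zmul a b = zmul b a.
Proof.
  apply functional_extensionality; intros n. unfold zmul. rewrite zsum_rev. apply zsum_ext. intros k Hk.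
  replace (n - (S n - 1 - k))%nat with k by lia. replace (S n - 1 - k)%nat with (n - k)%nat by lia. ring.
Qed.

Lemma zmul_assoc a b c : zmul a (zmul b c) = zmul (zmul a b) c.
Proof.
  apply functional_extensionality; intros n. unfold zmul. symmetry.
  rewrite (zsum_ext _ (fun k => zsum (fun i => a i * b (k - i)%nat * c (n - (i + (k - i)))%nat)%Z (S k))).
  2:{ intros k Hk. rewrite Z.mul_comm, <- zsum_scal. apply zsum_ext. intros i Hi. replace (i + (k - i))%nat with k by lia. ring. }
  rewrite (zsum_triangle (fun i j => a i * b j * c (n - (i + j))%nat)%Z).
  apply zsum_ext. intros i Hi. rewrite <- zsum_scal. replace (S n - i)%nat with (S (n - i)) by lia. apply zsum_ext. intros j Hj.
  replace (n - (i + j))%nat with (n - i - j)%nat by lia. ring.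
Qed.

Lemma zmul_one_l a : zmul zone a = a.
Proof.
  apply functional_extensionality; intros n. unfold zmul. rewrite zsum_S_l, Nat.sub_0_r.
  rewrite (zsum_ext _ (fun _ => 0%Z)), zsum_zero by reflexivity. unfold zone. simpl (0 =? 0)%nat. cbv iota. ring.
Qed.

Lemma zmul_add_l a b c : zmul (zadd a b) c = zadd (zmul a c) (zmul b c).
Proof.
  apply functional_extensionality. intros n. unfold zmul, zadd. generalize (S n). intros m.
  induction m; cbn [zsum]. ring. rewrite IHm. ring.
Qed.

Lemma zmul_scal_l c a b : zmul (zscal c a) b = zscal c (zmul a b).
Proof.
  apply functional_extensionality. intros n. unfold zmul, zscal. rewrite <- zsum_scal. apply zsum_ext. intros k _. ring.
Qed.

(** * Divisor sums *)

(* [sigma n] sums the codivisors [n / d] over the divisors [d = m + 1] of [n]. *)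
Definition sigma (n : nat) : Z :=
  zsum (fun m => if (n mod S m =? 0)%nat then Z.of_nat (n / S m) else 0%Z) n.

(** Shifting the index gives G = 1 + X G for the geometric series and A = X (A + G) for the sum of n
    X^n; solving yields X / (1 - X)^2. *)
Lemma cosec2_Ev w : 0 < Im w -> Ev nC w = cosec2 w /\ pconv nC.
Proof.
  intros Hw. assert (P : pconv nC).
  { apply pconv_ext with (ctheta (fun _ => RtoC 1)). intros; unfold ctheta; ring. apply pconv_theta, pconv_cst. }
  split; auto. assert (Hx := one_minus_nz _ (cE_neq_1 w Hw)). set (X := cE w) in *.
  assert (P1 := pconv_cst 1).
  set (G := Ev (fun _ => RtoC 1) w).
  assert (S0 := summ_Ev _ w P1 Hw). assert (S1 := summ_Ev _ w P Hw).
  assert (HG : G = (1 + X * G)%C).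
  { unfold G, Ev. rewrite (Csum_shift _ S0) at 1. rewrite <- Csum_scal by auto. f_equal.
    - replace (nC 0 * w)%C with (RtoC 0) by (unfold nC; simpl; ring). rewrite cE_0. ring.
    - apply Csum_ext. intros n. rewrite !cE_nC. simpl. unfold X. ring. }
  assert (HA : Ev nC w = (X * (Ev nC w + G))%C).
  { unfold G, Ev. rewrite (Csum_shift _ S1) at 1. rewrite <- Csum_plus, <- Csum_scal by (auto using summ_plus).
    replace (nC 0 * cE (nC 0 * w))%C with (RtoC 0) by (unfold nC; simpl; ring). rewrite Cplus_0_l.
    apply Csum_ext. intros n. rewrite nC_S. replace (cE ((nC n + 1) * w)) with (cE (nC n * w) * X)%C.
    ring. unfold X. rewrite <- cE_plus. f_equal. ring. }
  assert (HG' : G = (/ (1 - X))%C). { replace G with (((1 + X * G) - X * G) / (1 - X))%C. 2:{ rewrite <- HG. field. auto. } field. auto. }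
  unfold cosec2. fold X. replace (Ev nC w) with ((X * (Ev nC w + G) - X * Ev nC w) / (1 - X))%C.
  2:{ rewrite <- HA. field. auto. }
  rewrite HG'. field. auto.
Qed.

Lemma rsum_const c n : rsum (fun _ => c) n = INR n * c.
Proof. induction n. simpl; ring. cbn [rsum]. rewrite IHn, S_INR. ring. Qed.

Lemma Series_finite (a : nat -> R) n : (forall k, (n <= k)%nat -> a k = 0) -> ex_series a /\ Series a = rsum a n.
Proof.
  intros H. assert (S : is_series a (rsum a n)).
  { apply is_series_rsum. apply is_lim_seq_ext_loc with (fun _ => rsum a n); [|apply is_lim_seq_const].
    exists n. intros k Hk. replace k with (n + (k - n))%nat by lia. rewrite rsum_add.
    rewrite (rsum_ext (fun k0 => a (n + k0)%nat) (fun _ => 0)), rsum_const by (intros; apply H; lia). ring. }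
  split. now exists (rsum a n). now apply is_series_unique.
Qed.

Lemma cinfl_nC_bound m n : Cmod (cinfl (S m) nC n) <= if (m <? n)%nat then INR n else 0.
Proof.
  unfold cinfl. destruct (Nat.eqb_spec (n mod S m) 0) as [E|E].
  - destruct (Nat.ltb_spec m n) as [L|L].
    + unfold nC. rewrite Cmod_R, Rabs_pos_eq by apply pos_INR. apply le_INR. apply Nat.Div0.div_le_upper_bound; nia.
    + rewrite Nat.mod_small in E by lia. subst n. rewrite Nat.Div0.div_0_l. unfold nC. simpl. rewrite Cmod_0. lra.
  - rewrite Cmod_0. destruct (m <? n)%nat. apply pos_INR. lra.
Qed.

Lemma sigma_csum n : csum (fun m => cinfl (S m) nC n) n = toC sigma n.
Proof.
  unfold toC, sigma. rewrite toC_zsum. apply csum_ext. intros m _. unfold cinfl.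
  destruct (n mod S m =? 0)%nat; auto. unfold nC. now rewrite INR_IZR_INZ.
Qed.

Lemma sigma_bound n : Cmod (toC sigma n) <= INR n * INR n.
Proof.
  rewrite <- sigma_csum. eapply Rle_trans; [apply rsum_le_csum|]. rewrite <- rsum_const. apply rsum_le. intros k Hk.
  eapply Rle_trans; [apply cinfl_nC_bound|]. destruct (k <? n)%nat. lra. apply pos_INR.
Qed.

Lemma pconv_sq : pconv (fun n => nC n * nC n)%C.
Proof.
  apply pconv_ext with (ctheta (ctheta (fun _ => RtoC 1))). intros; unfold ctheta; ring. apply pconv_theta, pconv_theta, pconv_cst.
Qed.

Lemma zconv_sigma : zconv sigma.
Proof.
  apply pconv_le with (2 := pconv_sq). intros n. eapply Rle_trans; [apply sigma_bound|].
  unfold nC. rewrite Cmod_mult, Cmod_R, Rabs_pos_eq by apply pos_INR. lra.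
Qed.

(** A Lambert series rearranged by powers of the nome. For fixed n the majorant vanishes from m = n
    on, since the divisor m + 1 of a positive n satisfies m < n. *)
Lemma sum_cosec2_sigma z : 0 < Im z -> sum_cosec2 z = ZE sigma z.
Proof.
  intros Hz. set (r := Cmod (cE z)). assert (Hr := cE_lt1 z Hz). fold r in Hr.
  set (D := fun n m => (cinfl (S m) nC n * cE (nC n * z))%C).
  set (u := fun n m : nat => if (m <? n)%nat then INR n * r ^ n else 0).
  assert (HD : forall n m, Cmod (D n m) <= u n m).
  { intros n m. unfold D, u. rewrite Cmod_mult, Cmod_qn. fold r. assert (B := cinfl_nC_bound m n).
    assert (0 <= r ^ n) by (apply pow_le; lra). destruct (m <? n)%nat; nra. }
  assert (Hfin : forall n, ex_series (u n) /\ Series (u n) = rsum (u n) n).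
  { intros n. apply Series_finite. intros k Hk. unfold u. destruct (Nat.ltb_spec k n); [lia|auto]. }
  assert (Hu : ex_series (fun n => Series (u n))).
  { apply ex_series_ext with (2 := pconv_sq r Hr). intros n. destruct (Hfin n) as [_ E]. rewrite E.
    rewrite (rsum_ext _ (fun _ => INR n * r ^ n)), rsum_const.
    match goal with |- ?a = ?b => change (@eq R a b) end.
    unfold nC. rewrite Cmod_mult, Cmod_R, Rabs_pos_eq by apply pos_INR. ring.
    intros k Hk. unfold u. destruct (Nat.ltb_spec k n); [auto|lia]. }
  destruct (fubini D u HD (fun n => proj1 (Hfin n)) Hu) as [F _].
  transitivity (Csum (fun m => Csum (fun n => D n m))).
  - unfold sum_cosec2. apply Csum_ext. intros m. assert (Hw := Im_nCz m z Hz). destruct (cosec2_Ev _ Hw) as [E P].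
    rewrite <- E, <- Ev_infl by (auto; lia). reflexivity.
  - rewrite F. unfold ZE, Ev. apply Csum_ext. intros n. rewrite (Csum_finite _ n).
    + rewrite <- sigma_csum, Cmult_comm, <- csum_scal. apply csum_ext. intros k _. unfold D. ring.
    + intros k Hk. unfold D. assert (B := cinfl_nC_bound k n). destruct (Nat.ltb_spec k n); [lia|].
      replace (cinfl (S k) nC n) with (RtoC 0). ring. symmetry. apply Cmod_eq_0. apply Rle_antisym; auto. apply Cmod_ge_0.
Qed.

(** * Eisenstein series *)

Definition e2 : nat -> Z := zadd zone (zscal (-24) sigma).
(* E4 = E2^2 - 12 theta E2 = 1 + 16 a4 with an integral series a4. *)
Definition a4 : nat -> Z := zadd (zscal (-3) sigma) (zadd (zscal 36 (zmul sigma sigma)) (zscal 18 (ztheta sigma))).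
Definition e4 : nat -> Z := zadd zone (zscal 16 a4).
(* Proportional to the second Rankin-Cohen bracket of E4 with itself; the odd leading term 15 x makes it Delta mod 2. *)
Definition dlt : nat -> Z :=
  zadd (zmul (ztheta (ztheta a4)) e4) (zscal (-20) (zmul (ztheta a4) (ztheta a4))).

Lemma zconv_e2 : zconv e2.
Proof. apply zconv_add. apply zconv_one. apply zconv_scal, zconv_sigma. Qed.
Lemma zconv_a4 : zconv a4.
Proof.
  apply zconv_add; [apply zconv_scal, zconv_sigma|]. apply zconv_add; apply zconv_scal.
  apply zconv_mul; apply zconv_sigma. apply zconv_theta, zconv_sigma.
Qed.
Lemma zconv_e4 : zconv e4.
Proof. apply zconv_add. apply zconv_one. apply zconv_scal, zconv_a4. Qed.
Lemma zconv_dlt : zconv dlt.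
Proof.
  apply zconv_add; [|apply zconv_scal]; apply zconv_mul; repeat apply zconv_theta; auto using zconv_a4, zconv_e4.
Qed.

Lemma ZE_e2 z : 0 < Im z -> ZE e2 z = (1 - 24 * sum_cosec2 z)%C.
Proof.
  intros Hz. unfold e2. rewrite ZE_add, ZE_scal, ZE_one, <- sum_cosec2_sigma by (auto using zconv_one, zconv_scal, zconv_sigma).
  replace (RtoC (-24)) with (- RtoC 24)%C by (apply C_eq; simpl; ring). ring.
Qed.

(** The value -1/24 of [zeta2] is what matches the constant term 1 of E2: multiplied by -24, the
    [zeta2] part of the inversion is absorbed by it. *)
Lemma E2_S z : 0 < Im z -> ZE e2 (- / z) = (z ^ 2 * ZE e2 z + 12 / c2pi * z)%C.
Proof.
  intros Hz. assert (Hz' := Im_neg_inv z Hz). rewrite !ZE_e2 by auto. rewrite (sum_cosec2_inversion z Hz), zeta2_value.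
  assert (Hn := Im_pos_nz z Hz). field. auto using c2pi_nz.
Qed.

(** Differentiates a transformation law: theta is d/dz divided by c2pi, and -1/z has derivative
    1/z^2. Uniqueness of the derivative compares the two sides. *)
Lemma theta_S a z (g : C -> C) l : zconv a -> 0 < Im z ->
  (forall w, 0 < Im w -> ZE a (- / w) = g w) -> J2 g z l ->
  ZE (ztheta a) (- / z) = (z ^ 2 * l / c2pi)%C.
Proof.
  intros Ha Hz H Hg. assert (Hz' := Im_neg_inv z Hz). assert (Hn := Im_pos_nz z Hz).
  assert (J := J2_comp (ZE a) (fun w => - / w)%C z _ _ (J2_ZE a _ Ha Hz') (J2_neg_inv z Hz)).
  apply (J2_ext_H _ g z _ H Hz) in J. assert (E := J2_unique _ _ _ _ J Hg). rewrite <- E. field. auto using c2pi_nz.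
Qed.

Lemma J2_pow F z l n : J2 F z l -> J2 (fun w => F w ^ S n)%C z (nC (S n) * F z ^ n * l)%C.
Proof.
  intros H. induction n.
  - apply J2_eq with (l * 1 + F z * 0)%C. apply (J2_mult F (fun _ => RtoC 1)); auto. apply J2_const.
    unfold nC. simpl. ring.
  - apply J2_eq with (l * F z ^ S n + F z * (nC (S n) * F z ^ n * l))%C.
    apply (J2_mult F (fun w => F w ^ S n)%C); auto.
    rewrite (nC_S (S n)). simpl. ring.
Qed.

Lemma J2_powz z n : J2 (fun w => w ^ S n)%C z (nC (S n) * z ^ n)%C.
Proof. apply J2_eq with (nC (S n) * z ^ n * 1)%C. apply (J2_pow (fun w => w)). apply J2_id. ring. Qed.

Lemma ZE_e4 z : 0 < Im z -> ZE e4 z = (ZE e2 z ^ 2 - 12 * ZE (ztheta e2) z)%C.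
Proof.
  intros Hz.
  assert (E1 : ztheta e2 = zscal (-24) (ztheta sigma)).
  { apply functional_extensionality. intros n. unfold ztheta, e2, zadd, zscal, zone. destruct (Nat.eqb_spec n 0); [subst; reflexivity|ring]. }
  rewrite E1. unfold e4, e2, a4.
  repeat (rewrite ?ZE_add, ?ZE_scal, ?ZE_mul by (zconv_tac; auto using zconv_sigma, zconv_a4, zconv_e4)).
  rewrite ZE_one. set (s := ZE sigma z). set (t := ZE (ztheta sigma) z).
  replace (RtoC (-24)) with (- RtoC 24)%C by (apply C_eq; simpl; ring).
  replace (RtoC (-3)) with (- RtoC 3)%C by (apply C_eq; simpl; ring). ring.
Qed.

(** The inversion adds 24 z^3 E2 / c2pi + 144 z^2 / c2pi^2 to z^4 E2^2, and exactly the same to 12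
    z^4 theta E2. *)
Lemma E4_S z : 0 < Im z -> ZE e4 (- / z) = (z ^ 4 * ZE e4 z)%C.
Proof.
  intros Hz. assert (Hz' := Im_neg_inv z Hz). assert (Hn := Im_pos_nz z Hz).
  rewrite !ZE_e4 by auto. rewrite E2_S by auto.
  rewrite (theta_S e2 z (fun w => w ^ 2 * ZE e2 w + 12 / c2pi * w)%C (((nC 2 * z ^ 1) * ZE e2 z + z ^ 2 * (c2pi * ZE (ztheta e2) z)) + 12 / c2pi * 1)%C); auto using zconv_e2, E2_S.
  - replace (nC 2) with (RtoC 2) by (unfold nC; simpl; f_equal; ring). field. auto using c2pi_nz.
  - apply J2_plus. apply (J2_mult (fun w => w ^ 2)%C). apply J2_powz. apply J2_ZE; auto using zconv_e2. apply J2_scal, J2_id.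
Qed.

Lemma E4_theta_S z : 0 < Im z -> ZE (ztheta e4) (- / z) = (z ^ 6 * ZE (ztheta e4) z + 4 / c2pi * (z ^ 5 * ZE e4 z))%C.
Proof.
  intros Hz. assert (Hn := Im_pos_nz z Hz).
  rewrite (theta_S e4 z (fun w => w ^ 4 * ZE e4 w)%C ((nC 4 * z ^ 3) * ZE e4 z + z ^ 4 * (c2pi * ZE (ztheta e4) z))%C); auto using zconv_e4, E4_S.
  - replace (nC 4) with (RtoC 4) by (unfold nC; simpl; f_equal; ring). field. auto using c2pi_nz.
  - apply (J2_mult (fun w => w ^ 4)%C). apply J2_powz. apply J2_ZE; auto using zconv_e4.
Qed.

Lemma E4_theta2_S z : 0 < Im z -> ZE (ztheta (ztheta e4)) (- / z) =
  (z ^ 8 * ZE (ztheta (ztheta e4)) z + 10 / c2pi * (z ^ 7 * ZE (ztheta e4) z) + 20 / c2pi ^ 2 * (z ^ 6 * ZE e4 z))%C.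
Proof.
  intros Hz. assert (Hn := Im_pos_nz z Hz).
  rewrite (theta_S (ztheta e4) z (fun w => w ^ 6 * ZE (ztheta e4) w + 4 / c2pi * (w ^ 5 * ZE e4 w))%C
    (((nC 6 * z ^ 5) * ZE (ztheta e4) z + z ^ 6 * (c2pi * ZE (ztheta (ztheta e4)) z)) + 4 / c2pi * ((nC 5 * z ^ 4) * ZE e4 z + z ^ 5 * (c2pi * ZE (ztheta e4) z)))%C); auto using zconv_theta, zconv_e4, E4_theta_S.
  - replace (nC 6) with (RtoC 6) by (unfold nC; simpl; f_equal; ring). replace (nC 5) with (RtoC 5) by (unfold nC; simpl; f_equal; ring).
    field. auto using c2pi_nz.
  - apply J2_plus. apply (J2_mult (fun w => w ^ 6)%C). apply J2_powz. apply J2_ZE; auto using zconv_theta, zconv_e4.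
    apply J2_scal. apply (J2_mult (fun w => w ^ 5)%C). apply J2_powz. apply J2_ZE; auto using zconv_e4.
Qed.

Lemma ztheta_e4 : ztheta e4 = zscal 16 (ztheta a4).
Proof.
  apply functional_extensionality. intros n. unfold ztheta, e4, zadd, zscal, zone. destruct (Nat.eqb_spec n 0); [subst; reflexivity|ring].
Qed.
Lemma ztheta_zscal c a : ztheta (zscal c a) = zscal c (ztheta a).
Proof. apply functional_extensionality. intros n. unfold ztheta, zscal. ring. Qed.

(** 4 f f'' - 5 f'^2 is the second bracket of a form f of weight 4 with itself, in which all
    corrections in 1 / c2pi cancel. Since theta e4 = 16 theta a4, the factor 64 comes out and -5 *
    256 becomes 64 * (-20). *)
Lemma ZE_dlt z : 0 < Im z ->
  (64 * ZE dlt z = 4 * ZE e4 z * ZE (ztheta (ztheta e4)) z - 5 * ZE (ztheta e4) z ^ 2)%C.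
Proof.
  intros Hz. rewrite ztheta_e4, ztheta_zscal. unfold dlt.
  repeat (rewrite ?ZE_add, ?ZE_scal, ?ZE_mul by (zconv_tac; auto using zconv_sigma, zconv_a4, zconv_e4)).
  replace (RtoC (-20)) with (- RtoC 20)%C by (apply C_eq; simpl; ring). ring.
Qed.

Lemma dlt_S z : 0 < Im z -> ZE dlt (- / z) = (z ^ 12 * ZE dlt z)%C.
Proof.
  intros Hz. assert (Hz' := Im_neg_inv z Hz).
  assert (E : (64 * ZE dlt (- / z) = 64 * (z ^ 12 * ZE dlt z))%C).
  { rewrite ZE_dlt by auto. replace (64 * (z ^ 12 * ZE dlt z))%C with (z ^ 12 * (64 * ZE dlt z))%C by ring. rewrite ZE_dlt by auto.
    rewrite E4_S, E4_theta_S, E4_theta2_S by auto. field. apply c2pi_nz. }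
  replace (ZE dlt (- / z)) with (/ 64 * (64 * ZE dlt (- / z)))%C by field. rewrite E. field.
Qed.

(** * The nonvanishing form of weight 12 *)

(** The expansion of the logarithm of the product of all (1 - x^n)^24. *)
Definition log_Del_coef : nat -> C := fun n => match n with O => RtoC 0 | S _ => (- (24) * toC sigma n / nC n)%C end.
Definition log_Del (z : C) : C := (c2pi * z + Ev log_Del_coef z)%C.
(* The product x prod (1 - x^n)^24: [dlt] has visibly integral coefficients, [Del] visibly no zeros; that they are proportional is not needed. *)
Definition Del (z : C) : C := cexp (log_Del z).

Lemma pconv_log_Del_coef : pconv log_Del_coef.
Proof.
  apply pconv_le with (2 := pconv_scal (RtoC 24) _ zconv_sigma). intros [|n]; unfold cscal.
  - simpl. rewrite Cmod_0. apply Cmod_ge_0.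
  - unfold log_Del_coef. rewrite Cmod_div, !Cmod_mult, Cmod_opp by apply nC_nz. unfold nC. rewrite (Cmod_R (INR (S n))), Rabs_pos_eq by apply pos_INR.
    rewrite S_INR. assert (H := pos_INR n). assert (H0 : 0 <= Cmod 24 * Cmod (toC sigma (S n))) by (apply Rmult_le_pos; apply Cmod_ge_0).
    apply Rmult_le_reg_r with (INR n + 1). lra. unfold Rdiv. rewrite Rmult_assoc, Rinv_l by lra. nra.
Qed.

Lemma theta_log_Del_coef z : 0 < Im z -> Ev (ctheta log_Del_coef) z = (ZE e2 z - 1)%C.
Proof.
  intros Hz. unfold e2. rewrite ZE_add, ZE_scal, ZE_one by (auto using zconv_one, zconv_scal, zconv_sigma).
  rewrite (Ev_ext _ (cscal (RtoC (-24)) (toC sigma))).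
  rewrite (Ev_scal _ _ z zconv_sigma Hz). fold (ZE sigma z). ring.
  intros [|n]; unfold ctheta, cscal, log_Del_coef.
  - unfold toC, sigma, nC. simpl. ring.
  - replace (RtoC (-24)) with (- RtoC 24)%C by (apply C_eq; simpl; ring). field. apply nC_nz.
Qed.

Lemma J2_log_Del z : 0 < Im z -> J2 log_Del z (c2pi * ZE e2 z)%C.
Proof.
  intros Hz. apply J2_eq with (c2pi * 1 + c2pi * Ev (ctheta log_Del_coef) z)%C.
  apply J2_plus. apply J2_scal, J2_id. apply J2_Ev; auto using pconv_log_Del_coef.
  rewrite theta_log_Del_coef by auto. ring.
Qed.

Lemma log_Del_T z : log_Del (z + 1) = (log_Del z + c2pi)%C.
Proof. unfold log_Del. rewrite Ev_per. ring. Qed.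

Lemma cexp_c2pi : cexp c2pi = 1.
Proof. replace c2pi with (c2pi * 1)%C by ring. rewrite <- cE_c2pi. apply cE_1. Qed.

Lemma Del_T z : Del (z + 1) = Del z.
Proof. unfold Del. rewrite log_Del_T, cexp_plus, cexp_c2pi. ring. Qed.

Lemma Del_nz z : Del z <> 0. Proof. apply cexp_nz. Qed.

Lemma cexp_opp u : cexp (- u) = (/ cexp u)%C.
Proof.
  assert (H : (cexp u * cexp (- u) = 1)%C) by (rewrite <- cexp_plus; replace (u + - u)%C with (RtoC 0) by ring; apply cexp_0).
  assert (Hn := cexp_nz u). replace (cexp (- u))%C with (/ cexp u * (cexp u * cexp (- u)))%C by (field; auto). rewrite H. ring.
Qed.

Lemma Im_Ci : 0 < Im Ci. Proof. simpl. lra. Qed.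

(** The logarithmic derivative of [Del] is c2pi E2, so by [E2_S] the quotient of the two sides has
    derivative 0 and is constant. At the fixed point i it is i^12 = 1. *)
Lemma Del_S z : 0 < Im z -> Del (- / z) = (z ^ 12 * Del z)%C.
Proof.
  intros Hz. set (Q := fun w => (cexp (log_Del (- / w) + - (1) * log_Del w) * (- / w) ^ 12)%C).
  assert (HQ : forall w, 0 < Im w -> J2 Q w 0).
  { intros w Hw. assert (Hw' := Im_neg_inv w Hw). assert (Hn := Im_pos_nz w Hw).
    eapply J2_eq.
    - apply (J2_mult (fun w => cexp (log_Del (- / w) + - (1) * log_Del w))%C (fun w => (- / w) ^ 12)%C).
      + apply (J2_comp cexp (fun w => log_Del (- / w) + - (1) * log_Del w)%C). apply J2_cexp.
        apply J2_plus. apply (J2_comp log_Del (fun w => - / w)%C). apply J2_log_Del; auto. apply J2_neg_inv; auto.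
        apply J2_scal. apply J2_log_Del; auto.
      + apply (J2_pow (fun w => - / w)%C). apply J2_neg_inv; auto.
    - cbv beta. rewrite E2_S by auto. replace (nC 12) with (RtoC 12) by (unfold nC; simpl; f_equal; ring).
      field. auto using c2pi_nz. }
  assert (E := J2_zero_const Q HQ z Ci Hz Im_Ci). unfold Q in E.
  replace (- / Ci)%C with Ci in E by (rewrite Ci_inv; ring).
  replace (log_Del Ci + - (1) * log_Del Ci)%C with (RtoC 0) in E by ring.
  rewrite cexp_0 in E. replace (1 * Ci ^ 12)%C with (RtoC 1) in E.
  2:{ replace (Ci ^ 12)%C with ((Ci * Ci) ^ 6)%C by ring. replace (Ci * Ci)%C with (- RtoC 1)%C by (apply C_eq; simpl; ring). ring. }
  assert (Hn := Im_pos_nz z Hz).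
  rewrite cexp_plus in E. replace (- (1) * log_Del z)%C with (- log_Del z)%C in E by ring. rewrite cexp_opp in E.
  fold (Del z) in E. fold (Del (- / z)) in E. assert (Hd := Del_nz z).
  replace (Del (- / z)) with ((Del (- / z) * / Del z * (- / z) ^ 12) * (z ^ 12 * Del z))%C by (field; auto).
  rewrite E. ring.
Qed.

(** * SL2(Z) *)

(** Generation by S and T through Euclid's algorithm on the first column: a power of T reduces a
    modulo c, and S exchanges the rows, lowering |c|. As the induction only knows S, its inverse is
    obtained as S^3. *)
Lemma sl2_ind (P : Z -> Z -> Z -> Z -> Prop) :
  P 1%Z 0%Z 0%Z 1%Z ->
  (forall a b c d, (a * d - b * c = 1)%Z -> P a b c d -> P (a + c)%Z (b + d)%Z c d) ->
  (forall a b c d, (a * d - b * c = 1)%Z -> P a b c d -> P (a - c)%Z (b - d)%Z c d) ->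
  (forall a b c d, (a * d - b * c = 1)%Z -> P a b c d -> P (- c)%Z (- d)%Z a b) ->
  forall a b c d, (a * d - b * c = 1)%Z -> P a b c d.
Proof.
  intros H1 HT HT' HS.
  assert (HTn : forall n a b c d, (a * d - b * c = 1)%Z -> P a b c d -> P (a + n * c)%Z (b + n * d)%Z c d).
  { intros n. pattern n. apply Z.bi_induction.
    - intros x y ->. reflexivity.
    - intros a b c d Hd H. replace (a + 0 * c)%Z with a by ring. replace (b + 0 * d)%Z with b by ring. exact H.
    - intros m. split; intros IH a b c d Hd H.
      + replace (a + Z.succ m * c)%Z with ((a + m * c) + c)%Z by ring. replace (b + Z.succ m * d)%Z with ((b + m * d) + d)%Z by ring.
        apply HT. lia. now apply IH.
      + replace (a + m * c)%Z with ((a + Z.succ m * c) - c)%Z by ring. replace (b + m * d)%Z with ((b + Z.succ m * d) - d)%Z by ring.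
        apply HT'. lia. now apply IH. }
  assert (Hn : forall n a b c d, (Z.abs c <= Z.of_nat n)%Z -> (a * d - b * c = 1)%Z -> P a b c d).
  { induction n; intros a b c d Hc Hd.
    - assert (c = 0%Z) by lia. subst c. assert (Had : (a * d = 1)%Z) by lia.
      apply Z.mul_eq_1 in Had as Ha. destruct Ha as [-> | ->].
      + assert (d = 1%Z) by lia. subst d. assert (X := (HTn b 1 0 0 1 eq_refl H1)%Z).
        replace (1 + b * 0)%Z with 1%Z in X by ring. replace (0 + b * 1)%Z with b in X by ring. exact X.
      + assert (d = (-1)%Z) by lia. subst d.
        assert (X := (HTn (- b) (-1) 0 0 (-1) eq_refl (HS 0 (-1) 1 0 eq_refl (HS 1 0 0 1 eq_refl H1)))%Z).
        replace (-1 + - b * 0)%Z with (-1)%Z in X by ring. replace (0 + - b * -1)%Z with b in X by ring. exact X.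
    - destruct (Z.eq_dec c 0) as [->|Hc0]. apply IHn; auto; lia.
      set (q := (a / c)%Z). set (r := (a - q * c)%Z).
      assert (Hr : (Z.abs r < Z.abs c)%Z). { unfold r, q. assert (E := Z.div_mod a c Hc0).
        replace (a - a / c * c)%Z with (a mod c)%Z by lia. apply Z.mod_bound_abs. auto. }
      assert (H0 : P (- c)%Z (- d)%Z r (b - q * d)%Z) by (apply IHn; [lia|unfold r; lia]).
      assert (E1 : (- c * (b - q * d) - - d * r = 1)%Z) by (unfold r; lia).
      assert (H2 := HS _ _ _ _ E1 H0). assert (E2 : (- r * - d - - (b - q * d) * - c = 1)%Z) by (unfold r; lia).
      assert (H3 := HS _ _ _ _ E2 H2). assert (E3 : (- - c * - (b - q * d) - - - d * - r = 1)%Z) by (unfold r; lia).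
      assert (H4 := HS _ _ _ _ E3 H3).
      replace (- - r)%Z with r in H4 by ring. replace (- - (b - q * d))%Z with (b - q * d)%Z in H4 by ring.
      replace (- - c)%Z with c in H4 by ring. replace (- - d)%Z with d in H4 by ring.
      replace a with (r + q * c)%Z by (unfold r; ring). replace b with ((b - q * d) + q * d)%Z by ring.
      apply HTn; auto. unfold r. lia. }
  intros a b c d. apply (Hn (Z.abs_nat c)). lia.
Qed.

Definition zC (n : Z) : C := RtoC (IZR n).
Lemma zC_plus m n : zC (m + n) = (zC m + zC n)%C. Proof. unfold zC. now rewrite plus_IZR, RtoC_plus. Qed.
Lemma zC_minus m n : zC (m - n) = (zC m - zC n)%C. Proof. unfold zC. now rewrite minus_IZR, RtoC_minus. Qed.
Lemma zC_mult m n : zC (m * n) = (zC m * zC n)%C. Proof. unfold zC. now rewrite mult_IZR, RtoC_mult. Qed.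
Lemma zC_opp m : zC (- m) = (- zC m)%C. Proof. unfold zC. now rewrite opp_IZR, RtoC_opp. Qed.

Lemma automy_eq a b c d z : automy a b c d z = (zC c * z + zC d)%C. Proof. reflexivity. Qed.
Lemma moeb_eq a b c d z : moeb a b c d z = ((zC a * z + zC b) / (zC c * z + zC d))%C. Proof. reflexivity. Qed.

Lemma automy_nz a b c d z : (a * d - b * c = 1)%Z -> 0 < Im z -> (zC c * z + zC d <> 0)%C.
Proof.
  intros Hd Hz E. assert (E1 := f_equal Im E). assert (E2 := f_equal Re E). unfold zC in *.
  rewrite Im_plus, im_scal_l, im_RtoC in E1. rewrite Re_plus, re_scal_l, re_RtoC in E2. change (Im 0) with 0 in E1. change (Re 0) with 0 in E2.
  assert (Hc : IZR c = 0) by nra. rewrite Hc in E2. assert (Hdd : IZR d = 0) by lra.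
  apply eq_IZR in Hc. apply eq_IZR in Hdd. subst. lia.
Qed.

Lemma Im_moeb a b c d z : (a * d - b * c = 1)%Z -> 0 < Im z ->
  Im (moeb a b c d z) = Im z / Cmod (zC c * z + zC d) ^ 2.
Proof.
  intros Hd Hz. assert (Hn := automy_nz a b c d z Hd Hz). rewrite moeb_eq.
  set (v := (zC c * z + zC d)%C) in *. assert (Hv : 0 < Cmod v) by (now apply Cmod_gt_0).
  assert (E : ((zC a * z + zC b) / v = RtoC (/ Cmod v ^ 2) * ((zC a * z + zC b) * Cconj v))%C).
  { rewrite RtoC_inv by (apply pow_nonzero; lra). rewrite Cmod2_conj.
    assert (Hcv : Cconj v <> 0). { apply Cmod_gt_0. now rewrite Cmod_conj. } field. auto. }
  rewrite E, im_scal_l. unfold Rdiv. rewrite Rmult_comm. f_equal.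
  unfold v, zC. destruct z as [x y]. simpl. unfold Im, Re; simpl.
  assert (E2 : IZR a * IZR d - IZR b * IZR c = 1). { rewrite <- !mult_IZR, <- minus_IZR, Hd. reflexivity. }
  transitivity (y * (IZR a * IZR d - IZR b * IZR c)); [ring|rewrite E2; ring].
Qed.

Lemma Im_moeb_pos a b c d z : (a * d - b * c = 1)%Z -> 0 < Im z -> 0 < Im (moeb a b c d z).
Proof.
  intros Hd Hz. rewrite Im_moeb by auto. apply Rdiv_lt_0_compat; auto. apply pow_lt. apply Cmod_gt_0. now apply (automy_nz a b).
Qed.

Lemma moeb_T a b c d z : (a * d - b * c = 1)%Z -> 0 < Im z -> moeb (a + c) (b + d) c d z = (moeb a b c d z + 1)%C.
Proof. intros Hd Hz. rewrite !moeb_eq, !zC_plus. field. now apply (automy_nz a b). Qed.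
Lemma moeb_S a b c d z : (a * d - b * c = 1)%Z -> 0 < Im z -> moeb (- c) (- d) a b z = (- / moeb a b c d z)%C.
Proof.
  intros Hd Hz. rewrite !moeb_eq, !zC_opp. field. split. now apply (automy_nz a b).
  apply (automy_nz (- c) (- d)); auto. lia.
Qed.

Lemma sl2_law (F : C -> C) k :
  (forall z, 0 < Im z -> F (z + 1)%C = F z) ->
  (forall z, 0 < Im z -> F (- / z)%C = (z ^ k * F z)%C) ->
  forall a b c d, (a * d - b * c = 1)%Z -> forall z, 0 < Im z ->
  F (moeb a b c d z) = ((zC c * z + zC d) ^ k * F z)%C.
Proof.
  intros HT HS.
  apply (sl2_ind (fun a b c d => forall z, 0 < Im z -> F (moeb a b c d z) = ((zC c * z + zC d) ^ k * F z)%C)).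
  - intros z Hz. rewrite moeb_eq. unfold zC. replace ((1 * z + 0) / (0 * z + 1))%C with z by (field; apply C1_nz).
    replace (0 * z + 1)%C with (RtoC 1) by ring. rewrite Cpow_1_l. ring.
  - intros a b c d Hd H z Hz. rewrite moeb_T, HT by (auto using Im_moeb_pos). auto.
  - intros a b c d Hd H z Hz. assert (E := moeb_T (a - c) (b - d) c d z ltac:(lia) Hz).
    replace (a - c + c)%Z with a in E by ring. replace (b - d + d)%Z with b in E by ring.
    rewrite <- H by auto. rewrite E, HT; auto. apply Im_moeb_pos; auto. lia.
  - intros a b c d Hd H z Hz. rewrite moeb_S, HS, H by (auto using Im_moeb_pos).
    rewrite Cmult_assoc, <- Cpow_mult_l. f_equal. f_equal. rewrite moeb_eq. field. now apply (automy_nz a b).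
Qed.

Lemma E2_law a b c d z : (a * d - b * c = 1)%Z -> 0 < Im z ->
  ZE e2 (moeb a b c d z) = ((zC c * z + zC d) ^ 2 * ZE e2 z + 12 / c2pi * (zC c * (zC c * z + zC d)))%C.
Proof.
  intros Hd Hz. revert a b c d Hd z Hz.
  apply (sl2_ind (fun a b c d => forall z, 0 < Im z -> ZE e2 (moeb a b c d z) = ((zC c * z + zC d) ^ 2 * ZE e2 z + 12 / c2pi * (zC c * (zC c * z + zC d)))%C)).
  - intros z Hz. rewrite moeb_eq. unfold zC. replace ((1 * z + 0) / (0 * z + 1))%C with z by (field; apply C1_nz). ring.
  - intros a b c d Hd H z Hz. rewrite moeb_T, ZE_per by auto. auto.
  - intros a b c d Hd H z Hz. assert (E := moeb_T (a - c) (b - d) c d z ltac:(lia) Hz).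
    replace (a - c + c)%Z with a in E by ring. replace (b - d + d)%Z with b in E by ring.
    rewrite <- H by auto. rewrite E, ZE_per; auto.
  - intros a b c d Hd H z Hz. rewrite moeb_S, E2_S, H by (auto using Im_moeb_pos).
    rewrite moeb_eq. assert (N := automy_nz a b c d z Hd Hz).
    assert (E : (zC a * zC d - zC b * zC c = 1)%C) by (rewrite <- !zC_mult, <- zC_minus, Hd; reflexivity).
    set (u := (zC a * z + zC b)%C). set (v := (zC c * z + zC d)%C) in *.
    (* The determinant relation merges the correction carried along with the one created by S into
       the correction belonging to the new lower row (a, b). *)
    assert (K : (zC c * u + 1 = zC a * v)%C) by (unfold u, v; rewrite <- E; ring).
    replace ((u / v) ^ 2 * (v ^ 2 * ZE e2 z + 12 / c2pi * (zC c * v)) + 12 / c2pi * (u / v))%C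
      with (u ^ 2 * ZE e2 z + 12 / c2pi * (u * (zC c * u + 1) / v))%C by (field; auto using c2pi_nz).
    rewrite K. field. auto using c2pi_nz.
Qed.

(** * Modular forms for Gamma_0(5) with integral expansions *)

(* Boundedness is only required at the cusp 0, represented by S; at infinity it follows from the expansion. *)
Definition MF (k : nat) (a : nat -> Z) : Prop :=
  zconv a /\
  (forall p q c d, (p * d - q * c = 1)%Z -> (5 | c)%Z -> forall z, 0 < Im z ->
     ZE a (moeb p q c d z) = ((zC c * z + zC d) ^ k * ZE a z)%C) /\
  (exists B Y, forall z, Y < Im z -> 0 < Im z -> Cmod (ZE a (- / z)) <= B * Cmod z ^ k).

Lemma MF_add k a b : MF k a -> MF k b -> MF k (zadd a b).
Proof.
  intros [A1 [A2 [B [Y A3]]]] [A1' [A2' [B' [Y' A3']]]]. split; [|split].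
  - now apply zconv_add.
  - intros p q c d Hd Hc z Hz. rewrite !ZE_add, (A2 p q), (A2' p q) by (auto using Im_moeb_pos). ring.
  - exists (B + B'), (Rmax Y Y'). intros z HY Hz.
    assert (H1 : Y < Im z) by (eapply Rle_lt_trans; [apply Rmax_l|apply HY]). assert (H2 : Y' < Im z) by (eapply Rle_lt_trans; [apply Rmax_r|apply HY]).
    rewrite ZE_add by (auto using Im_neg_inv). eapply Rle_trans; [apply Cmod_triangle|].
    specialize (A3 z H1 Hz). specialize (A3' z H2 Hz). lra.
Qed.

Lemma MF_scal k c a : MF k a -> MF k (zscal c a).
Proof.
  intros [A1 [A2 [B [Y A3]]]]. split; [|split].
  - now apply zconv_scal.
  - intros p q c' d Hd Hc z Hz. rewrite !ZE_scal, (A2 p q) by (auto using Im_moeb_pos). ring.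
  - exists (Rabs (IZR c) * B), Y. intros z HY Hz. rewrite ZE_scal by (auto using Im_neg_inv). rewrite Cmod_mult, Cmod_R.
    specialize (A3 z HY Hz). rewrite Rmult_assoc. apply Rmult_le_compat_l; auto. apply Rabs_pos.
Qed.

Lemma MF_mul k l a b : MF k a -> MF l b -> MF (k + l) (zmul a b).
Proof.
  intros [A1 [A2 [B [Y A3]]]] [A1' [A2' [B' [Y' A3']]]]. split; [|split].
  - now apply zconv_mul.
  - intros p q c d Hd Hc z Hz. rewrite !ZE_mul, (A2 p q), (A2' p q), Cpow_add_r by (auto using Im_moeb_pos). ring.
  - exists (B * B'), (Rmax Y Y'). intros z HY Hz.
    assert (H1 : Y < Im z) by (eapply Rle_lt_trans; [apply Rmax_l|apply HY]). assert (H2 : Y' < Im z) by (eapply Rle_lt_trans; [apply Rmax_r|apply HY]).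
    rewrite ZE_mul by (auto using Im_neg_inv). rewrite Cmod_mult, pow_add.
    specialize (A3 z H1 Hz). specialize (A3' z H2 Hz).
    replace (B * B' * (Cmod z ^ k * Cmod z ^ l)) with ((B * Cmod z ^ k) * (B' * Cmod z ^ l)) by ring.
    apply Rmult_le_compat; auto; apply Cmod_ge_0.
Qed.

Lemma MF_one : MF 0 zone.
Proof.
  split; [|split]. apply zconv_one. intros. rewrite !ZE_one. simpl. ring.
  exists 1, 0. intros. rewrite ZE_one, Cmod_1. simpl. lra.
Qed.

Lemma MF_pow k a n : MF k a -> MF (n * k) (zpow a n).
Proof. intros H. induction n; simpl. apply MF_one. now apply MF_mul. Qed.

(** Serves to divide a combination of Eisenstein series by the common factor of its coefficients,
    the quotient being given as an integral series from the start. *)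
Lemma MF_unscal k c a : c <> 0%Z -> MF k (zscal c a) -> MF k a.
Proof.
  intros Hc [A1 [A2 [B [Y A3]]]]. assert (Hc' : IZR c <> 0) by (intros E; apply Hc; now apply eq_IZR).
  assert (HcC : RtoC (IZR c) <> RtoC 0) by (intros E; apply RtoC_inj in E; auto).
  assert (Za : zconv a).
  { apply pconv_ext with (cscal (/ RtoC (IZR c)) (toC (zscal c a))). intros n. unfold cscal, toC, zscal. rewrite mult_IZR, RtoC_mult. field. auto.
    now apply pconv_scal. }
  assert (E : forall z, 0 < Im z -> ZE a z = (/ RtoC (IZR c) * ZE (zscal c a) z)%C).
  { intros z Hz. rewrite ZE_scal by auto. field. auto. }
  split; [|split]; auto.
  - intros p q c' d Hd H5 z Hz. rewrite !E, (A2 p q) by (auto using Im_moeb_pos). ring.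
  - exists (/ Rabs (IZR c) * B), Y. intros z HY Hz. rewrite E by (auto using Im_neg_inv). rewrite Cmod_mult, Cmod_inv, Cmod_R by auto.
    rewrite Rmult_assoc. apply Rmult_le_compat_l; auto. left. apply Rinv_0_lt_compat. now apply Rabs_pos_lt.
Qed.

Lemma MF_ext k a b : (forall n, a n = b n) -> MF k a -> MF k b.
Proof. intros H Ha. replace b with a; auto. now apply functional_extensionality. Qed.

Lemma MF_level1 k a : zconv a -> (forall z, 0 < Im z -> ZE a (- / z) = (z ^ k * ZE a z)%C) -> MF k a.
Proof.
  intros Ha HS. split; [|split]; auto.
  - intros p q c d Hd _. apply sl2_law; auto. intros; apply ZE_per.
  - destruct (Ev_bounded (toC a) 1 Ha ltac:(lra)) as [K [HK H]]. exists K, 1. intros z HY Hz. rewrite HS by auto.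
    rewrite Cmod_mult, Cmod_pow. rewrite Rmult_comm. apply Rmult_le_compat_r. apply pow_le, Cmod_ge_0. apply H. lra.
Qed.

(** Conjugation by diag(5, 1) carries Gamma_0(5) into SL2(Z) and preserves the automorphy factor. *)
Lemma moeb_5 p q c d z : (p * d - q * (5 * c) = 1)%Z -> 0 < Im z ->
  (nC 5 * moeb p q (5 * c) d z)%C = moeb p (5 * q) c d (nC 5 * z) /\ (zC (5 * c) * z + zC d = zC c * (nC 5 * z) + zC d)%C.
Proof.
  intros Hd Hz. assert (E5 : nC 5 = RtoC 5) by (unfold nC; simpl; f_equal; ring).
  assert (E : (zC (5 * c) = zC c * nC 5)%C). { rewrite zC_mult. rewrite E5. unfold zC at 1. ring. }
  rewrite !moeb_eq. assert (N := automy_nz p q (5 * c) d z Hd Hz). rewrite E in N |- *. split; [|ring].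
  replace (zC (5 * q)) with (nC 5 * zC q)%C by (rewrite zC_mult, E5; reflexivity). field.
  replace (zC c * (nC 5 * z) + zC d)%C with (zC c * nC 5 * z + zC d)%C by ring. auto.
Qed.

Lemma five_inv z : 0 < Im z -> (nC 5 * (- / z) = - / (z / nC 5))%C /\ 0 < Im (z / nC 5).
Proof.
  intros Hz. assert (Hn := Im_pos_nz z Hz). split. field. split; auto using nC_nz.
  replace (z / nC 5)%C with (RtoC (/ 5) * z)%C. rewrite im_scal_l. lra.
  unfold Cdiv. rewrite Cmult_comm. f_equal. unfold nC. rewrite RtoC_inv by lra. f_equal. simpl. f_equal. ring.
Qed.

Lemma MF_level1_5 k a : zconv a -> (forall z, 0 < Im z -> ZE a (- / z) = (z ^ k * ZE a z)%C) -> MF k (zinfl 5 a).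
Proof.
  intros Ha HS. split; [|split].
  - apply zconv_infl; auto. lia.
  - intros p q c d Hd [c' ->] z Hz. replace (c' * 5)%Z with (5 * c')%Z in * by ring.
    destruct (moeb_5 p q c' d z Hd Hz) as [E1 E2]. rewrite !ZE_infl by (auto using Im_moeb_pos; lia).
    rewrite E1, E2. apply sl2_law; auto. intros; apply ZE_per. lia. now apply Im_nCz.
  - destruct (Ev_bounded (toC a) (1 / 5) Ha ltac:(lra)) as [K [HK H]]. exists K, 1. intros z HY Hz.
    destruct (five_inv z Hz) as [E H5]. rewrite ZE_infl by (auto using Im_neg_inv; lia). rewrite E, HS by auto.
    rewrite Cmod_mult, Cmod_pow, Rmult_comm. apply Rmult_le_compat.
    + apply Cmod_ge_0.
    + apply pow_le, Cmod_ge_0.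
    + apply H. replace (z / nC 5)%C with (RtoC (/ 5) * z)%C. rewrite im_scal_l. lra.
      unfold Cdiv. rewrite Cmult_comm. f_equal. unfold nC. rewrite RtoC_inv by lra. f_equal. simpl. f_equal. ring.
    + apply pow_incr. split. apply Cmod_ge_0. unfold Cdiv. rewrite Cmod_mult, Cmod_inv by apply nC_nz.
      unfold nC. rewrite Cmod_R, Rabs_pos_eq by apply pos_INR. simpl. assert (H0 := Cmod_ge_0 z). lra.
Qed.

(* The weight 2 Eisenstein series (5 E2(5z) - E2(z)) / 4 = 1 + 2 ee. *)
Definition ee : nat -> Z := zadd (zscal 3 sigma) (zscal (-15) (zinfl 5 sigma)).
Definition e5 : nat -> Z := zadd zone (zscal 2 ee).

Lemma zconv_e5 : zconv e5.
Proof. unfold e5, ee. zconv_tac; auto using zconv_sigma. Qed.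

Lemma ZE_e5 z : 0 < Im z -> ZE e5 z = (/ 4 * (5 * ZE e2 (nC 5 * z) - ZE e2 z))%C.
Proof.
  intros Hz. assert (H5 := Im_nCz 4 z Hz). unfold e5, ee, e2.
  repeat (rewrite ?ZE_add, ?ZE_scal, ?ZE_infl by (zconv_tac; auto using zconv_sigma; lia)).
  rewrite !ZE_one.
  replace (RtoC (-24)) with (- RtoC 24)%C by (apply C_eq; simpl; ring).
  replace (RtoC (-15)) with (- RtoC 15)%C by (apply C_eq; simpl; ring). field.
Qed.

(** Five times the correction of E2 for the conjugated matrix, with lower left entry c', equals the
    correction for the entry 5 c', so the difference transforms without correction. At the cusp 0
    the cancellation is 5 (z / 5) = z. *)
Lemma MF_e5 : MF 2 e5.
Proof.
  split; [|split].
  - apply zconv_e5.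
  - intros p q c d Hd [c' ->] z Hz. replace (c' * 5)%Z with (5 * c')%Z in * by ring.
    destruct (moeb_5 p q c' d z Hd Hz) as [E1 E2]. rewrite !ZE_e5 by (auto using Im_moeb_pos).
    rewrite E1. rewrite (E2_law p (5 * q) c' d) by (try lia; now apply Im_nCz). rewrite (E2_law p q (5 * c') d) by auto.
    rewrite <- E2. rewrite (zC_mult 5 c'). change (zC 5) with (RtoC 5). ring.
  - destruct (Ev_bounded (toC e2) (1 / 5) zconv_e2 ltac:(lra)) as [K [HK H]]. exists K, 1. intros z HY Hz.
    assert (Hn := Im_pos_nz z Hz). assert (E5 : nC 5 = RtoC 5) by (unfold nC; simpl; f_equal; ring).
    destruct (five_inv z Hz) as [E H5]. rewrite ZE_e5 by (auto using Im_neg_inv). rewrite E, !E2_S by auto.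
    replace (/ 4 * (5 * ((z / nC 5) ^ 2 * ZE e2 (z / nC 5) + 12 / c2pi * (z / nC 5)) - (z ^ 2 * ZE e2 z + 12 / c2pi * z)))%C
      with (z ^ 2 * (/ 4 * (/ 5 * ZE e2 (z / nC 5) - ZE e2 z)))%C by (rewrite E5; field; auto using c2pi_nz).
    rewrite Cmod_mult, Cmod_pow, Rmult_comm. apply Rmult_le_compat_r. apply pow_le, Cmod_ge_0.
    assert (B1 : Cmod (ZE e2 z) <= K) by (apply H; lra).
    assert (B2 : Cmod (ZE e2 (z / nC 5)) <= K).
    { apply H. replace (z / nC 5)%C with (RtoC (/ 5) * z)%C. rewrite im_scal_l. lra.
      unfold Cdiv. rewrite Cmult_comm, E5. f_equal. rewrite RtoC_inv by lra. reflexivity. }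
    replace (/ 4)%C with (RtoC (/ 4)) by (rewrite RtoC_inv by lra; reflexivity). replace (/ 5)%C with (RtoC (/ 5)) by (rewrite RtoC_inv by lra; reflexivity).
    rewrite Cmod_mult, Cmod_R, Rabs_pos_eq by lra.
    assert (T := Cmod_triangle_minus (RtoC (/ 5) * ZE e2 (z / nC 5)) (ZE e2 z)). rewrite Cmod_mult, Cmod_R, Rabs_pos_eq in T by lra. lra.
Qed.

Lemma MF_e4 : MF 4 e4.
Proof. apply MF_level1. apply zconv_e4. apply E4_S. Qed.
Lemma MF_e4_5 : MF 4 (zinfl 5 e4).
Proof. apply MF_level1_5. apply zconv_e4. apply E4_S. Qed.
Lemma MF_dlt : MF 12 dlt.
Proof. apply MF_level1. apply zconv_dlt. apply dlt_S. Qed.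
Lemma MF_dlt_5 : MF 12 (zinfl 5 dlt).
Proof. apply MF_level1_5. apply zconv_dlt. apply dlt_S. Qed.

(* An integral triangular system in weight 4: [bas0 = 1 + ..], [bas1 = 15 x + ..], [bas2 = -45 x^2 + ..]. *)
Definition bas0 : nat -> Z := zinfl 5 e4.
Definition bas1 : nat -> Z := zadd a4 (zscal (-1) (zinfl 5 a4)).
Definition bas2 : nat -> Z := zadd (zscal 5 (zadd (zadd ee (zmul ee ee)) (zscal (-4) (zinfl 5 a4)))) (zscal (-1) bas1).

Lemma zinfl_e4 : zinfl 5 e4 = zadd zone (zscal 16 (zinfl 5 a4)).
Proof.
  apply functional_extensionality. intros n. unfold zinfl, e4, zadd, zscal, zone.
  destruct (Nat.eqb_spec (n mod 5) 0) as [E|E].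
  - assert (H := Nat.div_mod_eq n 5). destruct (Nat.eqb_spec (n / 5) 0), (Nat.eqb_spec n 0); auto; exfalso; lia.
  - destruct (Nat.eqb_spec n 0); auto. subst. exfalso. apply E. reflexivity.
Qed.

Lemma MF_bas1 : MF 4 bas1.
Proof.
  apply MF_unscal with 16%Z. lia. apply MF_ext with (zadd e4 (zscal (-1) (zinfl 5 e4))).
  - intros n. rewrite zinfl_e4. unfold bas1, e4, zadd, zscal. ring.
  - apply MF_add. apply MF_e4. apply MF_scal, MF_e4_5.
Qed.

(** [e5^2] minus E4(5 z) equals 4 (ee + ee^2 - 4 a4(5 z)), and the bracket starts with 3 x. Five
    times the bracket therefore has the term 15 x, which [bas1] removes. *)
Lemma MF_bas2 : MF 4 bas2.
Proof.
  apply MF_add; [|apply MF_scal, MF_bas1]. apply MF_scal.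
  apply MF_unscal with 4%Z. lia.
  apply MF_ext with (zadd (zmul e5 e5) (zscal (-1) (zinfl 5 e4))).
  - intros n. rewrite zinfl_e4. unfold e5.
    rewrite zmul_add_l, zmul_one_l, zmul_scal_l, (zmul_comm ee), zmul_add_l, zmul_one_l, zmul_scal_l.
    unfold zadd, zscal. ring.
  - apply MF_add. apply (MF_mul 2 2); apply MF_e5. apply MF_scal, MF_e4_5.
Qed.

(** * The maximum principle on horizontal strips *)

Lemma list_max_exists {T : Type} (v : T -> R) (l : list T) (x0 : T) :
  exists m, In m (x0 :: l) /\ forall x, In x (x0 :: l) -> v x <= v m.
Proof.
  induction l as [|y l IH].
  - exists x0. split. now left. intros x [->|[]]. lra.
  - destruct IH as [m [Hm H]]. destruct (Rle_dec (v m) (v y)) as [Hl|Hl].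
    + exists y. split. right; now left. intros x [->|[->|Hx]].
      eapply Rle_trans; [apply H; now left|auto]. lra. eapply Rle_trans; [apply H; now right|auto].
    + exists m. split. destruct Hm as [->|Hm]; [now left|right; now right].
      intros x [->|[->|Hx]]. apply H; now left. lra. apply H; now right.
Qed.

(** Without a maximum every point of the rectangle has a neighbourhood on which v stays below its
    value at some chosen better point. Finitely many neighbourhoods suffice, and the best of the
    finitely many chosen points lies in one of them: a contradiction. *)
Lemma rectangle_max (v : R -> R -> R) a b a' b' : a <= b -> a' <= b' ->
  (forall x y, a <= x <= b -> a' <= y <= b' -> forall e, 0 < e -> exists d, 0 < d /\
     forall x' y', Rabs (x' - x) < d -> Rabs (y' - y) < d -> Rabs (v x' y' - v x y) < e) ->
  exists x y, (a <= x <= b /\ a' <= y <= b') /\ forall x' y', a <= x' <= b -> a' <= y' <= b' -> v x' y' <= v x y.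
Proof.
  intros Hab Hab' Hc. apply NNPP. intros Hno.
  set (Tn2 := Compactness.Tn 2 R).
  set (inr := fun t : Tn2 => a <= fst t <= b /\ a' <= fst (snd t) <= b').
  set (V := fun t : Tn2 => v (fst t) (fst (snd t))).
  assert (Hex : forall t : Tn2, exists p : posreal * Tn2, inr t ->
     inr (snd p) /\ forall x : Tn2, Rabs (fst x - fst t) < fst p -> Rabs (fst (snd x) - fst (snd t)) < fst p -> V x < V (snd p)).
  { intros t. destruct (classic (inr t)) as [Ht|Ht].
    2:{ exists (mkposreal 1 Rlt_0_1, t). tauto. }
    destruct Ht as [Ht1 Ht2].
    assert (Hex : exists t', inr t' /\ V t < V t').
    { apply NNPP. intros Hn. apply Hno. exists (fst t), (fst (snd t)). split; auto.
      intros x' y' Hx Hy. apply Rnot_lt_le. intros Hl. apply Hn. exists (x', (y', tt)). split; auto. split; auto. }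
    destruct Hex as [t' [Ht' Hl]].
    destruct (Hc _ _ Ht1 Ht2 (V t' - V t) ltac:(lra)) as [d [Hd H]].
    exists (mkposreal d Hd, t'). intros _. split; auto. simpl. intros x H1 H2.
    specialize (H _ _ H1 H2). unfold V in *. apply Rabs_def2 in H. lra. }
  set (pick := fun t => proj1_sig (constructive_indefinite_description _ (Hex t))).
  assert (Hpick := fun t => proj2_sig (constructive_indefinite_description _ (Hex t))). fold pick in Hpick.
  apply (Compactness.compactness_list 2 (a, (a', tt)) (b, (b', tt)) (fun t => fst (pick t))). intros [l Hl].
  set (l' := map (fun t => snd (pick t)) (filter (fun t => if excluded_middle_informative (inr t) then true else false) l)).
  destruct (list_max_exists V l' (snd (pick (a, (a', tt))))) as [m [Hm HM]].
  assert (Hinr : inr m).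
  { destruct Hm as [<-|Hm]. apply Hpick. split; simpl; lra.
    unfold l' in Hm. apply in_map_iff in Hm. destruct Hm as [t [<- Ht]]. apply filter_In in Ht. destruct Ht as [_ Ht].
    destruct (excluded_middle_informative (inr t)); [|discriminate]. now apply Hpick. }
  destruct (Hl m) as [t [Ht1 [Ht2 Ht3]]].
  { destruct m as [m1 [m2 []]]. destruct Hinr. simpl in *. auto. }
  assert (Hit : inr t). { destruct t as [t1 [t2 []]]. destruct Ht2 as [? [? _]]. split; auto. }
  destruct (Hpick t Hit) as [P1 P2].
  assert (HV : V m < V (snd (pick t))).
  { apply P2; destruct m as [m1 [m2 []]], t as [t1 [t2 []]]; destruct Ht3 as [? [? _]]; auto. }
  assert (V (snd (pick t)) <= V m).
  { apply HM. right. unfold l'. apply (in_map (fun t => snd (pick t))). apply filter_In. split; auto.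
    destruct (excluded_middle_informative (inr t)); tauto. }
  lra.
Qed.

Lemma J2_continuous_norm h z l : J2 h z l -> forall e, 0 < e -> exists d, 0 < d /\
  forall w, Cmod (w - z) < d -> Rabs (Cmod (h w) ^ 2 - Cmod (h z) ^ 2) < e.
Proof.
  intros H e He. destruct (J2_linear_bound _ _ _ H) as [K [d [HK [Hd A]]]].
  set (L := Cmod l + K). assert (Hl := Cmod_ge_0 l). assert (HL : 0 <= L) by (unfold L; lra).
  set (N := 2 * Cmod (h z) + L + 1). assert (Hz := Cmod_ge_0 (h z)). assert (HN : 1 <= N) by (unfold N; lra).
  set (d0 := Rmin (Rmin d 1) (e / (N * (L + 1)))).
  assert (Hp : 0 < N * (L + 1)) by (apply Rmult_lt_0_compat; lra).
  exists d0. split. { unfold d0. repeat apply Rmin_glb_lt; try lra. apply Rdiv_lt_0_compat; auto. }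
  intros w Hw. set (k := (w - z)%C) in *.
  assert (h1 : Cmod k < d) by (eapply Rlt_le_trans; [apply Hw|]; eapply Rle_trans; [apply Rmin_l|apply Rmin_l]).
  assert (h2 : Cmod k < 1) by (eapply Rlt_le_trans; [apply Hw|]; eapply Rle_trans; [apply Rmin_l|apply Rmin_r]).
  assert (h3 : Cmod k * (N * (L + 1)) < e). { apply (Rlt_div_r (Cmod k) e (N * (L + 1))); auto. eapply Rlt_le_trans; [apply Hw|apply Rmin_r]. }
  specialize (A k h1). replace (z + k)%C with w in A by (unfold k; ring).
  assert (Hk := Cmod_ge_0 k).
  assert (D : Cmod (h w - h z) <= L * Cmod k).
  { replace (h w - h z)%C with ((h w - h z - l * k) + l * k)%C by ring. eapply Rle_trans; [apply Cmod_triangle|]. rewrite Cmod_mult.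
    assert (K * Cmod k ^ 2 <= K * Cmod k) by (apply Rmult_le_compat_l; auto; nra). unfold L. nra. }
  assert (D1 := Cmod_triangle_inv (h w) (h z)). assert (D2 := Cmod_triangle_inv (h z) (h w)). rewrite (Cmod_minus_sym (h z)) in D2.
  set (p := Cmod (h w)) in *. set (q := Cmod (h z)) in *. set (x := Cmod (h w - h z)) in *.
  replace (p ^ 2 - q ^ 2) with ((p - q) * (p + q)) by ring. rewrite Rabs_mult.
  assert (Rabs (p - q) <= L * Cmod k) by (apply Rabs_le; lra).
  assert (Hp0 : 0 <= p) by apply Cmod_ge_0.
  assert (Rabs (p + q) <= N). { rewrite Rabs_pos_eq by lra. unfold N. assert (L * Cmod k <= L) by nra. lra. }
  apply Rle_lt_trans with (L * Cmod k * N). apply Rmult_le_compat; auto; apply Rabs_pos.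
  apply Rle_lt_trans with (2 := h3). replace (Cmod k * (N * (L + 1))) with ((L + 1) * Cmod k * N) by ring.
  apply Rmult_le_compat_r. lra. apply Rmult_le_compat_r; lra.
Qed.

Lemma Cmod_pair_sub (x y x' y' d : R) : Rabs (x' - x) < d / 2 -> Rabs (y' - y) < d / 2 -> Cmod ((x', y') - (x, y))%C < d.
Proof.
  intros H1 H2. eapply Rle_lt_trans; [apply Cmod_le_sum|]. rewrite Re_minus, Im_minus. unfold Re, Im; simpl. lra.
Qed.

(* Averaging |h|^2 over the four points p + i^k t kills the linear and quadratic cross terms. *)
Lemma four_point_mean h p l : J2 h p l -> exists C0 d, 0 <= C0 /\ 0 < d /\ forall t, 0 < t < d ->
  4 * Cmod (h p) ^ 2 - C0 * t ^ 3 <=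
  Cmod (h (p + RtoC t)%C) ^ 2 + Cmod (h (p - RtoC t)%C) ^ 2 + Cmod (h (p + Ci * RtoC t)%C) ^ 2 + Cmod (h (p - Ci * RtoC t)%C) ^ 2.
Proof.
  intros [m [K [d [HK [Hd H]]]]]. set (A := h p) in *.
  set (B := Cmod A + Cmod l + Cmod m). assert (HB : 0 <= B) by (assert (H1 := Cmod_ge_0 A); assert (H2 := Cmod_ge_0 l); assert (H3 := Cmod_ge_0 m); unfold B; lra).
  exists (8 * B * K), (Rmin d 1). split. nra. split. apply Rmin_glb_lt; lra. intros t Ht.
  assert (Ht1 : t < d) by (eapply Rlt_le_trans; [apply Ht|apply Rmin_l]). assert (Ht2 : t < 1) by (eapply Rlt_le_trans; [apply Ht|apply Rmin_r]).
  assert (G : forall k, Cmod k = t -> Cmod (A + l * k + m * (k * k)) ^ 2 - 2 * B * (K * t ^ 3) <= Cmod (h (p + k)%C) ^ 2).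
  { intros k Hk. specialize (H k ltac:(lra)). rewrite Hk in H. assert (P := Cmod_poly2 A l m k ltac:(lra)). fold B in P.
    set (Pk := (A + l * k + m * (k * k))%C) in *. assert (T := Cmod_triangle_inv Pk (h (p + k)%C)). rewrite Cmod_minus_sym in T.
    assert (P0 := Cmod_ge_0 Pk). assert (Q0 := Cmod_ge_0 (h (p + k)%C)).
    set (x := Cmod Pk) in *. set (y := Cmod (h (p + k)%C)) in *. set (r := Cmod (h (p + k)%C - Pk)) in *.
    assert (R0 : 0 <= r) by apply Cmod_ge_0.
    assert (x * x - 2 * x * r <= y * y). { destruct (Rle_dec x r). nra. assert (0 <= x - r) by lra. nra. }
    assert (x * r <= B * (K * t ^ 3)) by (apply Rmult_le_compat; auto). nra. }
  assert (Mt : Cmod (RtoC t) = t) by (rewrite Cmod_R, Rabs_pos_eq; lra).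
  assert (G1 := G (RtoC t) Mt). assert (G2 := G (- RtoC t)%C ltac:(now rewrite Cmod_opp)).
  assert (G3 := G (Ci * RtoC t)%C ltac:(rewrite Cmod_mult, Cmod_Ci; lra)). assert (G4 := G (- (Ci * RtoC t))%C ltac:(rewrite Cmod_opp, Cmod_mult, Cmod_Ci; lra)).
  fold (p - RtoC t)%C in G2. fold (p - Ci * RtoC t)%C in G4.
  assert (S : 4 * Cmod A ^ 2 <= Cmod (A + l * t + m * (t * t)) ^ 2 + Cmod (A + l * - t + m * (- t * - t)) ^ 2
     + Cmod (A + l * (Ci * t) + m * (Ci * t * (Ci * t))) ^ 2 + Cmod (A + l * - (Ci * t) + m * (- (Ci * t) * - (Ci * t))) ^ 2).
  { rewrite !Cmod2_alt. destruct A as [a1 a2], l as [l1 l2], m as [m1 m2]. unfold Re, Im; simpl.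
    match goal with |- ?u <= ?v => assert (E : v = u + 4 * t ^ 2 * (l1 ^ 2 + l2 ^ 2) + 4 * t ^ 4 * (m1 ^ 2 + m2 ^ 2)) by ring; rewrite E end.
    assert (0 <= t ^ 2 * (l1 ^ 2 + l2 ^ 2)). { apply Rmult_le_pos. apply pow2_ge_0. apply Rplus_le_le_0_compat; apply pow2_ge_0. }
    assert (0 <= t ^ 4 * (m1 ^ 2 + m2 ^ 2)). { apply Rmult_le_pos. apply pow_le; lra. apply Rplus_le_le_0_compat; apply pow2_ge_0. }
    lra. }
  lra.
Qed.

(** Adding del y^2 makes |h|^2 strictly subharmonic: at an interior maximum the four-point mean
    would give 2 del t^2 <= C0 t^3 for small t. Here del Y^2 is half of the supposed excess of |h
    z0|^2 over B^2, so the maximum cannot sit on the boundary lines, and the period 5 makes the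
    maximum over a rectangle one over the strip. *)
Lemma max_principle (h : C -> C) (eta Y B : R) : 0 < eta < Y ->
  (forall z, 0 < Im z -> exists l, J2 h z l) ->
  (forall z, 0 < Im z -> Cmod (h (z + 5)%C) = Cmod (h z)) ->
  (forall z, Im z = eta \/ Im z = Y -> Cmod (h z) <= B) ->
  forall z, eta <= Im z <= Y -> Cmod (h z) <= B.
Proof.
  intros Hy HJ Hper Hb z0 Hz0. apply Rnot_lt_le. intros Hlt.
  assert (HB : 0 <= B). { eapply Rle_trans; [apply Cmod_ge_0|apply (Hb (0, eta)); now left]. }
  set (del := (Cmod (h z0) ^ 2 - B ^ 2) / (2 * Y ^ 2)).
  assert (Hpos : 0 < Cmod (h z0) ^ 2 - B ^ 2) by nra.
  assert (HY2 : 0 < 2 * Y ^ 2) by nra.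
  assert (Hdel : 0 < del) by (apply Rdiv_lt_0_compat; auto).
  assert (Edel : del * Y ^ 2 = (Cmod (h z0) ^ 2 - B ^ 2) / 2) by (unfold del; field; lra).
  set (v := fun x y : R => Cmod (h (x, y)) ^ 2 + del * y ^ 2).
  destruct (rectangle_max v 0 5 eta Y) as [x [y [[Hx Hyy] Hmax]]]; try lra.
  { intros x y Hx Hyy e He.
    destruct (HJ (x, y) ltac:(simpl; lra)) as [l Hl]. destruct (J2_continuous_norm h _ l Hl (e / 2) ltac:(lra)) as [d [Hd A]].
    set (M := del * (2 * Y + 1) + 1). assert (HM : 1 <= M) by (unfold M; nra).
    exists (Rmin (Rmin (d / 2) 1) (e / 2 / M)). split. { repeat apply Rmin_glb_lt; try lra. apply Rdiv_lt_0_compat; lra. }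
    intros x' y' H1 H2. unfold v.
    assert (cotan : Rabs (x' - x) < d / 2) by (eapply Rlt_le_trans; [apply H1|]; eapply Rle_trans; [apply Rmin_l|apply Rmin_l]).
    assert (cosec2 : Rabs (y' - y) < d / 2) by (eapply Rlt_le_trans; [apply H2|]; eapply Rle_trans; [apply Rmin_l|apply Rmin_l]).
    assert (T3 : Rabs (y' - y) < 1) by (eapply Rlt_le_trans; [apply H2|]; eapply Rle_trans; [apply Rmin_l|apply Rmin_r]).
    assert (T4 : Rabs (y' - y) * M < e / 2). { apply (Rlt_div_r _ (e / 2) M). lra. eapply Rlt_le_trans; [apply H2|apply Rmin_r]. }
    specialize (A (x', y') (Cmod_pair_sub _ _ _ _ _ cotan cosec2)).
    replace (Cmod (h (x', y')) ^ 2 + del * y' ^ 2 - (Cmod (h (x, y)) ^ 2 + del * y ^ 2)) with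
      ((Cmod (h (x', y')) ^ 2 - Cmod (h (x, y)) ^ 2) + del * ((y' - y) * (y' + y))) by ring.
    eapply Rle_lt_trans; [apply Rabs_triang|]. rewrite !Rabs_mult, (Rabs_pos_eq del) by lra.
    assert (Rabs (y' + y) <= 2 * Y + 1). { apply Rabs_def2 in T3. apply Rabs_le. lra. }
    assert (del * (Rabs (y' - y) * Rabs (y' + y)) <= Rabs (y' - y) * M).
    { unfold M. assert (Hr := Rabs_pos (y' - y)).
      assert (del * (Rabs (y' - y) * Rabs (y' + y)) <= del * (Rabs (y' - y) * (2 * Y + 1))) by (apply Rmult_le_compat_l; [lra|]; apply Rmult_le_compat_l; auto). nra. }
    lra. }
  assert (HperZ : forall n z, 0 < Im z -> Cmod (h (z + RtoC (5 * IZR n))%C) = Cmod (h z)).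
  { intros n. pattern n. apply Z.bi_induction.
    - intros ? ? ->. reflexivity.
    - intros z Hz. f_equal. f_equal. rewrite Rmult_0_r. ring.
    - intros k. split; intros IH z Hz.
      + rewrite <- (IH z Hz). rewrite <- (Hper (z + RtoC (5 * IZR k))%C) by (now rewrite Im_add_R). f_equal. f_equal.
        rewrite succ_IZR. apply C_eq; simpl; ring.
      + rewrite <- (IH z Hz). rewrite <- (Hper (z + RtoC (5 * IZR k))%C) by (now rewrite Im_add_R). f_equal. f_equal.
        rewrite succ_IZR. apply C_eq; simpl; ring. }
  assert (Hglob : forall z, eta <= Im z <= Y -> Cmod (h z) ^ 2 + del * Im z ^ 2 <= v x y).
  { intros z Hz. destruct (archimed (Re z / 5)) as [A1 A2]. set (n := (up (Re z / 5) - 1)%Z).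
    rewrite <- (HperZ (- n)%Z z) by lra.
    assert (E : (z + RtoC (5 * IZR (- n)))%C = (Re z - 5 * IZR n, Im z)).
    { rewrite opp_IZR. apply C_eq; simpl; unfold Re, Im; ring. }
    rewrite E. apply Hmax; auto. unfold n. rewrite minus_IZR. lra. }
  assert (Hv0 : B ^ 2 + del * Y ^ 2 < v x y).
  { apply Rlt_le_trans with (2 := Hglob z0 Hz0). rewrite Edel. assert (0 <= del * Im z0 ^ 2) by (apply Rmult_le_pos; [lra|apply pow2_ge_0]). lra. }
  assert (Hbd : forall s, s = eta \/ s = Y -> y <> s).
  { intros s Hs E. subst s. unfold v in Hv0.
    assert (Hc := Hb (x, y) ltac:(simpl; tauto)). assert (Hc0 := Cmod_ge_0 (h (x, y))).
    assert (Cmod (h (x, y)) ^ 2 <= B ^ 2) by (apply pow_incr; lra). assert (y ^ 2 <= Y ^ 2) by (apply pow_incr; lra). nra. }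
  assert (y <> eta) by (apply Hbd; auto). assert (y <> Y) by (apply Hbd; auto).
  destruct (HJ (x, y) ltac:(simpl; lra)) as [l Hl]. destruct (four_point_mean h _ l Hl) as [C0 [d [HC0 [Hd HF]]]].
  set (t := Rmin (Rmin (d / 2) (Rmin (y - eta) (Y - y))) (del / (C0 + 1))).
  assert (Hq : 0 < del / (C0 + 1)) by (apply Rdiv_lt_0_compat; lra).
  assert (Ht : 0 < t) by (unfold t; repeat apply Rmin_glb_lt; lra).
  assert (t1 : t <= d / 2) by (eapply Rle_trans; [apply Rmin_l|apply Rmin_l]).
  assert (t2 : t <= y - eta) by (eapply Rle_trans; [apply Rmin_l|]; eapply Rle_trans; [apply Rmin_r|apply Rmin_l]).
  assert (t3 : t <= Y - y) by (eapply Rle_trans; [apply Rmin_l|]; eapply Rle_trans; [apply Rmin_r|apply Rmin_r]).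
  assert (t4 : t * (C0 + 1) <= del). { apply (Rle_div_r t del (C0 + 1)). lra. apply Rmin_r. }
  specialize (HF t ltac:(lra)). set (p := (x, y) : C) in *.
  assert (I1 : Im (p + RtoC t)%C = y) by (simpl; ring). assert (I2 : Im (p - RtoC t)%C = y) by (simpl; ring).
  assert (I3 : Im (p + Ci * RtoC t)%C = y + t) by (simpl; ring). assert (I4 : Im (p - Ci * RtoC t)%C = y - t) by (simpl; ring).
  assert (V1 := Hglob (p + RtoC t)%C ltac:(rewrite I1; lra)). assert (V2 := Hglob (p - RtoC t)%C ltac:(rewrite I2; lra)).
  assert (V3 := Hglob (p + Ci * RtoC t)%C ltac:(rewrite I3; lra)). assert (V4 := Hglob (p - Ci * RtoC t)%C ltac:(rewrite I4; lra)).
  rewrite I1 in V1. rewrite I2 in V2. rewrite I3 in V3. rewrite I4 in V4. unfold v in V1, V2, V3, V4. fold p in V1, V2, V3, V4.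
  assert (2 * del * t ^ 2 <= C0 * t ^ 3) by nra.
  assert (C0 * t ^ 3 <= del * t ^ 2). { replace (C0 * t ^ 3) with (C0 * t * t ^ 2) by ring. apply Rmult_le_compat_r. apply pow2_ge_0. nra. }
  assert (0 < del * t ^ 2) by (apply Rmult_lt_0_compat; auto; apply pow_lt; auto). lra.
Qed.

(** The maximum principle is applied to h(z) exp(- PI i z), of modulus |h| exp(PI y). Since s > PI
    it is still small at the top of a high strip, and going from height 1/4 to height 1/2 gains
    exp(PI / 4) exp(- PI / 2). *)
Lemma strip_decay (h : C -> C) (C1 K s : R) : PI < s -> 0 <= K -> 0 <= C1 ->
  (forall z, 0 < Im z -> exists l, J2 h z l) ->
  (forall z, 0 < Im z -> Cmod (h (z + 5)%C) = Cmod (h z)) ->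
  (forall z, 1 / 4 <= Im z -> Cmod (h z) <= C1 * exp (- s * Im z)) ->
  (forall z, Im z = 1 / 4 -> Cmod (h z) <= K) ->
  forall z, 1 / 2 <= Im z -> Cmod (h z) <= K * exp (- PI / 4).
Proof.
  intros Hs HK HC1 HJ Hper Hdec Hb z Hz. assert (Hpi := PI_RGT_0).
  set (g := fun w => (h w * cE (- / 2 * w))%C).
  assert (Hg : forall w, Cmod (g w) = Cmod (h w) * exp (PI * Im w)).
  { intros w. unfold g. rewrite Cmod_mult, Cmod_cE. do 2 f_equal.
    replace (- / 2 * w)%C with (RtoC (- / 2) * w)%C by (rewrite RtoC_opp, RtoC_inv by lra; ring). rewrite im_scal_l. field. }
  assert (M : forall e, 0 < e -> Cmod (g z) <= K * exp (PI / 4) + e).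
  { intros e He.
    (* High enough that C1 <= e (s - PI) Y <= e exp((s - PI) Y), which bounds the top edge by e. *)
    set (Y := Rmax (Im z + 1) (C1 / e / (s - PI))).
    assert (Y1 : Im z + 1 <= Y) by apply Rmax_l. assert (Y2 : C1 / e / (s - PI) <= Y) by apply Rmax_r.
    apply (max_principle g (1 / 4) Y); try lra.
    - intros w Hw. destruct (HJ w Hw) as [l Hl]. eexists. apply J2_mult; [exact Hl|]. unfold cE.
      apply (J2_comp cexp (fun w => RtoC (2 * PI) * Ci * (- / 2 * w))%C). apply J2_cexp. apply J2_scal, J2_scal, J2_id.
    - intros w Hw. rewrite !Hg, Hper by auto. do 2 f_equal. f_equal. simpl. unfold Im. ring.
    - intros w Hw. rewrite Hg. assert (E0 : 0 < K * exp (PI / 4) + e) by (assert (E0 := exp_pos (PI / 4)); nra).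
      destruct Hw as [Hw|Hw]; rewrite Hw.
      + replace (PI * (1 / 4)) with (PI / 4) by field. assert (E1 := exp_pos (PI / 4)). specialize (Hb w Hw).
        assert (Cmod (h w) * exp (PI / 4) <= K * exp (PI / 4)) by (apply Rmult_le_compat_r; lra). lra.
      + specialize (Hdec w ltac:(lra)). rewrite Hw in Hdec.
        apply Rle_trans with (C1 * exp (- s * Y) * exp (PI * Y)). apply Rmult_le_compat_r; auto. left; apply exp_pos.
        rewrite Rmult_assoc, <- exp_plus. replace (- s * Y + PI * Y) with (- ((s - PI) * Y)) by ring. rewrite exp_Ropp.
        assert (Ex := exp_ineq1_le ((s - PI) * Y)). assert (Exp := exp_pos ((s - PI) * Y)).
        assert (Hle : C1 <= e * exp ((s - PI) * Y)).
        { apply Rle_trans with (e * ((s - PI) * Y)). 2: apply Rmult_le_compat_l; lra.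
          assert (L : C1 / e / (s - PI) * (e * (s - PI)) <= Y * (e * (s - PI))) by (apply Rmult_le_compat_r; auto; nra).
          replace (C1 / e / (s - PI) * (e * (s - PI))) with C1 in L by (field; lra). lra. }
        apply Rle_trans with e; [|assert (E1 := exp_pos (PI / 4)); nra].
        apply Rmult_le_reg_r with (exp ((s - PI) * Y)); auto. rewrite Rmult_assoc, Rinv_l by lra. lra. }
  assert (M' : Cmod (g z) <= K * exp (PI / 4)) by (apply le_epsilon; intros; now apply M).
  rewrite Hg in M'.
  apply Rmult_le_reg_r with (exp (PI * Im z)). apply exp_pos.
  apply Rle_trans with (1 := M'). rewrite Rmult_assoc, <- exp_plus. apply Rmult_le_compat_l; auto. apply exp_le.
  replace (- PI / 4) with (- (PI * (1 / 4))) by field. nra.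
Qed.

(** * Moving points up by SL2(Z), and cosets of Gamma_0(5) *)

Lemma round_half (x : R) : exists n : Z, Rabs (x + IZR n) <= 1 / 2.
Proof.
  destruct (archimed (x - 1 / 2)) as [A1 A2]. exists (- up (x - 1 / 2))%Z. rewrite opp_IZR. apply Rabs_le. lra.
Qed.

Lemma moeb_comp_ST p q c d n z : (p * d - q * c = 1)%Z -> 0 < Im z ->
  moeb p q c d (- / (z + zC n)) = moeb q (q * n - p) d (d * n - c) z.
Proof.
  intros Hd Hz. assert (N1 : (z + zC n <> 0)%C) by (unfold zC; now apply Im_pos_add_nz).
  assert (N2 := automy_nz q (q * n - p) d (d * n - c) z ltac:(lia) Hz).
  rewrite !moeb_eq, !zC_minus, !zC_mult in *. field. repeat split; auto.
Qed.

(** Below height 1/2 a translation to |Re w| <= 1/2 gives |w|^2 <= 1/2, so the inversion at least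
    doubles the imaginary part; n bounds the number of doublings. *)
Lemma reduction n : forall z, 1 / 2 / 2 ^ n <= Im z ->
  exists p q c d, (p * d - q * c = 1)%Z /\ 1 / 2 <= Im (moeb p q c d z).
Proof.
  induction n; intros z Hz.
  - exists 1%Z, 0%Z, 0%Z, 1%Z. split; [reflexivity|]. rewrite moeb_eq. unfold zC.
    replace ((1 * z + 0) / (0 * z + 1))%C with z by (field; apply C1_nz). simpl in Hz. lra.
  - assert (P := p2_pos (S n)). assert (Hz0 : 0 < Im z). { eapply Rlt_le_trans; [|apply Hz]. apply Rdiv_lt_0_compat; lra. }
    destruct (Rle_dec (1 / 2) (Im z)) as [Hl|Hl].
    { exists 1%Z, 0%Z, 0%Z, 1%Z. split; [reflexivity|]. rewrite moeb_eq. unfold zC.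
      replace ((1 * z + 0) / (0 * z + 1))%C with z by (field; apply C1_nz). auto. }
    destruct (round_half (Re z)) as [k Hk]. set (w := (z + zC k)%C).
    assert (Iw : Im w = Im z) by (unfold w, zC; apply Im_add_R).
    assert (Rw : Re w = Re z + IZR k) by reflexivity.
    destruct (IHn (- / w)%C) as [p [q [c [d [Hd H]]]]].
    + assert (E : Im (- / w) = Im z / Cmod w ^ 2).
      { assert (X := Im_moeb 0 (-1) 1 0 w eq_refl ltac:(lra)). rewrite moeb_eq in X. unfold zC in X.
        replace ((0 * w + -1) / (1 * w + 0))%C with (- / w)%C in X.
        2:{ replace (RtoC (-1)) with (- RtoC 1)%C by (apply C_eq; simpl; ring). field. apply Im_pos_nz. lra. }
        rewrite X, Iw. replace (1 * w + 0)%C with w by ring. reflexivity. }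
      rewrite E. assert (Hm : Cmod w ^ 2 <= 1 / 2).
      { rewrite Cmod2_alt, Iw, Rw. apply Rabs_le_between in Hk. nra. }
      assert (Hm0 : 0 < Cmod w ^ 2) by (apply pow_lt, Cmod_gt_0, Im_pos_nz; lra).
      apply Rle_trans with (2 * Im z).
      * simpl in Hz. assert (Pn := p2_pos n). replace (1 / 2 / (2 * 2 ^ n)) with (1 / 2 / 2 ^ n / 2) in Hz by (field; lra). lra.
      * apply (Rle_div_r (2 * Im z) (Im z) (Cmod w ^ 2)); auto. nra.
    + exists q, (q * k - p)%Z, d, (d * k - c)%Z. split. lia. unfold w in H. rewrite moeb_comp_ST in H; auto.
Qed.

Lemma reduction_exists z : 0 < Im z -> exists p q c d, (p * d - q * c = 1)%Z /\ 1 / 2 <= Im (moeb p q c d z).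
Proof.
  intros Hz. destruct (INR_unbounded (1 / Im z)) as [n Hn]. apply (reduction n).
  assert (H1 := Nat.pow_gt_lin_r 2 n ltac:(lia)). apply lt_INR in H1. rewrite INR_pow2 in H1.
  assert (P := p2_pos n). apply (Rle_div_l (1 / 2) (Im z) (2 ^ n)); auto.
  assert (1 < Im z * 2 ^ n). { assert (H2 : 1 / Im z < 2 ^ n) by lra. apply (Rlt_div_l 1 (2 ^ n) (Im z)) in H2; lra. } lra.
Qed.

Lemma moeb_inv p q c d z : (p * d - q * c = 1)%Z -> 0 < Im z -> moeb d (- q) (- c) p (moeb p q c d z) = z.
Proof.
  intros Hd Hz. assert (N := automy_nz p q c d z Hd Hz). rewrite !moeb_eq, !zC_opp.
  assert (E : (zC p * zC d - zC q * zC c = 1)%C) by (rewrite <- !zC_mult, <- zC_minus, Hd; reflexivity).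
  set (v := (zC c * z + zC d)%C) in *.
  replace (zC d * ((zC p * z + zC q) / v) + - zC q)%C with (z * (zC p * zC d - zC q * zC c) / v)%C by (unfold v; field; auto).
  replace (- zC c * ((zC p * z + zC q) / v) + zC p)%C with ((zC p * zC d - zC q * zC c) / v)%C by (unfold v; field; auto).
  rewrite E. field; auto.
Qed.

(* Coset representatives for Gamma_0(5) in SL2(Z): the identity and S T^j. *)
Lemma coset_ST c d : ~ (5 | c)%Z -> exists j, (5 | d - c * j)%Z.
Proof.
  intros Hc. exists (d * c ^ 3)%Z.
  assert (H4 : (5 | 1 - c ^ 4)%Z).
  {
    assert (Hm := Z.mod_pos_bound c 5 ltac:(lia)). assert (Hm0 : (c mod 5 <> 0)%Z) by (intros E; apply Hc; apply Z.mod_divide; [lia|auto]).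
    assert (E := Z.div_mod c 5 ltac:(lia)). set (q := (c / 5)%Z) in *. set (r := (c mod 5)%Z) in *.
    assert (Hr : (r = 1 \/ r = 2 \/ r = 3 \/ r = 4)%Z) by lia.
    rewrite E.
    destruct Hr as [-> | [-> | [-> | ->]]].
    - exists (- (125 * q ^ 4 + 100 * q ^ 3 + 30 * q ^ 2 + 4 * q))%Z. ring.
    - exists (- (125 * q ^ 4 + 200 * q ^ 3 + 120 * q ^ 2 + 32 * q + 3))%Z. ring.
    - exists (- (125 * q ^ 4 + 300 * q ^ 3 + 270 * q ^ 2 + 108 * q + 16))%Z. ring.
    - exists (- (125 * q ^ 4 + 400 * q ^ 3 + 480 * q ^ 2 + 256 * q + 51))%Z. ring. }
  destruct H4 as [u Hu]. exists (d * u)%Z. replace (d - c * (d * c ^ 3))%Z with (d * (1 - c ^ 4))%Z by ring. rewrite Hu. ring.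
Qed.

(** The matrix factors as gamma S T^j, and the lower left entry of gamma is - (d - c j); j is chosen
    to make it divisible by 5. *)
Lemma coset_law (F : C -> C) k :
  (forall p q c d, (p * d - q * c = 1)%Z -> (5 | c)%Z -> forall z, 0 < Im z ->
     F (moeb p q c d z) = ((zC c * z + zC d) ^ k * F z)%C) ->
  forall p q c d, (p * d - q * c = 1)%Z -> ~ (5 | c)%Z ->
  exists j, forall z, 0 < Im z ->
    F (moeb p q c d z) = (((zC c * z + zC d) / (z + zC j)) ^ k * F (- / (z + zC j)))%C.
Proof.
  intros HF p q c d Hd Hc. destruct (coset_ST c d Hc) as [j Hj]. exists j. intros z Hz.
  assert (Hzj : 0 < Im (z + zC j)%C) by (unfold zC; now rewrite Im_add_R).
  set (p' := (- (q - p * j))%Z). set (c' := (- (d - c * j))%Z).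
  assert (D' : (p' * c - p * c' = 1)%Z) by (unfold p', c'; lia).
  assert (E : moeb p q c d z = moeb p' p c' c (- / (z + zC j))).
  { rewrite (moeb_comp_ST p' p c' c j z D' Hz). unfold p', c'. f_equal; ring. }
  rewrite E, (HF p' p c' c); auto using Im_neg_inv.
  2:{ unfold c'. now apply Z.divide_opp_r. }
  f_equal. f_equal. unfold c'. rewrite zC_opp, zC_minus, zC_mult. field. now apply Im_pos_nz.
Qed.

(** * Forms of weight 4m vanishing beyond order 2m are zero *)

Lemma Cmod_Del z : Cmod (Del z) = Cmod (cE z) * Cmod (cexp (Ev log_Del_coef z)).
Proof. unfold Del, log_Del. rewrite cexp_plus, Cmod_mult. reflexivity. Qed.

Lemma exp_Re_bounds u K : Cmod u <= K -> Cmod (cexp u) <= exp K /\ Cmod (cexp (- u)) <= exp K.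
Proof.
  intros H. rewrite !Cmod_cexp. assert (R := re_le_Cmod u). apply Rabs_le_between in R.
  split; apply exp_le. lra. simpl. unfold Re in *. lra.
Qed.

Lemma Del_bounds y0 : 0 < y0 -> exists K, 0 < K /\ forall z, y0 <= Im z ->
  Cmod (Del z) <= K * exp (- (2 * PI) * Im z) /\ Cmod (cexp (- log_Del z)) <= K * exp (2 * PI * Im z).
Proof.
  intros Hy. destruct (Ev_bounded log_Del_coef y0 pconv_log_Del_coef Hy) as [K [HK H]]. exists (exp K). split. apply exp_pos.
  intros z Hz. destruct (exp_Re_bounds _ _ (H z Hz)) as [B1 B2]. split.
  - rewrite Cmod_Del, Cmod_cE, Rmult_comm. apply Rmult_le_compat_r; auto. left; apply exp_pos.
  - unfold log_Del. replace (- (c2pi * z + Ev log_Del_coef z))%C with (c2pi * - z + - Ev log_Del_coef z)%C by ring.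
    rewrite cexp_plus, Cmod_mult, <- cE_c2pi, Cmod_cE. rewrite Rmult_comm. apply Rmult_le_compat; auto using Cmod_ge_0.
    left; apply exp_pos. right. f_equal. simpl. unfold Im. ring.
Qed.

Lemma exp_pow_nat x n : exp x ^ n = exp (INR n * x).
Proof.
  induction n. simpl. rewrite Rmult_0_l, exp_0. auto. rewrite S_INR. simpl. rewrite IHn, <- exp_plus. f_equal. ring.
Qed.

Section SturmBound.
Context (m : nat) (a : nat -> Z).
Context (Ha : MF (4 * m) a) (Hord : forall n, (n <= 2 * m)%nat -> a n = 0%Z).

(** The reciprocal of Del(5 z), written as an exponential so that its Taylor expansion comes from
    composition alone. *)
Let iD5 (z : C) : C := cexp (- (1) * log_Del (nC 5 * z)).
(* f^12 Delta(z)^(m+1) / Delta(5z)^(5m+1) has weight 0 and vanishes at both cusps. *)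
Let H (z : C) : C := (ZE a z ^ 12 * (Del z ^ S m * iD5 z ^ S (5 * m)))%C.

Let iD5_inv z : (iD5 z * Del (nC 5 * z) = 1)%C.
Proof. unfold iD5, Del. rewrite <- cexp_plus. replace (- (1) * log_Del (nC 5 * z) + log_Del (nC 5 * z))%C with (RtoC 0) by ring. apply cexp_0. Qed.

Let H_J2 z : 0 < Im z -> exists l, J2 H z l.
Proof.
  intros Hz. destruct Ha as [A1 _]. eexists. unfold H. apply J2_mult.
  apply (J2_pow (ZE a)). apply J2_ZE; auto. apply J2_mult.
  apply (J2_pow Del). unfold Del. apply (J2_comp cexp log_Del). apply J2_cexp. apply J2_log_Del; auto.
  apply (J2_pow iD5). unfold iD5. apply (J2_comp cexp (fun z => - (1) * log_Del (nC 5 * z))%C). apply J2_cexp.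
  apply J2_scal. apply (J2_comp log_Del (fun z => nC 5 * z)%C). apply J2_log_Del. now apply Im_nCz. apply J2_scal, J2_id.
Qed.

Let H_inv p q c d : (p * d - q * c = 1)%Z -> (5 | c)%Z -> forall z, 0 < Im z ->
  H (moeb p q c d z) = ((zC c * z + zC d) ^ 0 * H z)%C.
Proof.
  intros Hd Hc z Hz. destruct Ha as [_ [A2 _]]. assert (N := automy_nz p q c d z Hd Hz).
  unfold H. rewrite (A2 p q c d Hd Hc z Hz).
  assert (D1 : Del (moeb p q c d z) = ((zC c * z + zC d) ^ 12 * Del z)%C) by (apply sl2_law; auto using Del_T, Del_S).
  assert (D5 : iD5 (moeb p q c d z) = (/ (zC c * z + zC d) ^ 12 * iD5 z)%C).
  { destruct Hc as [c' ->]. replace (c' * 5)%Z with (5 * c')%Z in * by ring.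
    destruct (moeb_5 p q c' d z Hd Hz) as [E1 E2]. assert (I1 := iD5_inv (moeb p q (5 * c') d z)). assert (I2 := iD5_inv z).
    rewrite E1 in I1. assert (D : Del (moeb p (5 * q) c' d (nC 5 * z)) = ((zC c' * (nC 5 * z) + zC d) ^ 12 * Del (nC 5 * z))%C).
    { apply sl2_law; auto using Del_T, Del_S. lia. now apply Im_nCz. }
    rewrite D, <- E2 in I1. set (v := (zC (5 * c') * z + zC d)%C) in *. set (X := iD5 (moeb p q (5 * c') d z)) in *.
    assert (Dn := Del_nz (nC 5 * z)). set (Y := Del (nC 5 * z)) in *.
    replace X with ((X * (v ^ 12 * Y)) * (iD5 z * Y) * / (v ^ 12 * Y * Y) * Y)%C at 1.
    rewrite I1. replace (iD5 z) with (iD5 z * Y * / Y)%C at 2 by (field; auto). rewrite I2. field. auto.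
    rewrite I2. field. auto. }
  rewrite D1, D5. rewrite !Cpow_mult_l.
  set (v := (zC c * z + zC d)%C) in *. rewrite <- !Cpow_mult_r, Cpow_inv by auto using Cpow_nz. rewrite <- Cpow_mult_r.
  assert (Ev12 : (v ^ (4 * m * 12) * v ^ (12 * S m) = v ^ (12 * S (5 * m)))%C) by (rewrite <- Cpow_add_r; f_equal; lia).
  assert (Nv : (v ^ (12 * S (5 * m)) <> 0)%C) by (now apply Cpow_nz).
  replace (v ^ (4 * m * 12) * ZE a z ^ 12 * (v ^ (12 * S m) * Del z ^ S m * (/ v ^ (12 * S (5 * m)) * iD5 z ^ S (5 * m))))%C
    with ((v ^ (4 * m * 12) * v ^ (12 * S m)) * / v ^ (12 * S (5 * m)) * (ZE a z ^ 12 * (Del z ^ S m * iD5 z ^ S (5 * m))))%C by ring.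
  rewrite Ev12. rewrite Cinv_r by auto. reflexivity.
Qed.

(** The order at infinity is at least 12 (2m + 1) + (m + 1) - 5 (5m + 1) = 8, whence the rate 2 PI *
    8. *)
Let H_decay : exists C1, 0 <= C1 /\ forall z, 1 / 4 <= Im z -> Cmod (H z) <= C1 * exp (- (16 * PI) * Im z).
Proof.
  destruct Ha as [A1 _].
  destruct (Ev_decay (toC a) (S (2 * m)) (1 / 4) A1) as [K [HK HD]]; [|lra|].
  { intros n Hn. unfold toC. rewrite Hord by lia. reflexivity. }
  destruct (Del_bounds (1 / 4) ltac:(lra)) as [K1 [HK1 HB]].
  exists (K ^ 12 * (K1 ^ S m * K1 ^ S (5 * m))). split.
  { apply Rmult_le_pos. now apply pow_le. apply Rmult_le_pos; apply pow_le; lra. }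
  intros z Hz. unfold H. rewrite !Cmod_mult, !Cmod_pow.
  specialize (HD z Hz). fold (ZE a z) in HD. rewrite Cmod_cE in HD. destruct (HB z Hz) as [B1 _].
  assert (Hz5 : Im (nC 5 * z)%C = 5 * Im z) by (unfold nC; rewrite im_scal_l; simpl; ring).
  destruct (HB (nC 5 * z)%C ltac:(lra)) as [_ B2]. rewrite Hz5 in B2.
  assert (B3 : Cmod (iD5 z) <= K1 * exp (2 * PI * (5 * Im z))) by (unfold iD5; replace (- (1) * log_Del (nC 5 * z))%C with (- log_Del (nC 5 * z))%C by ring; auto).
  set (y := Im z) in *.
  apply Rle_trans with ((K * exp (- (2 * PI) * y) ^ S (2 * m)) ^ 12 * ((K1 * exp (- (2 * PI) * y)) ^ S m * (K1 * exp (2 * PI * (5 * y))) ^ S (5 * m))).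
  { apply Rmult_le_compat; try (apply pow_le, Cmod_ge_0). apply Rmult_le_pos; apply pow_le, Cmod_ge_0.
    apply pow_incr; split; auto; apply Cmod_ge_0. apply Rmult_le_compat; try (apply pow_le, Cmod_ge_0); apply pow_incr; split; auto; apply Cmod_ge_0. }
  right. rewrite !Rpow_mult_distr, !exp_pow_nat.
  match goal with |- ?u * exp ?e1 * (?v * exp ?e2 * (?w * exp ?e3)) = _ =>
    transitivity (u * (v * w) * (exp e1 * exp e2 * exp e3)); [ring|] end.
  rewrite <- !exp_plus. f_equal. f_equal. rewrite !S_INR, !mult_INR. simpl. ring.
Qed.

Let G (z : C) : C := H (- / z).

(** At the cusp 0 the factor Del(5 z) becomes Del(z / 5) up to (z / 5)^12, and the form itself is
    only bounded. The remaining order is (m + 1) - (5m + 1) / 5 = 4/5, whence the rate 2 PI * 4/5;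
    the powers of |z| cancel because the weight is 0, leaving a power of 5. *)
Let G_decay_far : exists C1 Y, 0 <= C1 /\ 1 <= Y /\ forall z, Y <= Im z -> Cmod (G z) <= C1 * exp (- (8 / 5 * PI) * Im z).
Proof.
  destruct Ha as [A1 [_ [B [Y0 A3]]]].
  destruct (Del_bounds (1 / 5) ltac:(lra)) as [K1 [HK1 HB]].
  set (B' := Rmax B 0). assert (HB' : 0 <= B') by apply Rmax_r.
  exists (B' ^ 12 * 5 ^ (12 * S (5 * m)) * (K1 ^ S m * K1 ^ S (5 * m))), (Rmax (Y0 + 1) 1).
  split. { apply Rmult_le_pos; apply Rmult_le_pos; apply pow_le; lra. } split. apply Rmax_r.
  intros z HY. assert (H1 : Y0 < Im z) by (assert (X := Rmax_l (Y0 + 1) 1); lra). assert (H2 : 1 <= Im z) by (assert (X := Rmax_r (Y0 + 1) 1); lra).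
  assert (Hz : 0 < Im z) by lra. assert (Hn := Im_pos_nz z Hz). assert (Hp : 0 < Cmod z) by (now apply Cmod_gt_0).
  specialize (A3 z H1 Hz).
  assert (A3' : Cmod (ZE a (- / z)) <= B' * Cmod z ^ (4 * m)).
  { apply Rle_trans with (1 := A3). apply Rmult_le_compat_r. apply pow_le; lra. apply Rmax_l. }
  destruct (five_inv z Hz) as [E5 H5].
  assert (Iz5 : Im (z / nC 5)%C = Im z / 5).
  { replace (z / nC 5)%C with (RtoC (/ 5) * z)%C. rewrite im_scal_l. field.
    unfold Cdiv. rewrite Cmult_comm. f_equal. unfold nC. rewrite RtoC_inv by lra. f_equal. simpl. f_equal. ring. }
  destruct (HB z ltac:(lra)) as [B1 _]. destruct (HB (z / nC 5)%C ltac:(lra)) as [_ B2]. rewrite Iz5 in B2.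
  assert (I5 : iD5 (- / z) = ((nC 5 / z) ^ 12 * cexp (- log_Del (z / nC 5)))%C).
  { assert (I := iD5_inv (- / z)%C). rewrite E5, Del_S in I by auto. rewrite cexp_opp. fold (Del (z / nC 5)).
    assert (Dn := Del_nz (z / nC 5)%C). set (X := iD5 (- / z)%C) in *.
    replace X with (X * ((z / nC 5) ^ 12 * Del (z / nC 5)) * / ((z / nC 5) ^ 12 * Del (z / nC 5)))%C.
    rewrite I. field. auto using nC_nz. field. auto using nC_nz. }
  unfold G, H. rewrite Del_S, I5 by auto. rewrite !Cmod_mult, !Cmod_pow, !Cmod_mult, !Cmod_pow.
  assert (M5 : Cmod (nC 5 / z) = 5 / Cmod z). { rewrite Cmod_div by auto. unfold nC. rewrite Cmod_R, Rabs_pos_eq by apply pos_INR. simpl. f_equal. ring. }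
  rewrite M5.
  set (y := Im z) in *. set (t := Cmod z) in *.
  apply Rle_trans with ((B' * t ^ (4 * m)) ^ 12 * ((t ^ 12 * (K1 * exp (- (2 * PI) * y))) ^ S m * ((5 / t) ^ 12 * (K1 * exp (2 * PI * (y / 5)))) ^ S (5 * m))).
  { assert (cotan : 0 <= t ^ 12) by (apply pow_le; lra). assert (cosec2 : 0 <= (5 / t) ^ 12) by (apply pow_le, Rdiv_le_0_compat; lra).
    apply Rmult_le_compat; try (apply pow_le, Cmod_ge_0).
    apply Rmult_le_pos; apply pow_le; apply Rmult_le_pos; auto using Cmod_ge_0.
    apply pow_incr; split; auto; apply Cmod_ge_0.
    apply Rmult_le_compat; try (apply pow_le; apply Rmult_le_pos; auto using Cmod_ge_0); apply pow_incr; split;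
      try (apply Rmult_le_pos; auto using Cmod_ge_0); apply Rmult_le_compat_l; auto. }
  right. unfold Rdiv at 1. rewrite !Rpow_mult_distr, !exp_pow_nat, pow_inv, <- !pow_mult.
  assert (Et : t ^ (4 * m * 12) * t ^ (12 * S m) * (/ t ^ 12) ^ S (5 * m) = 1).
  { rewrite pow_inv, <- pow_mult, <- pow_add. replace (4 * m * 12 + 12 * S m)%nat with (12 * S (5 * m))%nat by lia. apply Rinv_r. apply pow_nonzero; lra. }
  match goal with |- ?u * ?t1 * (?t2 * (?v * exp ?e2) * (?f * ?t3 * (?w * exp ?e3))) = _ =>
    transitivity (u * f * (v * w) * (t1 * t2 * t3) * (exp e2 * exp e3)); [ring|] end.
  rewrite Et, <- exp_plus, Rmult_1_r. f_equal. f_equal. rewrite !S_INR, !mult_INR. simpl. field.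
Qed.

Let G_J2 z : 0 < Im z -> exists l, J2 G z l.
Proof.
  intros Hz. destruct (H_J2 (- / z)%C (Im_neg_inv z Hz)) as [l Hl]. eexists.
  apply (J2_comp H (fun w => - / w)%C); [exact Hl|]. now apply J2_neg_inv.
Qed.

(** The cusp 0 has width 5: under z -> -1/z the translation by 5 becomes the matrix (1, 0; -5, 1) of
    Gamma_0(5). *)
Let G_per z : 0 < Im z -> Cmod (G (z + 5)%C) = Cmod (G z).
Proof.
  intros Hz. f_equal. unfold G.
  assert (E : (- / (z + 5))%C = moeb 1 0 (-5) 1 (- / z)).
  { rewrite moeb_eq. unfold zC. replace (RtoC (-5)) with (- RtoC 5)%C by (apply C_eq; simpl; ring).
    assert (N1 := Im_pos_nz z Hz). assert (N2 := Im_pos_add_nz z 5 Hz). field. repeat split; auto.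
    replace (5 + z)%C with (z + 5)%C by ring. auto. }
  rewrite E, (H_inv 1 0 (-5) 1); auto using Im_neg_inv. simpl. ring. exists (-1)%Z. reflexivity.
Qed.

Let H_per z : 0 < Im z -> Cmod (H (z + 5)%C) = Cmod (H z).
Proof.
  intros Hz. f_equal. assert (E : (z + 5)%C = moeb 1 5 0 1 z) by (rewrite moeb_eq; unfold zC; field; apply C1_nz).
  rewrite E, (H_inv 1 5 0 1); auto. simpl. ring. exists 0%Z. reflexivity.
Qed.

(** Extends the decay down to height 1/4. By periodicity the part below Y reduces to a compact
    rectangle, where |G| <= M, and M <= M exp(8/5 PI Y) exp(- 8/5 PI Im z) there. *)
Let G_decay : exists C1, 0 <= C1 /\ forall z, 1 / 4 <= Im z -> Cmod (G z) <= C1 * exp (- (8 / 5 * PI) * Im z).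
Proof.
  destruct G_decay_far as [C1 [Y [HC [HY HG]]]].
  destruct (rectangle_max (fun x y => Cmod (G (x, y)) ^ 2) 0 5 (1 / 4) Y) as [x0 [y0 [_ Hmax]]]; try lra.
  { intros x y Hx Hy e He. destruct (G_J2 (x, y) ltac:(simpl; lra)) as [l Hl].
    destruct (J2_continuous_norm G _ l Hl e He) as [d [Hd A]]. exists (d / 2). split. lra.
    intros x' y' H1 H2. apply A. now apply Cmod_pair_sub. }
  set (M := Cmod (G (x0, y0))) in *. assert (HM : 0 <= M) by apply Cmod_ge_0. assert (Hpi := PI_RGT_0).
  assert (HperZ : forall n z, 0 < Im z -> Cmod (G (z + RtoC (5 * IZR n))%C) = Cmod (G z)).
  { intros n. pattern n. apply Z.bi_induction.
    - intros ? ? ->. reflexivity.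
    - intros z Hz. f_equal. f_equal. rewrite Rmult_0_r. ring.
    - intros k. split; intros IH z Hz.
      + rewrite <- (IH z Hz). rewrite <- (G_per (z + RtoC (5 * IZR k))%C) by (now rewrite Im_add_R). f_equal. f_equal.
        rewrite succ_IZR. apply C_eq; simpl; ring.
      + rewrite <- (IH z Hz). rewrite <- (G_per (z + RtoC (5 * IZR k))%C) by (now rewrite Im_add_R). f_equal. f_equal.
        rewrite succ_IZR. apply C_eq; simpl; ring. }
  exists (C1 + M * exp (8 / 5 * PI * Y)). assert (Ex := exp_pos (8 / 5 * PI * Y)). split. nra.
  intros z Hz. destruct (Rle_dec Y (Im z)) as [Hl|Hl].
  - specialize (HG z Hl). assert (E := exp_pos (- (8 / 5 * PI) * Im z)).
    apply Rle_trans with (1 := HG). apply Rmult_le_compat_r; [lra|]. nra.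
  - assert (HzM : Cmod (G z) <= M).
    { destruct (archimed (Re z / 5)) as [A1 A2]. set (n := (up (Re z / 5) - 1)%Z).
      rewrite <- (HperZ (- n)%Z z) by lra.
      assert (E : (z + RtoC (5 * IZR (- n)))%C = (Re z - 5 * IZR n, Im z)).
      { rewrite opp_IZR. apply C_eq; simpl; unfold Re, Im; ring. }
      rewrite E. assert (X : Cmod (G (Re z - 5 * IZR n, Im z)) ^ 2 <= M ^ 2).
      { apply Hmax; [|lra]. unfold n. rewrite minus_IZR. lra. }
      apply Rnot_lt_le. intros Hlt. nra. }
    apply Rle_trans with (1 := HzM). rewrite Rmult_plus_distr_r.
    assert (E := exp_pos (- (8 / 5 * PI) * Im z)).
    assert (1 <= exp (8 / 5 * PI * Y) * exp (- (8 / 5 * PI) * Im z)).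
    { rewrite <- exp_plus. replace 1 with (exp 0) by apply exp_0. apply exp_le. nra. }
    assert (0 <= C1 * exp (- (8 / 5 * PI) * Im z)) by (apply Rmult_le_pos; lra).
    assert (M * 1 <= M * (exp (8 / 5 * PI * Y) * exp (- (8 / 5 * PI) * Im z))) by (apply Rmult_le_compat_l; lra). lra.
Qed.

(** The point is moved up by SL2(Z); moving back lies either in Gamma_0(5), giving H, or in a coset
    of S T^j, giving G at a translate of the same height. *)
Let H_cases z : 0 < Im z -> exists w, 1 / 2 <= Im w /\ (H z = H w \/ H z = G w).
Proof.
  intros Hz. destruct (reduction_exists z Hz) as [p [q [c [d [Hd Hw]]]]]. set (w := moeb p q c d z) in *.
  assert (E := moeb_inv p q c d z Hd Hz). fold w in E.
  assert (Hd' : (d * p - - q * - c = 1)%Z) by lia. assert (Hw0 : 0 < Im w) by lra.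
  destruct (classic (5 | - c)%Z) as [H5|H5].
  - exists w. split; auto. left. rewrite <- E. rewrite (H_inv d (- q) (- c) p); auto. simpl. ring.
  - destruct (coset_law H 0 H_inv d (- q)%Z (- c)%Z p Hd' H5) as [j Hj].
    exists (w + zC j)%C. unfold zC at 1. rewrite Im_add_R. split; auto. right.
    rewrite <- E. rewrite Hj by auto. unfold G. simpl. ring.
Qed.

Lemma MF_vanishing : forall n, a n = 0%Z.
Proof.
  assert (Hpi := PI_RGT_0).
  destruct H_decay as [C1 [HC1 D1]]. destruct G_decay as [C2 [HC2 D2]].
  set (rho := exp (- PI / 4)). assert (Hrho : 0 < rho < 1).
  { split. apply exp_pos. unfold rho. rewrite <- exp_0. apply exp_increasing. lra. }
  (* A bound for H on the whole half-plane bounds H and G on the line of height 1/4. [strip_decay]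
     improves it above height 1/2, as both decay rates exceed PI, and [H_cases] carries the
     improvement back to every point. *)
  assert (Step : forall K, 0 <= K -> (forall z, 0 < Im z -> Cmod (H z) <= K) -> forall z, 0 < Im z -> Cmod (H z) <= K * rho).
  { intros K HK HB z Hz. destruct (H_cases z Hz) as [w [Hw [-> | ->]]].
    - apply (strip_decay H C1 K (16 * PI)); auto; try lra. intros; apply HB; lra.
    - apply (strip_decay G C2 K (8 / 5 * PI)); auto; try lra. intros; apply HB. apply Im_neg_inv. lra. }
  assert (B0 : forall z, 0 < Im z -> Cmod (H z) <= C1 + C2).
  { intros z Hz. destruct (H_cases z Hz) as [w [Hw [-> | ->]]].
    - eapply Rle_trans; [apply D1; lra|]. assert (exp (- (16 * PI) * Im w) <= 1) by (rewrite <- exp_0; apply exp_le; nra).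
      assert (0 < exp (- (16 * PI) * Im w)) by apply exp_pos. nra.
    - eapply Rle_trans; [apply D2; lra|]. assert (exp (- (8 / 5 * PI) * Im w) <= 1) by (rewrite <- exp_0; apply exp_le; nra).
      assert (0 < exp (- (8 / 5 * PI) * Im w)) by apply exp_pos. nra. }
  assert (Bn : forall n z, 0 < Im z -> Cmod (H z) <= (C1 + C2) * rho ^ n).
  { induction n; intros z Hz. simpl. rewrite Rmult_1_r. auto.
    simpl. replace ((C1 + C2) * (rho * rho ^ n)) with ((C1 + C2) * rho ^ n * rho) by ring. apply Step; auto.
    apply Rmult_le_pos. lra. apply pow_le; lra. }
  assert (H0 : forall z, 0 < Im z -> H z = 0).
  { intros z Hz. apply Cmod_eq_0. apply Rle_antisym; [|apply Cmod_ge_0].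
    assert (L : is_lim_seq (fun n => (C1 + C2) * rho ^ n) 0).
    { replace (Finite 0) with (Rbar_mult (C1 + C2) 0) by (simpl; f_equal; ring). apply is_lim_seq_scal_l. apply is_lim_seq_geom. rewrite Rabs_pos_eq; lra. }
    assert (X := is_lim_seq_le (fun _ => Cmod (H z)) (fun n => (C1 + C2) * rho ^ n) (Cmod (H z)) 0 (fun n => Bn n z Hz) (is_lim_seq_const _) L).
    exact X. }
  destruct Ha as [A1 _].
  assert (Z0 : forall n, toC a n = RtoC 0).
  { apply (Ev_zero (toC a) 0 A1). intros z _ Hz. specialize (H0 z Hz). unfold H in H0.
    fold (ZE a z). destruct (Ceq_dec (ZE a z) 0) as [E|E]; auto. exfalso.
    apply (Cmult_neq_0 (ZE a z ^ 12) (Del z ^ S m * iD5 z ^ S (5 * m))); auto.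
    now apply Cpow_nz. apply Cmult_neq_0; apply Cpow_nz; apply cexp_nz. }
  intros n. specialize (Z0 n). unfold toC in Z0. apply RtoC_inj in Z0. now apply eq_IZR.
Qed.
End SturmBound.

(** * Agreement with the analytic definition of modular forms *)

Lemma cpow_Cpow z n : cpow z n = (z ^ n)%C.
Proof. induction n; simpl; now rewrite ?IHn. Qed.

Lemma sum_n_csum (a : nat -> C) n : sum_n (G := C_AbelianMonoid) a n = csum a (S n).
Proof.
  induction n. rewrite sum_O. simpl. now rewrite Cplus_0_l.
  rewrite sum_Sn, IHn. reflexivity.
Qed.

Lemma is_series_Clim (a : nat -> C) l : is_series (K := C_AbsRing) (V := C_NormedModule) a l <-> Clim (csum a) l.
Proof.
  split.
  - intros H. apply Clim_shift_inv. intros e He.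
    assert (HP : locally (T := C_UniformSpace) l (fun y => Cmod (y - l) < e)).
    { apply (locally_le_locally_norm (V := C_NormedModule) l). exists (mkposreal e He). intros y Hy. exact Hy. }
    destruct (H _ HP) as [N HN]. exists N. intros n Hn. specialize (HN n Hn). cbv beta in HN.
    rewrite sum_n_csum in HN. exact HN.
  - intros H P HP. apply (locally_norm_le_locally (V := C_NormedModule) l) in HP. destruct HP as [e He].
    destruct (H e (cond_pos e)) as [N HN]. exists N. intros n Hn. apply He.
    rewrite sum_n_csum. apply HN. lia.
Qed.

Lemma expansion_terms a z : ((fun n : nat => (RtoC (IZR (a n)) * cpow (qparam z) n)%C)) = (fun n => (toC a n * cE (nC n * z))%C).
Proof. apply functional_extensionality. intros n. rewrite cpow_Cpow, qparam_cE, cE_nC. reflexivity. Qed.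

Lemma Clim_bounded s l : Clim s l -> exists K N, forall n, (N <= n)%nat -> Cmod (s n) <= K.
Proof.
  intros H. destruct (H 1 ltac:(lra)) as [N HN]. exists (Cmod l + 1), N. intros n Hn. specialize (HN n Hn).
  assert (T := Cmod_triangle_inv (s n) l). lra.
Qed.

(** Convergence at one point whose nome has modulus rho between r and 1 bounds the terms there, and
    comparison with a geometric series of ratio r / rho gives absolute convergence at radius r. *)
Lemma expansion_conv f a : has_expansion f a -> zconv a /\ forall z, 0 < Im z -> f z = ZE a z.
Proof.
  intros H.
  assert (HC : forall z, 0 < Im z -> Clim (csum (fun n => toC a n * cE (nC n * z))%C) (f z)).
  { intros z Hz. apply is_series_Clim. rewrite <- expansion_terms. now apply H. }
  split.
  - intros r Hr. set (rho := (1 + r) / 2). assert (Hrho : 0 < rho < 1) by (unfold rho; lra).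
    assert (Hpi := PI_RGT_0). set (y := - ln rho / (2 * PI)).
    assert (Hln : ln rho < 0) by (rewrite <- ln_1; apply ln_increasing; lra).
    assert (Hy : 0 < y) by (unfold y; apply Rdiv_lt_0_compat; lra).
    assert (Hq : Cmod (cE (0, y)) = rho).
    { rewrite Cmod_cE. simpl. unfold y. replace (- (2 * PI) * (- ln rho / (2 * PI))) with (ln rho) by (field; lra). apply exp_ln; lra. }
    assert (L := HC (0, y) Hy).
    assert (L2 : Clim (fun n => toC a n * cE (nC n * (0, y)))%C (f (0, y) - f (0, y))%C).
    { apply Clim_ext with (fun n => csum (fun n => toC a n * cE (nC n * (0, y)))%C (S n) - csum (fun n => toC a n * cE (nC n * (0, y)))%C n)%C.
      intros n. cbn [csum]. ring. apply Clim_minus; auto. now apply (Clim_shift (csum (fun n => toC a n * cE (nC n * (0, y)))%C)). }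
    destruct (Clim_bounded _ _ L2) as [K [N HK]].
    apply ex_series_incr_n with N.
    apply ex_series_le_nn with (fun n => K * (r / rho) ^ (N + n)).
    + intros n. assert (0 <= r ^ (N + n)) by (apply pow_le; lra). split. apply Rmult_le_pos; auto using Cmod_ge_0.
      specialize (HK (N + n)%nat ltac:(lia)). rewrite Cmod_mult, Cmod_qn, Hq in HK.
      replace (r ^ (N + n)) with (rho ^ (N + n) * (r / rho) ^ (N + n)) by (rewrite <- Rpow_mult_distr; f_equal; field; lra).
      rewrite <- Rmult_assoc. apply Rmult_le_compat_r; auto. apply pow_le. apply Rdiv_le_0_compat; lra.
    + apply (ex_series_incr_n (fun n => K * (r / rho) ^ n)). apply (ex_series_scal (V := R_NormedModule)). apply ex_series_geom.
      rewrite Rabs_pos_eq by (apply Rdiv_le_0_compat; lra). apply Rlt_div_l; unfold rho in *; lra.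
  - intros z Hz. symmetry. apply Csum_unique. now apply HC.
Qed.

Lemma modular_MF k f a : is_modular_form_Gamma0_5 k f -> has_expansion f a -> MF k a.
Proof.
  intros [_ [H1 H2]] He. destruct (expansion_conv f a He) as [Hc Hf].
  split; [|split]; auto.
  - intros p q c d Hd H5 z Hz. rewrite <- !Hf by (auto using Im_moeb_pos). rewrite (H1 p q c d Hd H5 z Hz), cpow_Cpow. reflexivity.
  - destruct (H2 0 (-1) 1 0)%Z as [B [Y H]]; [reflexivity|]. exists B, Y. intros z HY Hz. specialize (H z HY).
    rewrite cpow_Cpow, automy_eq, moeb_eq in H. unfold zC in H.
    assert (Hn := Im_pos_nz z Hz).
    replace ((0 * z + -1) / (1 * z + 0))%C with (- / z)%C in H.
    2:{ replace (RtoC (-1)) with (- RtoC 1)%C by (apply C_eq; simpl; ring). field. auto. }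
    replace (1 * z + 0)%C with z in H by ring. rewrite Hf in H by now apply Im_neg_inv.
    rewrite Cmod_div, Cmod_pow in H by now apply Cpow_nz.
    assert (Hp : 0 < Cmod z ^ k) by (apply pow_lt; now apply Cmod_gt_0). apply (Rle_div_l _ B (Cmod z ^ k)) in H; auto.
Qed.

(** The condition at an arbitrary cusp reduces to one of two: if 5 divides c it is boundedness of
    the expansion at infinity, otherwise [coset_law] turns it into the bound at the cusp 0 at a
    translate of z. *)
Lemma MF_modular k a : MF k a -> is_modular_form_Gamma0_5 k (ZE a) /\ has_expansion (ZE a) a.
Proof.
  intros [A1 [A2 [B [Y A3]]]]. split; [split; [|split]|].
  - intros z Hz. apply (J2_ex_derive (ZE a) z (c2pi * ZE (ztheta a) z)%C). now apply J2_ZE.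
  - intros p q c d Hd H5 z Hz. rewrite (A2 p q c d Hd H5 z Hz). reflexivity.
  - intros p q c d Hd. destruct (classic (5 | c)%Z) as [H5|H5].
    + destruct (Ev_bounded (toC a) 1 A1 ltac:(lra)) as [K [HK H]]. exists K, 1. intros z Hz.
      assert (Hz0 : 0 < Im z) by lra. rewrite (A2 p q c d Hd H5 z Hz0). change cpow with Cpow. rewrite automy_eq.
      assert (N := automy_nz p q c d z Hd Hz0).
      replace ((zC c * z + zC d) ^ k * ZE a z / (zC c * z + zC d) ^ k)%C with (ZE a z) by (field; now apply Cpow_nz).
      apply H. lra.
    + destruct (coset_law (ZE a) k A2 p q c d Hd H5) as [j Hj]. exists B, (Rmax Y 0). intros z Hz.
      assert (H1 : Y < Im z) by (eapply Rle_lt_trans; [apply Rmax_l|apply Hz]). assert (Hz0 : 0 < Im z) by (eapply Rle_lt_trans; [apply Rmax_r|apply Hz]).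
      rewrite (Hj z Hz0). change cpow with Cpow. rewrite automy_eq.
      assert (N := automy_nz p q c d z Hd Hz0). set (w := (z + zC j)%C).
      assert (Iw : Im w = Im z) by (unfold w, zC; apply Im_add_R). assert (Nw : w <> 0) by (apply Im_pos_nz; lra).
      replace (((zC c * z + zC d) / w) ^ k * ZE a (- / w) / (zC c * z + zC d) ^ k)%C with (ZE a (- / w) / w ^ k)%C.
      2:{ unfold Cdiv at 3. rewrite Cpow_mult_l, Cpow_inv by auto. field. split; now apply Cpow_nz. }
      rewrite Cmod_div, Cmod_pow by (now apply Cpow_nz). apply (proj2 (Rle_div_l _ B (Cmod w ^ k) ltac:(apply pow_lt; now apply Cmod_gt_0))).
      apply A3; lra.
  - intros z Hz. rewrite expansion_terms. apply is_series_Clim. apply Clim_Csum. now apply summ_Ev.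
Qed.

Lemma M_k_MF k h : M_k k h <-> exists a, MF k a /\ forall n, h n = Z.odd (a n).
Proof.
  split.
  - intros [f [a [H1 [H2 H3]]]]. exists a. split; auto. now apply (modular_MF k f).
  - intros [a [H1 H2]]. destruct (MF_modular k a H1). exists (ZE a), a. auto.
Qed.

Local Close Scope R_scope.

(** * Reduction mod 2 *)

Definition red (a : nat -> Z) : ps := fun n => Z.odd (a n).
(** A section of [red], through which [ps] inherits its ring laws from integer power series. *)
Definition lift (h : ps) : nat -> Z := fun n => Z.b2z (h n).

Lemma red_lift h : red (lift h) = h.
Proof. apply functional_extensionality; intros n. unfold red, lift. now destruct (h n). Qed.

Fixpoint bsum (phi : nat -> bool) (n : nat) : bool :=
  match n with O => false | S m => xorb (bsum phi m) (phi m) end.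

Lemma fold_xorb_init l b : fold_right xorb b l = xorb (fold_right xorb false l) b.
Proof. induction l; simpl. now destruct b. rewrite IHl. now rewrite xorb_assoc. Qed.

Lemma fold_bsum phi n : fold_right xorb false (map phi (seq 0 n)) = bsum phi n.
Proof.
  induction n; auto. rewrite seq_S, map_app, fold_right_app. simpl. rewrite xorb_false_r, fold_xorb_init, IHn. reflexivity.
Qed.

Lemma odd_zsum a n : Z.odd (zsum a n) = bsum (fun k => Z.odd (a k)) n.
Proof. induction n; simpl; auto. now rewrite Z.odd_add, IHn. Qed.

Lemma bsum_ext a b n : (forall k, (k < n)%nat -> a k = b k) -> bsum a n = bsum b n.
Proof. induction n; simpl; intros H; auto. rewrite IHn, H; auto. Qed.

Lemma ps_mul_bsum f g n : ps_mul f g n = bsum (fun k => andb (f k) (g (n - k)%nat)) (S n).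
Proof. apply fold_bsum. Qed.

Lemma red_mul a b : red (zmul a b) = ps_mul (red a) (red b).
Proof.
  apply functional_extensionality; intros n. rewrite ps_mul_bsum. unfold red, zmul. rewrite odd_zsum.
  apply bsum_ext. intros. apply Z.odd_mul.
Qed.
Lemma red_add a b : red (zadd a b) = ps_add (red a) (red b).
Proof. apply functional_extensionality; intros n. apply Z.odd_add. Qed.
Lemma red_one : red zone = ps_one.
Proof. apply functional_extensionality; intros n. unfold red, zone, ps_one. now destruct (n =? 0)%nat. Qed.
Lemma red_scal c a : red (zscal c a) = if Z.odd c then red a else ps_zero.
Proof.
  apply functional_extensionality; intros n. unfold red, zscal. rewrite Z.odd_mul. now destruct (Z.odd c).
Qed.
Lemma red_pow a k : red (zpow a k) = ps_pow (red a) k.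
Proof. induction k; simpl. apply red_one. now rewrite red_mul, IHk. Qed.

Lemma ps_mul_comm f g : ps_mul f g = ps_mul g f.
Proof. rewrite <- (red_lift f), <- (red_lift g), <- !red_mul. now rewrite zmul_comm. Qed.
Lemma ps_mul_assoc f g h : ps_mul f (ps_mul g h) = ps_mul (ps_mul f g) h.
Proof. rewrite <- (red_lift f), <- (red_lift g), <- (red_lift h), <- !red_mul. now rewrite zmul_assoc. Qed.
Lemma ps_mul_one_l f : ps_mul ps_one f = f.
Proof. rewrite <- (red_lift f), <- red_one, <- red_mul. now rewrite zmul_one_l. Qed.
Lemma ps_distr_l f g h : ps_mul (ps_add f g) h = ps_add (ps_mul f h) (ps_mul g h).
Proof. rewrite <- (red_lift f), <- (red_lift g), <- (red_lift h), <- !red_add, <- !red_mul, <- red_add. now rewrite zmul_add_l. Qed.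
Lemma ps_add_comm f g : ps_add f g = ps_add g f.
Proof. apply functional_extensionality; intros n. apply xorb_comm. Qed.
Lemma ps_add_assoc f g h : ps_add f (ps_add g h) = ps_add (ps_add f g) h.
Proof. apply functional_extensionality; intros n. unfold ps_add. now rewrite xorb_assoc. Qed.
Lemma ps_add_0_l f : ps_add ps_zero f = f.
Proof. apply functional_extensionality; intros n. unfold ps_add, ps_zero. now destruct (f n). Qed.
Lemma ps_add_same f : ps_add f f = ps_zero.
Proof. apply functional_extensionality; intros n. unfold ps_add, ps_zero. now destruct (f n). Qed.

Lemma ps_mul_0_l f : ps_mul ps_zero f = ps_zero.
Proof. rewrite <- (ps_add_same ps_one) at 1. now rewrite ps_distr_l, ps_mul_one_l, ps_add_same. Qed.

Lemma ps_ring_theory : ring_theory ps_zero ps_one ps_add ps_mul ps_add (fun f => f) eq.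
Proof.
  constructor; auto using ps_add_0_l, ps_add_comm, ps_add_assoc, ps_mul_one_l, ps_mul_comm, ps_mul_assoc, ps_distr_l, ps_add_same.
Qed.

(* Coefficients in bool, so that [ring] knows that 2 = 0. *)
Definition ps_cst (b : bool) : ps := if b then ps_one else ps_zero.
Lemma ps_ring_morph : ring_morph ps_zero ps_one ps_add ps_mul ps_add (fun f => f) eq
  false true xorb andb xorb (fun b => b) Bool.eqb ps_cst.
Proof.
  constructor; auto.
  - intros [] []; simpl; rewrite ?ps_add_same, ?ps_add_0_l, ?(ps_add_comm ps_one), ?ps_add_0_l; auto.
  - intros [] []; simpl; rewrite ?ps_add_same, ?ps_add_0_l, ?(ps_add_comm ps_one), ?ps_add_0_l; auto.
  - intros [] []; simpl; now rewrite ?ps_mul_one_l, ?ps_mul_0_l.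
  - intros [] []; simpl; intros; auto; discriminate.
Qed.

Ltac ps_cst_tac t := match t with
  | ps_zero => constr:(false)
  | ps_one => constr:(true)
  | _ => constr:(InitialRing.NotConstant)
  end.
Add Ring ps_ring : ps_ring_theory (morphism ps_ring_morph, constants [ps_cst_tac]).

Local Open Scope nat_scope.

(** * Squares and parity *)

Lemma bsum_S_l a n : bsum a (S n) = xorb (a O) (bsum (fun k => a (S k)) n).
Proof.
  induction n. simpl. now destruct (a O). change (bsum a (S (S n))) with (xorb (bsum a (S n)) (a (S n))). rewrite IHn.
  simpl. now rewrite xorb_assoc.
Qed.

(** Mirror-image terms cancel in characteristic 2; only a middle term, present when n is odd,
    survives. *)
Lemma bsum_symmetric n : forall phi, (forall k, (k < n)%nat -> phi (n - 1 - k)%nat = phi k) ->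
  bsum phi n = if Nat.odd n then phi (n / 2)%nat else false.
Proof.
  induction n as [n IH] using (well_founded_induction lt_wf). intros phi H.
  destruct n as [|[|n]]; auto.
  change (bsum phi (S (S n))) with (xorb (bsum phi (S n)) (phi (S n))). rewrite bsum_S_l.
  rewrite (IH n ltac:(lia) (fun k => phi (S k))).
  - assert (E := H 0%nat ltac:(lia)). replace (S (S n) - 1 - 0)%nat with (S n) in E by lia. rewrite E.
    change (Nat.odd (S (S n))) with (Nat.odd n). replace (S (S n) / 2)%nat with (S (n / 2)).
    destruct (Nat.odd n), (phi (S (n / 2))), (phi 0%nat); auto.
    replace (S (S n)) with (n + 1 * 2)%nat by lia. rewrite Nat.div_add by lia. lia.
  - intros k Hk. rewrite <- (H (S k)) by lia. f_equal. lia.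
Qed.

(** Frobenius in characteristic 2: the square of h(x) is h(x^2). *)
Lemma ps_square h n : ps_mul h h n = if Nat.even n then h (n / 2)%nat else false.
Proof.
  rewrite ps_mul_bsum, bsum_symmetric.
  - rewrite Nat.odd_succ. destruct (Nat.even n) eqn:E; auto. apply Nat.even_spec in E. destruct E as [k ->].
    replace (S (2 * k)) with (1 + k * 2)%nat by lia. rewrite Nat.div_add by lia. simpl (1 / 2 + k)%nat.
    replace (2 * k)%nat with (k * 2)%nat by lia. rewrite Nat.div_mul by lia. replace (k * 2 - k)%nat with k by lia. now destruct (h k).
  - intros k Hk. replace (n - (S n - 1 - k))%nat with k by lia. replace (S n - 1 - k)%nat with (n - k)%nat by lia. apply andb_comm.
Qed.

(** The grading of the series by the parity of exponents; the zero series belongs to both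
    degrees. *)
Definition par (p : bool) (h : ps) : Prop := forall n, h n = true -> Nat.odd n = p.

Lemma par_add p f g : par p f -> par p g -> par p (ps_add f g).
Proof. intros Hf Hg n. unfold ps_add. specialize (Hf n). specialize (Hg n). destruct (f n), (g n); simpl; auto; discriminate. Qed.
Lemma bsum_true phi n : bsum phi n = true -> exists k, (k < n)%nat /\ phi k = true.
Proof.
  induction n; simpl; [discriminate|]. intros H. destruct (phi n) eqn:E. exists n; auto.
  rewrite xorb_false_r in H. destruct (IHn H) as [k [Hk E']]. exists k; auto.
Qed.
Lemma par_mul p q f g : par p f -> par q g -> par (xorb p q) (ps_mul f g).
Proof.
  intros Hf Hg n H. rewrite ps_mul_bsum in H. destruct (bsum_true _ _ H) as [k [Hk E]]. apply andb_true_iff in E. destruct E as [E1 E2].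
  apply Hf in E1. apply Hg in E2. replace n with (k + (n - k))%nat by lia. rewrite Nat.odd_add. now rewrite E1, E2.
Qed.
Lemma par_one : par false ps_one.
Proof. intros n H. unfold ps_one in H. apply Nat.eqb_eq in H. now subst. Qed.
Lemma par_zero p : par p ps_zero.
Proof. intros n H. discriminate. Qed.
Lemma par_square h : par false (ps_mul h h).
Proof. intros n H. rewrite ps_square in H. rewrite <- Nat.negb_even. now destruct (Nat.even n). Qed.
Lemma par_zero_of_both h : par false h -> par true h -> h = ps_zero.
Proof.
  intros H1 H2. apply functional_extensionality; intros n. specialize (H1 n). specialize (H2 n). unfold ps_zero.
  destruct (h n); auto. rewrite H1 in H2 by auto. specialize (H2 eq_refl). discriminate.
Qed.

(** * Parity of divisor sums *)

Definition sigma_mod2 : ps := red sigma.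

(** An odd divisor of 2k has an even codivisor and contributes nothing mod 2, while an even divisor
    2d of 2k has the same codivisor as the divisor d of k. *)
Lemma sigma_mod2_double k : sigma_mod2 (2 * k)%nat = sigma_mod2 k.
Proof.
  unfold sigma_mod2, red, sigma. rewrite !odd_zsum.
  assert (H : forall N, bsum (fun m => Z.odd (if ((2 * k) mod S m =? 0)%nat then Z.of_nat (2 * k / S m) else 0%Z)) (2 * N) =
    bsum (fun m => Z.odd (if (k mod S m =? 0)%nat then Z.of_nat (k / S m) else 0%Z)) N).
  { induction N; auto. replace (2 * S N)%nat with (S (S (2 * N))) by lia. cbn [bsum]. rewrite IHN, xorb_assoc. f_equal.
    replace (Z.odd (if ((2 * k) mod S (2 * N) =? 0)%nat then Z.of_nat (2 * k / S (2 * N)) else 0%Z)) with false.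
    - rewrite xorb_false_l. replace (S (S (2 * N))) with (2 * S N)%nat by lia. rewrite Nat.Div0.mul_mod_distr_l, Nat.Div0.div_mul_cancel_l by lia.
      destruct (Nat.eqb_spec (2 * (k mod S N)) 0), (Nat.eqb_spec (k mod S N) 0); auto; lia.
    - destruct (Nat.eqb_spec ((2 * k) mod S (2 * N)) 0) as [E|E]; auto.
      apply Nat.Lcm0.mod_divide in E. assert (E2 : Nat.divide (S (2 * N)) k).
      { apply (Nat.gauss _ 2); auto.
        assert (G : Nat.divide (Nat.gcd (S (2 * N)) 2) 1).
        { assert (X := Nat.divide_sub_r _ _ _ (Nat.gcd_divide_l (S (2 * N)) 2) (Nat.divide_mul_r _ N _ (Nat.gcd_divide_r (S (2 * N)) 2))).
          replace (S (2 * N) - N * 2)%nat with 1%nat in X by lia. exact X. }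
        now apply Nat.divide_1_r. }
      destruct E2 as [u ->]. replace (2 * (u * S (2 * N)))%nat with ((2 * u) * S (2 * N))%nat by lia. rewrite Nat.div_mul by lia.
      rewrite Nat2Z.inj_mul, Z.odd_mul. reflexivity. }
  apply H.
Qed.

Lemma odd_of_nat n : Z.odd (Z.of_nat n) = Nat.odd n.
Proof.
  destruct (Nat.odd n) eqn:E.
  - apply Nat.odd_spec in E. destruct E as [k ->]. apply Z.odd_spec. exists (Z.of_nat k). lia.
  - rewrite <- Nat.negb_even in E. apply negb_false_iff, Nat.even_spec in E. destruct E as [k ->].
    rewrite Nat2Z.inj_mul, Z.odd_mul. reflexivity.
Qed.

Definition divs (n : nat) : list nat := filter (fun d => (n mod d =? 0)%nat) (seq 1 n).

Lemma in_divs n d : (0 < n)%nat -> In d (divs n) <-> (0 < d)%nat /\ Nat.divide d n.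
Proof.
  intros Hn. unfold divs. rewrite filter_In, in_seq. split.
  - intros [H1 H2]. apply Nat.eqb_eq in H2. split. lia. now apply Nat.Lcm0.mod_divide.
  - intros [H1 H2]. assert (H3 := Nat.divide_pos_le d n Hn H2). split. lia. apply Nat.eqb_eq. now apply Nat.Lcm0.mod_divide.
Qed.

Lemma NoDup_divs n : NoDup (divs n).
Proof. apply NoDup_filter, seq_NoDup. Qed.

Lemma bsum_filter_length (f : nat -> bool) n : bsum (fun m => f (S m)) n = Nat.odd (length (filter f (seq 1 n))).
Proof.
  induction n; auto. rewrite seq_S, filter_app, length_app, Nat.odd_add. cbn [bsum]. rewrite IHn. f_equal.
  simpl. now destruct (f (S n)).
Qed.

(** All codivisors of an odd number are odd, so the sum of divisors has the parity of their
    number. *)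
Lemma sigma_mod2_odd n : Nat.odd n = true -> sigma_mod2 n = Nat.odd (length (divs n)).
Proof.
  intros Hn. unfold sigma_mod2, red, sigma. rewrite odd_zsum. unfold divs. rewrite <- bsum_filter_length. apply bsum_ext. intros m Hm.
  destruct (Nat.eqb_spec (n mod S m) 0) as [E|E]; auto.
  rewrite odd_of_nat. apply Nat.Lcm0.mod_divide in E. destruct E as [u ->]. rewrite Nat.div_mul by lia.
  rewrite Nat.odd_mul in Hn. now apply andb_true_iff in Hn.
Qed.

Lemma length_split_square n (l : list nat) :
  length l = (length (filter (fun d => d * d <? n) l) + length (filter (fun d => d * d =? n) l) + length (filter (fun d => n <? d * d) l))%nat.
Proof.
  induction l as [|x l IH]; auto. simpl.
  destruct (Nat.ltb_spec (x * x) n), (Nat.eqb_spec (x * x) n), (Nat.ltb_spec n (x * x)); simpl; lia.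
Qed.

(* The involution d -> n / d exchanges the divisors below and above sqrt n. *)
Lemma divs_parity n : (0 < n)%nat ->
  Nat.odd (length (divs n)) = existsb (fun m => (m * m =? n)%nat) (seq 0 (S n)).
Proof.
  intros Hn. rewrite (length_split_square n (divs n)).
  assert (E1 : length (filter (fun d => n <? d * d) (divs n)) = length (filter (fun d => d * d <? n) (divs n))).
  { rewrite <- (length_map (fun d => (n / d)%nat)). apply Permutation_length. apply NoDup_Permutation.
    - apply NoDup_map_NoDup_ForallPairs; [|apply NoDup_filter, NoDup_divs].
      intros x y Hx Hy Hxy. apply filter_In in Hx. apply filter_In in Hy. destruct Hx as [Hx _], Hy as [Hy _].
      apply in_divs in Hx; auto. apply in_divs in Hy; auto. destruct Hx as [Hx [u Hu]], Hy as [Hy [v Hv]].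
      rewrite Hu in Hxy at 1. rewrite Hv in Hxy. rewrite !Nat.div_mul in Hxy by lia. subst v. nia.
    - apply NoDup_filter, NoDup_divs.
    - intros x. rewrite in_map_iff, filter_In. split.
      + intros [d [E Hd]]. apply filter_In in Hd. destruct Hd as [Hd1 Hd2]. apply in_divs in Hd1; auto. destruct Hd1 as [Hd0 [u Hu]].
        apply Nat.ltb_lt in Hd2. rewrite Hu, Nat.div_mul in E by lia. subst x. split.
        * apply in_divs; auto. split. nia. exists d. lia.
        * apply Nat.ltb_lt. nia.
      + intros [Hx1 Hx2]. apply in_divs in Hx1; auto. destruct Hx1 as [Hx0 [u Hu]]. apply Nat.ltb_lt in Hx2.
        exists u. assert (Hu0 : (0 < u)%nat) by nia. split. rewrite Hu. replace (u * x)%nat with (x * u)%nat by lia. now rewrite Nat.div_mul by lia.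
        apply filter_In. split. apply in_divs; auto. split; auto. exists x. lia. apply Nat.ltb_lt. nia. }
  rewrite E1. set (k := length (filter (fun d => d * d <? n) (divs n))).
  replace (k + length (filter (fun d => d * d =? n) (divs n)) + k)%nat with (length (filter (fun d => d * d =? n) (divs n)) + 2 * k)%nat by lia.
  rewrite Nat.odd_add_mul_2.
  destruct (existsb (fun m => (m * m =? n)%nat) (seq 0 (S n))) eqn:E.
  - apply existsb_exists in E. destruct E as [m [_ Hm]]. apply Nat.eqb_eq in Hm.
    replace (filter (fun d => d * d =? n) (divs n)) with [m]; auto.
    symmetry. apply Permutation_length_1_inv. apply NoDup_Permutation. repeat constructor; auto. apply NoDup_filter, NoDup_divs.
    intros x. rewrite filter_In. split.
    + intros [<-|[]]. split. apply in_divs; auto. split. nia. exists m. lia. now apply Nat.eqb_eq.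
    + intros [_ Hx]. apply Nat.eqb_eq in Hx. left. nia.
  - replace (filter (fun d => d * d =? n) (divs n)) with (@nil nat); auto. symmetry.
    destruct (filter (fun d => d * d =? n) (divs n)) as [|x l] eqn:El; auto. exfalso.
    assert (Hx : In x (filter (fun d => d * d =? n) (divs n))) by (rewrite El; now left).
    apply filter_In in Hx. destruct Hx as [_ Hx]. apply Nat.eqb_eq in Hx.
    assert (T : existsb (fun m => (m * m =? n)%nat) (seq 0 (S n)) = true).
    { apply existsb_exists. exists x. split. apply in_seq. nia. now apply Nat.eqb_eq. }
    rewrite T in E. discriminate.
Qed.

Lemma F_odd n : Nat.odd n = true -> F n = sigma_mod2 n.
Proof.
  intros Hn. assert (Hpos : (0 < n)%nat) by (destruct n; [discriminate|lia]). rewrite sigma_mod2_odd, divs_parity by auto. unfold F.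
  apply eq_true_iff_eq. rewrite !existsb_exists. split; intros [m [H1 H2]]; exists m; split; auto.
  - now apply andb_true_iff in H2.
  - apply andb_true_iff. split; auto. apply Nat.eqb_eq in H2. subst n. rewrite Nat.odd_mul in Hn. now apply andb_true_iff in Hn.
Qed.

Lemma par_F : par true F.
Proof.
  intros n H. unfold F in H. apply existsb_exists in H. destruct H as [m [_ H]]. apply andb_true_iff in H. destruct H as [H1 H2].
  apply Nat.eqb_eq in H2. subst n. now rewrite Nat.odd_mul, H1.
Qed.

Lemma par_infl5 p h : par p h -> par p (fun n => andb (n mod 5 =? 0)%nat (h (n / 5)%nat)).
Proof.
  intros H n Hn. apply andb_true_iff in Hn. destruct Hn as [H1 H2]. apply Nat.eqb_eq in H1. apply H in H2.
  assert (E := Nat.div_mod_eq n 5). rewrite H1, Nat.add_0_r in E. rewrite E, Nat.odd_mul, H2. reflexivity.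
Qed.

Lemma par_G : par true G.
Proof. apply (par_infl5 true F par_F). Qed.

Definition psinfl (h : ps) : ps := fun n => andb (n mod 5 =? 0)%nat (h (n / 5)%nat).

Lemma red_infl a : red (zinfl 5 a) = psinfl (red a).
Proof. apply functional_extensionality; intros n. unfold red, zinfl, psinfl. now destruct (n mod 5 =? 0)%nat. Qed.

Lemma red_a4 : red a4 = sigma_mod2.
Proof. unfold a4. rewrite !red_add, !red_scal. simpl. fold sigma_mod2. ring. Qed.

Lemma red_e4 : red e4 = ps_one.
Proof. unfold e4. rewrite red_add, red_one, red_scal. simpl. ring. Qed.

(** Mod 2 only theta^2 a4 is left of [dlt], and theta^2 keeps exactly the odd exponents of the
    divisor sums, where they agree with F. *)
Lemma red_dlt : red dlt = F.
Proof.
  unfold dlt. rewrite red_add, red_mul, red_e4, red_scal. simpl.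
  replace (ps_add (ps_mul (red (ztheta (ztheta a4))) ps_one) ps_zero) with (red (ztheta (ztheta a4))) by ring.
  apply functional_extensionality; intros n. unfold red, ztheta. rewrite !Z.odd_mul, odd_of_nat. change (Z.odd (a4 n)) with (red a4 n). rewrite red_a4.
  destruct (Nat.odd n) eqn:E; simpl. symmetry. now apply F_odd.
  assert (H := par_F n). destruct (F n); auto. rewrite H in E; auto.
Qed.

Lemma red_dlt_5 : red (zinfl 5 dlt) = G.
Proof. rewrite red_infl, red_dlt. reflexivity. Qed.

Definition rho : ps := red bas1.

Lemma rho_eq : rho = ps_add sigma_mod2 (psinfl sigma_mod2).
Proof. unfold rho, bas1. rewrite red_add, red_scal, red_infl, red_a4. reflexivity. Qed.

Lemma red_ee : red ee = rho.
Proof. unfold ee. rewrite red_add, !red_scal, red_infl, rho_eq. reflexivity. Qed.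

Lemma red_bas0 : red bas0 = ps_one.
Proof.
  unfold bas0. rewrite red_infl, red_e4. apply functional_extensionality; intros n. unfold psinfl, ps_one.
  assert (E := Nat.div_mod_eq n 5). apply eq_true_iff_eq. rewrite andb_true_iff, !Nat.eqb_eq. split.
  - intros [H1 H2]. rewrite E, H1, H2. reflexivity.
  - intros ->. split; reflexivity.
Qed.

Lemma red_bas2 : red bas2 = ps_mul rho rho.
Proof.
  unfold bas2. rewrite !red_add, !red_scal, !red_add, red_mul, red_ee, red_scal. simpl. fold rho. ring.
Qed.

(** At an exponent 2k the square contributes the coefficient of rho at k, which equals the one at
    2k, so even exponents cancel. At odd exponents the square is 0, and rho itself is F + G. *)
Lemma rho_add_sq : ps_add rho (ps_mul rho rho) = ps_add F G.
Proof.
  apply functional_extensionality; intros n. unfold ps_add at 1. rewrite ps_square, rho_eq. unfold ps_add, psinfl. change (G n) with (psinfl F n). unfold psinfl.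
  destruct (Nat.even n) eqn:E.
  - apply Nat.even_spec in E. destruct E as [k ->]. replace (2 * k / 2)%nat with k by (rewrite Nat.mul_comm, Nat.div_mul by lia; reflexivity).
    rewrite sigma_mod2_double.
    assert (HF : forall j, F (2 * j)%nat = false). { intros j. assert (H := par_F (2 * j)%nat). destruct (F (2 * j)); auto. specialize (H eq_refl). rewrite Nat.odd_mul in H. discriminate. }
    rewrite HF.
    assert (Hm : ((2 * k) mod 5 =? 0)%nat = (k mod 5 =? 0)%nat).
    { assert (H1 := Nat.div_mod_eq (2 * k) 5). assert (H2 := Nat.div_mod_eq k 5).
      assert (H3 := Nat.mod_upper_bound k 5 ltac:(lia)). assert (H4 := Nat.mod_upper_bound (2 * k) 5 ltac:(lia)).
      destruct (Nat.eqb_spec ((2 * k) mod 5) 0), (Nat.eqb_spec (k mod 5) 0); auto; exfalso; lia. }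
    rewrite Hm. destruct (Nat.eqb_spec (k mod 5) 0) as [E|E]; rewrite ?andb_true_l, ?andb_false_l.
    + assert (H2 := Nat.div_mod_eq k 5). replace (2 * k / 5)%nat with (2 * (k / 5))%nat.
      rewrite sigma_mod2_double, HF. destruct (sigma_mod2 k), (sigma_mod2 (k / 5)%nat); auto.
      rewrite E, Nat.add_0_r in H2. rewrite H2 at 2. replace (2 * (5 * (k / 5)))%nat with ((2 * (k / 5)) * 5)%nat by lia. now rewrite Nat.div_mul by lia.
    + now destruct (sigma_mod2 k).
  - assert (Ho : Nat.odd n = true) by (rewrite <- Nat.negb_even, E; auto). rewrite xorb_false_r, <- F_odd by auto. f_equal.
    destruct (Nat.eqb_spec (n mod 5) 0) as [E5|E5]; auto. rewrite !andb_true_l. symmetry. apply F_odd.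
    assert (H2 := Nat.div_mod_eq n 5). rewrite E5, Nat.add_0_r in H2. rewrite H2, Nat.odd_mul in Ho. now apply andb_true_iff in Ho.
Qed.

(** * Triangular reduction *)

Definition lead (a : nat -> Z) (i : nat) (c : Z) : Prop := (forall n, (n < i)%nat -> a n = 0%Z) /\ a i = c.

Lemma zsum_single a n k : (k < n)%nat -> (forall j, (j < n)%nat -> j <> k -> a j = 0%Z) -> zsum a n = a k.
Proof.
  intros Hk H. induction n; [lia|]. cbn [zsum]. destruct (Nat.eq_dec k n) as [->|Hne].
  - rewrite (zsum_ext _ (fun _ => 0%Z)), zsum_zero by (intros; apply H; lia). ring.
  - rewrite IHn by (try lia; intros; apply H; lia). rewrite (H n) by lia. ring.
Qed.

Lemma lead_mul a b i j c d : lead a i c -> lead b j d -> lead (zmul a b) (i + j) (c * d).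
Proof.
  intros [A1 A2] [B1 B2]. split.
  - intros n Hn. unfold zmul. rewrite (zsum_ext _ (fun _ => 0%Z)), zsum_zero; auto. intros k Hk.
    destruct (Nat.lt_ge_cases k i). rewrite A1; auto; ring. rewrite B1 by lia. ring.
  - unfold zmul. rewrite (zsum_single _ _ i) by (try lia; (intros k Hk Hne; destruct (Nat.lt_ge_cases k i); [rewrite A1; auto; ring|rewrite B1 by lia; ring])).
    replace (i + j - i)%nat with j by lia. now rewrite A2, B2.
Qed.

Lemma lead_pow a i c n : lead a i c -> lead (zpow a n) (n * i) (c ^ Z.of_nat n).
Proof.
  intros H. induction n. split. intros; lia. reflexivity.
  cbn [zpow]. replace (S n * i)%nat with (i + n * i)%nat by lia. replace (c ^ Z.of_nat (S n))%Z with (c * c ^ Z.of_nat n)%Z.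
  now apply lead_mul. rewrite Nat2Z.inj_succ, Z.pow_succ_r; lia.
Qed.

Lemma lead_bas0 : lead bas0 0 1. Proof. split. intros; lia. reflexivity. Qed.
Lemma lead_bas1 : lead bas1 1 15. Proof. split. intros [|n] H; [reflexivity|lia]. reflexivity. Qed.
Lemma lead_bas2 : lead bas2 2 (-45). Proof. split. intros [|[|n]] H; [reflexivity|reflexivity|lia]. reflexivity. Qed.

Lemma ps_pow_add f i j : ps_pow f (i + j) = ps_mul (ps_pow f i) (ps_pow f j).
Proof. induction i; simpl. ring. rewrite IHi. ring. Qed.
Lemma ps_pow_sq f i : ps_pow (ps_mul f f) i = ps_pow f (2 * i).
Proof. replace (2 * i)%nat with (i + i)%nat by lia. rewrite ps_pow_add. induction i; simpl. ring. rewrite IHi. ring. Qed.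
Lemma ps_pow_one i : ps_pow ps_one i = ps_one.
Proof. induction i; simpl; auto. rewrite IHi. ring. Qed.

(** [bas0] fills up the weight without moving the leading exponent or the reduction; there is room
    for it precisely because j <= 2m. *)
Lemma basis_exists m j : (j <= 2 * m)%nat -> exists b c, MF (4 * m) b /\ lead b j c /\ Z.odd c = true /\ red b = ps_pow rho j.
Proof.
  intros Hj. destruct (Nat.Even_or_Odd j) as [[i ->]|[i ->]].
  - exists (zmul (zpow bas2 i) (zpow bas0 (m - i))), ((-45) ^ Z.of_nat i * 1 ^ Z.of_nat (m - i))%Z. split; [|split; [|split]].
    + replace (4 * m)%nat with (i * 4 + (m - i) * 4)%nat by lia. apply MF_mul; apply MF_pow. apply MF_bas2. apply MF_e4_5.
    + replace (2 * i)%nat with (i * 2 + (m - i) * 0)%nat by lia. apply lead_mul; apply lead_pow. apply lead_bas2. apply lead_bas0.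
    + rewrite Z.pow_1_l by lia. rewrite Z.mul_1_r. destruct i; auto. rewrite Z.odd_pow; auto. lia.
    + rewrite red_mul, !red_pow, red_bas0, red_bas2, ps_pow_one, ps_pow_sq. ring.
  - exists (zmul bas1 (zmul (zpow bas2 i) (zpow bas0 (m - 1 - i)))), (15 * ((-45) ^ Z.of_nat i * 1 ^ Z.of_nat (m - 1 - i)))%Z. split; [|split; [|split]].
    + replace (4 * m)%nat with (4 + (i * 4 + (m - 1 - i) * 4))%nat by lia. apply MF_mul. apply MF_bas1. apply MF_mul; apply MF_pow. apply MF_bas2. apply MF_e4_5.
    + replace (2 * i + 1)%nat with (1 + (i * 2 + (m - 1 - i) * 0))%nat by lia. apply lead_mul. apply lead_bas1. apply lead_mul; apply lead_pow. apply lead_bas2. apply lead_bas0.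
    + rewrite Z.pow_1_l by lia. rewrite Z.mul_1_r, Z.odd_mul. destruct i; auto. rewrite Z.odd_pow; auto. lia.
    + rewrite !red_mul, !red_pow, red_bas0, red_bas2, ps_pow_one, ps_pow_sq. fold rho. rewrite Nat.add_1_r. simpl ps_pow. ring.
Qed.

Definition psum {T : Type} (f : T -> ps) (l : list T) : ps := fold_right (fun i acc => ps_add (f i) acc) ps_zero l.
Lemma psum_app {T} (f : T -> ps) l l' : psum f (l ++ l') = ps_add (psum f l) (psum f l').
Proof. induction l; simpl. ring. rewrite IHl. ring. Qed.
(** Elimination of the coefficient at j without division: [a] is multiplied by the odd number c,
    which its reduction does not see. When j passes 2m, [MF_vanishing] ends the process. Keeping the
    lower bound j on the exponents is what [G_rho] relies on. *)
Lemma reduction_span m : forall t j, (j + t = S (2 * m))%nat -> forall a, MF (4 * m) a -> (forall n, (n < j)%nat -> a n = 0%Z) ->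
  exists l, (forall i, In i l -> (j <= i <= 2 * m)%nat) /\ red a = psum (ps_pow rho) l.
Proof.
  induction t; intros j Hj a Ha H0.
  - exists []. split. intros i []. apply functional_extensionality; intros n. unfold red. rewrite (MF_vanishing m a Ha); auto. intros; apply H0; lia.
  - destruct (basis_exists m j ltac:(lia)) as [b [c [Hb [[L1 L2] [Hc Hr]]]]].
    set (a' := zadd (zscal c a) (zscal (- a j) b)).
    destruct (IHt (S j) ltac:(lia) a') as [l [Hl E]].
    + apply MF_add; now apply MF_scal.
    + intros n Hn. unfold a', zadd, zscal. destruct (Nat.eq_dec n j) as [->|Hne]. rewrite L2. ring.
      rewrite H0, L1 by lia. ring.
    + unfold a' in E. rewrite red_add, !red_scal, Hc, Hr, Z.odd_opp in E.
      destruct (Z.odd (a j)) eqn:Ea.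
      * exists (j :: l). split. intros i [<-|Hi]; [lia|]. specialize (Hl i Hi). lia.
        simpl. rewrite <- E. ring.
      * exists l. split. intros i Hi. specialize (Hl i Hi). lia. rewrite <- E. ring.
Qed.

(** * The relation between the two levels *)

Lemma psum_56 (f : nat -> ps) l : (forall i, In i l -> (5 <= i <= 6)%nat) ->
  exists x y : bool, psum f l = ps_add (ps_mul (ps_cst x) (f 5%nat)) (ps_mul (ps_cst y) (f 6%nat)).
Proof.
  induction l as [|i l IH]; intros H.
  - exists false, false. simpl. ring.
  - destruct IH as [x [y E]]; [intros; apply H; now right|].
    assert (Hi : i = 5%nat \/ i = 6%nat) by (specialize (H i ltac:(now left)); lia).
    simpl. rewrite E. destruct Hi as [-> | ->].
    + exists (negb x), y. destruct x; simpl; ring.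
    + exists x, (negb y). destruct y; simpl; ring.
Qed.

Lemma G_rho : G = ps_add (ps_pow rho 5) (ps_pow rho 6).
Proof.
  (* Weight 12 means m = 3, so exponents go up to 6, and order 5 at infinity leaves only 5 and 6.
     Coefficients of x^5 and x^6 then exclude all but one of the four combinations. *)
  destruct (reduction_span 3 2 5 eq_refl (zinfl 5 dlt) MF_dlt_5) as [l [Hl E]].
  { intros n Hn. do 5 (destruct n; [reflexivity|]). lia. }
  destruct (psum_56 (ps_pow rho) l Hl) as [x [y E2]]. rewrite E2, red_dlt_5 in E.
  assert (E5 := f_equal (fun h => h 5%nat) E). assert (E6 := f_equal (fun h => h 6%nat) E). cbv beta in E5, E6.
  destruct x, y; simpl ps_cst in *; rewrite ?ps_mul_one_l, ?ps_mul_0_l in *; auto; exfalso; vm_compute in E5, E6; discriminate.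
Qed.

(** * Splitting polynomials in rho into even and odd parts *)

(** [FaddG] and [rho2] are the series R and s of the overview. *)
Definition FaddG : ps := ps_add F G.
Definition rho2 : ps := ps_mul rho rho.

Lemma rho_split : rho = ps_add FaddG rho2.
Proof. unfold FaddG, rho2. rewrite <- rho_add_sq. ring. Qed.
Lemma FaddG_sq : ps_mul FaddG FaddG = ps_add rho2 (ps_mul rho2 rho2).
Proof. unfold FaddG, rho2. rewrite <- rho_add_sq. ring. Qed.
Lemma G_FaddG : G = ps_mul FaddG (ps_mul rho2 rho2).
Proof. rewrite G_rho. unfold FaddG, rho2. rewrite <- rho_add_sq. simpl ps_pow. ring. Qed.

Lemma par_FaddG : par true FaddG.
Proof. apply par_add. apply par_F. apply par_G. Qed.
Lemma par_rho2 i : par false (ps_pow rho2 i).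
Proof. induction i; simpl. apply par_one. apply (par_mul false false); auto. apply par_square. Qed.

Lemma par_psum_s l : par false (psum (ps_pow rho2) l).
Proof. induction l; simpl. apply par_zero. apply par_add; auto. apply par_rho2. Qed.

Lemma psum_s_shift l : psum (ps_pow rho2) (map S l) = ps_mul rho2 (psum (ps_pow rho2) l).
Proof. induction l; simpl. ring. rewrite IHl. ring. Qed.

(** Multiplying U + R V by rho = R + s gives s (U + V + s V) + R (U + s V), since R^2 = s + s^2. The
    lists in the inductive step encode these two polynomials in s, [map S] being multiplication by
    s. *)
Lemma rho_pow_split i : exists u v, ps_pow rho i = ps_add (psum (ps_pow rho2) u) (ps_mul FaddG (psum (ps_pow rho2) v)).
Proof.
  induction i as [|i [u [v E]]].
  - exists [0], []. simpl. ring.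
  - exists (map S (u ++ v ++ map S v)), (u ++ map S v).
    simpl ps_pow. rewrite E, psum_s_shift, !psum_app, !psum_s_shift.
    assert (H := FaddG_sq). rewrite rho_split at 1.
    transitivity (ps_add (ps_add (ps_mul rho2 (psum (ps_pow rho2) u)) (ps_mul (ps_mul FaddG FaddG) (psum (ps_pow rho2) v)))
      (ps_mul FaddG (ps_add (psum (ps_pow rho2) u) (ps_mul rho2 (psum (ps_pow rho2) v))))). ring. rewrite H. ring.
Qed.

Lemma psum_rho_split l : exists u v, psum (ps_pow rho) l = ps_add (psum (ps_pow rho2) u) (ps_mul FaddG (psum (ps_pow rho2) v)).
Proof.
  induction l as [|i l [u [v E]]].
  - exists [], []. simpl. ring.
  - destruct (rho_pow_split i) as [u' [v' E']]. exists (u' ++ u), (v' ++ v). simpl. rewrite E, E', !psum_app. ring.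
Qed.

(** * Polynomials in F and G of fixed degree parity *)

Definition FG_span (p : bool) (h : ps) : Prop :=
  exists l, (forall x, In x l -> Nat.odd (fst x + snd x) = p) /\ h = sum_FG l.

Lemma sum_FG_app l l' : sum_FG (l ++ l') = ps_add (sum_FG l) (sum_FG l').
Proof. induction l; simpl. ring. rewrite IHl. ring. Qed.

Lemma FG_span_add p f g : FG_span p f -> FG_span p g -> FG_span p (ps_add f g).
Proof.
  intros [l [Hl ->]] [l' [Hl' ->]]. exists (l ++ l'). split.
  - intros x Hx. apply in_app_or in Hx. destruct Hx; auto.
  - now rewrite sum_FG_app.
Qed.

Lemma FG_span_F p h : FG_span p h -> FG_span (negb p) (ps_mul F h).
Proof.
  intros [l [Hl ->]]. exists (map (fun x => (S (fst x), snd x)) l). split.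
  - intros x Hx. apply in_map_iff in Hx. destruct Hx as [y [<- Hy]]. simpl fst. simpl snd. cbn [Nat.add]. rewrite Nat.odd_succ, <- Nat.negb_odd, (Hl y Hy). reflexivity.
  - clear Hl. induction l; simpl. ring. rewrite <- IHl. ring.
Qed.
Lemma FG_span_G p h : FG_span p h -> FG_span (negb p) (ps_mul G h).
Proof.
  intros [l [Hl ->]]. exists (map (fun x => (fst x, S (snd x))) l). split.
  - intros x Hx. apply in_map_iff in Hx. destruct Hx as [y [<- Hy]]. simpl fst. simpl snd. rewrite Nat.add_succ_r, Nat.odd_succ, <- Nat.negb_odd, (Hl y Hy). reflexivity.
  - clear Hl. induction l; simpl. ring. rewrite <- IHl. ring.
Qed.
Lemma FG_span_FaddG p h : FG_span p h -> FG_span (negb p) (ps_mul FaddG h).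
Proof.
  intros H. unfold FaddG. rewrite ps_distr_l. apply FG_span_add. now apply FG_span_F. now apply FG_span_G.
Qed.
Lemma FG_span_one : FG_span false ps_one.
Proof. exists [(0, 0)]. split. intros x [<-|[]]. reflexivity. simpl. ring. Qed.

(** Two consecutive exponents are carried along, because the recursion for R s^(i+2) reaches two
    steps back. *)
Lemma FG_span_FaddG_s i : FG_span true (ps_mul FaddG (ps_pow rho2 i)) /\ FG_span true (ps_mul FaddG (ps_pow rho2 (S i))).
Proof.
  induction i as [|i [IH1 IH2]].
  - assert (H1 := FG_span_FaddG _ _ FG_span_one). split; auto.
    replace (ps_mul FaddG (ps_pow rho2 1)) with (ps_add (ps_mul G ps_one) (ps_mul FaddG (ps_mul FaddG (ps_mul FaddG ps_one)))).
    + apply FG_span_add. now apply (FG_span_G false), FG_span_one. now apply (FG_span_FaddG false), (FG_span_FaddG true).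
    + rewrite G_FaddG. simpl ps_pow. transitivity (ps_mul FaddG (ps_add (ps_mul rho2 rho2) (ps_mul FaddG FaddG))). ring. rewrite FaddG_sq. ring.
  - split; auto.
    replace (ps_mul FaddG (ps_pow rho2 (S (S i)))) with (ps_add (ps_mul FaddG (ps_pow rho2 (S i))) (ps_mul FaddG (ps_mul FaddG (ps_mul FaddG (ps_pow rho2 i))))).
    + apply FG_span_add; auto. now apply (FG_span_FaddG false), (FG_span_FaddG true).
    + simpl ps_pow. transitivity (ps_mul FaddG (ps_mul (ps_pow rho2 i) (ps_add rho2 (ps_mul FaddG FaddG)))). ring. rewrite FaddG_sq. ring.
Qed.

Lemma FG_span_psum l : FG_span true (ps_mul FaddG (psum (ps_pow rho2) l)).
Proof.
  induction l; simpl.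
  - exists []. split. intros x []. simpl. ring.
  - replace (ps_mul FaddG _) with (ps_add (ps_mul FaddG (ps_pow rho2 a)) (ps_mul FaddG (psum (ps_pow rho2) l))) by ring.
    apply FG_span_add; auto. apply FG_span_FaddG_s.
Qed.

Lemma M_odd_FG_span h : M_odd h -> FG_span true h.
Proof.
  intros [[m Hm] Heven]. apply M_k_MF in Hm. destruct Hm as [a [Ha Eh]].
  assert (E : h = red a) by (apply functional_extensionality; exact Eh).
  destruct (reduction_span m (S (2 * m)) 0 (Nat.add_0_l _) a Ha) as [l [_ El]]. { intros n Hn. lia. }
  destruct (psum_rho_split l) as [u [v E2]]. rewrite E2 in El. rewrite <- E in El.
  assert (Hh : par true h).
  { intros n Hn. rewrite <- Nat.negb_even. destruct (Nat.even n) eqn:En; auto. now rewrite Heven in Hn. }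
  assert (HR : par true (ps_mul FaddG (psum (ps_pow rho2) v))) by (apply (par_mul true false); [apply par_FaddG|apply par_psum_s]).
  (* The even part U equals h + R V, a sum of odd series, hence is both even and odd. *)
  assert (Hu : psum (ps_pow rho2) u = ps_zero).
  { apply par_zero_of_both. apply par_psum_s.
    replace (psum (ps_pow rho2) u) with (ps_add h (ps_mul FaddG (psum (ps_pow rho2) v))) by (rewrite El; ring). now apply par_add. }
  rewrite El, Hu, ps_add_0_l. apply FG_span_psum.
Qed.

(** Forms of different weights are brought to a common weight by powers of E4, which reduces to 1;
    this makes the union of the spaces of all weights 4m closed under addition. *)
Lemma red_MF_add f g : (exists m a, MF (4 * m) a /\ f = red a) -> (exists m a, MF (4 * m) a /\ g = red a) ->
  exists m a, MF (4 * m) a /\ ps_add f g = red a.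
Proof.
  intros [m [a [Ha ->]]] [n [b [Hb ->]]]. exists (n + m), (zadd (zmul (zpow e4 n) a) (zmul (zpow e4 m) b)). split.
  - apply MF_add.
    + replace (4 * (n + m)) with (n * 4 + 4 * m) by lia. apply MF_mul; auto. apply MF_pow, MF_e4.
    + replace (4 * (n + m)) with (m * 4 + 4 * n) by lia. apply MF_mul; auto. apply MF_pow, MF_e4.
  - rewrite red_add, !red_mul, !red_pow, red_e4, !ps_pow_one. ring.
Qed.

Lemma red_MF_FG i j : exists m a, MF (4 * m) a /\ ps_mul (ps_pow F i) (ps_pow G j) = red a.
Proof.
  exists (3 * (i + j)), (zmul (zpow dlt i) (zpow (zinfl 5 dlt) j)). split.
  - replace (4 * (3 * (i + j))) with (i * 12 + j * 12) by lia. apply MF_mul; apply MF_pow. apply MF_dlt. apply MF_dlt_5.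
  - now rewrite red_mul, !red_pow, red_dlt, red_dlt_5.
Qed.

Lemma red_MF_zero : exists m a, MF (4 * m) a /\ ps_zero = red a.
Proof.
  exists 1, (zscal 0 e4). split. apply MF_scal, MF_e4. now rewrite red_scal.
Qed.

Lemma par_pow f i : par true f -> par (Nat.odd i) (ps_pow f i).
Proof.
  intros H. induction i. apply par_one. simpl ps_pow.
  replace (Nat.odd (S i)) with (xorb true (Nat.odd i)). now apply par_mul. rewrite Nat.odd_succ, <- Nat.negb_odd. now destruct (Nat.odd i).
Qed.

Lemma FG_span_M_odd h : FG_span true h -> M_odd h.
Proof.
  intros [l [Hl ->]]. split.
  - assert (H : exists m a, MF (4 * m) a /\ sum_FG l = red a).
    { clear Hl. induction l; simpl. apply red_MF_zero. apply red_MF_add; auto. apply red_MF_FG. }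
    destruct H as [m [a [Ha E]]]. exists m. apply M_k_MF. exists a. split; auto. intros n. now rewrite E.
  - assert (H : par true (sum_FG l)).
    { induction l as [|[i j] l IH]; simpl. apply par_zero. apply par_add.
      - rewrite <- (Hl (i, j)) by now left. simpl fst. simpl snd. rewrite Nat.odd_add. apply par_mul; apply par_pow. apply par_F. apply par_G.
      - apply IH. intros x Hx. apply Hl. now right. }
    intros n Hn. specialize (H n). destruct (sum_FG l n); auto. rewrite <- Nat.negb_even, Hn in H. now specialize (H eq_refl).
Qed.

Theorem theorem1p13 :
  forall h : ps,
    M_odd h <->
    exists l : list (nat * nat),
      (forall p, In p l -> Nat.odd (fst p + snd p) = true) /\
      (forall n, h n = sum_FG l n).
Proof.
  intros h. split.
  - intros H. destruct (M_odd_FG_span h H) as [l [Hl E]]. exists l. split; auto. intros n. now rewrite E.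
  - intros [l [Hl E]]. apply FG_span_M_odd. exists l. split; auto. now apply functional_extensionality.
Qed.
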